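(* Let $T:M\to M$ be a nonuniformly hyperbolic transformation with $T$-invariant probability measure $\mu$, constructed from the set $Y$, return time $\tau$, induced map $F=T^\tau:Y\to Y$, quotient uniformly expanding map $\bar F:\bar Y\to\bar Y$, invariant measure $\bar\mu_Y$ and constants $K_0,\rho_0,\theta,K$ as described in the context. Assume that either (1) $\bar\mu_Y(\tau\ge n)\le C_\tau n^{-\beta}$ for some $\beta>1$, $C_\tau>0$ and all $n\ge1$; or (2) $\bar\mu_Y(\tau\ge n)\le C_\tau e^{-An^\gamma}$ for some $A>0$, $\gamma\in(0,1]$, $C_\tau>0$ and all $n\ge1$. Let $\eta\in(0,1]$. Then there exist constants $C>0$, $B>0$, depending continuously on $\lambda=1/\theta$, $K$, $\max\{I_k\}$, $\delta$, $C_\tau$, on $\beta$ (in case (1)) or $A,\gamma$ (in case (2)), and on $\eta$, $\rho_0$ and $K_0$, such that $$\Bigl|\int_M v\,w\circ T^n\,d\mu-\int_M v\,d\mu\int_M w\,d\mu\Bigr|\le C a_n\|v\|_\eta\|w\|_\eta$$ for all $v,w\in C^\eta(M)$ and $n\ge1$, where $a_n=n^{-(\beta-1)}$ in case (1) and $a_n=e^{-Bn^\gamma}$ in case (2).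
   Context: Setting. $T:M\to M$ is a diffeomorphism (possibly with singularities) on a Riemannian manifold $(M,d)$. Fix a subset $Y\subset M$ with a product structure: a family of disjoint ''stable disks'' $\{W^s\}$ covering $Y$ and a family of disjoint ''unstable disks'' $\{W^u\}$ covering $Y$, such that each stable disk intersects each unstable disk in precisely one point. $W^s(y)$, $W^u(y)$ denote the stable and unstable disks containing $y$. There is a partition $\{Y_j\}$ of $Y$ (into unions of stable disks) and integers $\tau(j)\ge1$ with $\gcd\{\tau(j)\}=1$ such that $T^{\tau(j)}(W^s(y))\subset W^s(T^{\tau(j)}y)$ for all $y\in Y_j$. Define $\tau:Y\to\mathbb{Z}^+$ by $\tau|_{Y_j}=\tau(j)$ and the induced map $F:Y\to Y$, $F(y)=T^{\tau(y)}(y)$. The separation time $s(y,z)$ of $y,z\in Y$ is the least integer $n\ge0$ such that $F^ny$ and $F^nz$ lie in distinct elements of $\{Y_j\}$. There exist constants $K_0\ge1$, $\rho_0\in(0,1)$ such that: (i) if $z\in W^s(y)$, then $d(F^ny,F^nz)\le K_0\rho_0^n$; (ii) if $z\in W^u(y)$, then $d(F^ny,F^nz)\le K_0\rho_0^{s(y,z)-n}$; (iii) if $y,z\in Y$, then $d(T^jy,T^jz)\le K_0(d(y,z)+d(Fy,Fz))$ for all $0\le j<\min\{\tau(y),\tau(z)\}$. Quotient. $\bar Y=Y/\sim$, where $y\sim z$ if $y\in W^s(z)$, with quotient map $\bar\pi:Y\to\bar Y$, partition $\alpha=\{\bar Y_j\}$, and well-defined $\tau:\bar Y\to\mathbb{Z}^+$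 and $\bar F:\bar Y\to\bar Y$. Suppose $\bar F$ and $\alpha$ separate points in $\bar Y$ and let $s$ also denote the separation time on $\bar Y$. Fix $\theta\in(0,1)$; $d_\theta(y,z)=\theta^{s(y,z)}$ is a metric on $\bar Y$. Suppose $\bar F$ is uniformly expanding on $(\bar Y,d_\theta)$ with partition $\alpha$ and constants $\lambda=1/\theta$, $K>0$, and exponent $1$, in the following sense: there is a probability measure $\bar m$ on $\bar Y$ for which $\bar F$ is nonsingular; $\alpha$ is an at most countable measurable partition and $\bar F$ restricts to a measure-theoretic bijection from each $a\in\alpha$ onto $\bar Y$; and with $\zeta=\frac{d\bar m}{d\bar m\circ\bar F}$, for all $x,y$ in the same partition element, $d_\theta(\bar Fx,\bar Fy)\ge\lambda d_\theta(x,y)$ and $|\log\zeta(x)-\log\zeta(y)|\le K d_\theta(\bar Fx,\bar Fy)$. Let $\bar\mu_Y$ be the unique absolutely continuous (with respect to $\bar m$) $\bar F$-invariant probability measure on $\bar Y$. Assume $\tau:\bar Y\to\mathbb{Z}^+$ is integrable, and that there is an $F$-invariant probability measure $\mu_Y$ on $Y$ with $\bar\pi_*\mu_Y=\bar\mu_Y$. Data for the return time. There are $\delta>0$ and a finite set of positive integers $\{I_k\}$ with $\gcd\{I_k\}=1$ such that $\bar\mu_Y(\tau=I_k)\ge\delta$ for every $k$; fix such data. Tower and invariant measure. $\Delta=\{(y,\ell)\in Y\times\mathbb{Z}:0\le\ell\le\tau(y)-1\}$, $f(y,\ell)=(y,\ell+1)$ if $\ell\le\tau(y)-2$, $f(y,\ell)=(Fy,0)$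 if $\ell=\tau(y)-1$. With $\bar\tau=\int_Y\tau\,d\mu_Y$, $\mu_\Delta$ is the $f$-invariant probability measure $\mu_\Delta(A\times\{\ell\})=\bar\tau^{-1}\mu_Y(A)$ for measurable $A\subset\{\tau\ge\ell+1\}$. Define $\pi:\Delta\to M$, $\pi(y,\ell)=T^\ell y$; then $\mu=\pi_*\mu_\Delta$ is a $T$-invariant mixing probability measure on $M$. $C^\eta(M)$ is the space of $v:M\to\mathbb{R}$ with $\|v\|_\eta=|v|_\infty+\sup_{x\ne y}|v(x)-v(y)|/d(x,y)^\eta<\infty$. ''Constants depending continuously on parameters'' means that they can be given by continuous functions of those parameters, the same functions for all systems and observables with those parameters. *)

(* Defs.v *)
From HB Require Import structures.
From mathcomp Require Import all_boot all_order all_algebra.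
From mathcomp Require Import all_classical all_reals all_analysis.
Set Implicit Arguments.
Unset Strict Implicit.
Unset Printing Implicit Defensive.
Import Order.TTheory GRing.Theory Num.Theory.
Import numFieldNormedType.Exports.
Local Open Scope classical_set_scope.
Local Open Scope ring_scope.

(* Measurable types are pointed in the library, so a metric space has to be
   pointed (that is, nonempty) before it can carry its Borel sigma-algebra. *)
#[short(type="pointedMetricType")]
HB.structure Definition PointedMetric (K : numDomainType) :=
  { M of Metric K M & isPointed M }.

Notation Borel M := (g_sigma_algebraType (@open M)).

Section holder.
Context (R : realType) (M : pointedMetricType R).
Implicit Type v : M -> R.

Definition sup_norm v : \bar R := ereal_sup [set `|v x|%:E | x in [set: M]].

(* The diagonal is harmless: for eta > 0 its pairs contribute 0 / 0 = 0.
   Keeping it makes the supremum 0, and not -oo, when M is a single point. *)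
Definition holder_seminorm (eta : R) v : \bar R :=
  ereal_sup [set (`|v p.1 - v p.2| / mdist p.1 p.2 `^ eta)%:E
            | p in [set: M * M]].

Definition holder_norm (eta : R) v : \bar R :=
  (sup_norm v + holder_seminorm eta v)%E.

Definition holder_space (eta : R) : set (M -> R) :=
  [set v | (holder_norm eta v < +oo)%E].

End holder.

Section separation_time.
Context (X : Type) (F : X -> X) (D : set nat) (a : nat -> set X).

Definition same_element (x y : X) := exists2 j, D j & a j x /\ a j y.

Definition separated_at (x y : X) (n : nat) :=
  ~ same_element (iter n F x) (iter n F y).

(* [None] stands for an infinite separation time. *)
Definition separation_time (x y : X) : option nat :=
  match pselect (exists n, `[< separated_at x y n >]) with
  | left h => Some (ex_minn h)
  | right _ => None
  end.

Definition separate_points := forall x y, x <> y -> separation_time x y <> None.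

End separation_time.

(* r ^ (s - n) for a possibly infinite s, with r ^ oo = 0 (as 0 < r < 1);
   the exponent is an integer and may be negative. *)
Definition pow_sub (R : realType) (r : R) (s : option nat) (n : nat) : R :=
  if s is Some k then r ^ (k%:Z - n%:Z) else 0.

Definition d_theta (R : realType) (theta : R) (X : Type) (F : X -> X)
    (D : set nat) (a : nat -> set X) (x y : X) : R :=
  pow_sub theta (separation_time F D a x y) 0.

Section uniformly_expanding.
Context (R : realType) (d : measure_display) (X : measurableType d).
Context (F : X -> X) (D : set nat) (a : nat -> set X).
Context (m : probability X R) (zeta : X -> R).

(* F restricts to a bijection, modulo m-null sets, from A onto X; E is the part
   of A on which F is bimeasurable and injective, with image of full measure. *)
Definition measure_bijection_on (A E : set X) :=
  [/\ measurable E, E `<=` A, m (A `\` E) = 0%E, set_inj E F &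
    (forall B, measurable B -> B `<=` E -> measurable (F @` B)) /\
    m (~` (F @` E)) = 0%E].

(* zeta = dm / d(m o F) on A, where (m o F)(B) = m (F B) for B inside A, the
   m-null set A \ E being discarded. *)
Definition density_on (A E : set X) :=
  exists mF : {measure set X -> \bar R},
    (forall B, measurable B -> mF B = m (F @` (B `&` E))) /\
    (forall B, measurable B -> B `<=` A ->
       m B = (\int[mF]_(x in B) (zeta x)%:E)%E).

Record uniformly_expanding (dist : X -> X -> R) (lambda K : R) : Prop := {
  ue_measurable : measurable_fun setT F ;
  ue_nonsingular : forall B, measurable B -> m B = 0%E -> m (F @^-1` B) = 0%E ;
  ue_partition : partition D a setT ;
  ue_measurable_cell : forall j, D j -> measurable (a j) ;
  ue_measurable_density : measurable_fun setT zeta ;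
  (* ln is total in the library, so ln (zeta x) needs zeta x > 0 *)
  ue_density_gt0 : forall x, 0 < zeta x ;
  ue_branch : forall j, D j ->
    exists E, measure_bijection_on (a j) E /\ density_on (a j) E ;
  ue_expansion : forall j x y, D j -> a j x -> a j y ->
    lambda * dist x y <= dist (F x) (F y) ;
  ue_distortion : forall j x y, D j -> a j x -> a j y ->
    `|ln (zeta x) - ln (zeta y)| <= K * dist (F x) (F y) }.

End uniformly_expanding.

(* The partition {Y_j} is indexed by a set [idx] of natural numbers, since it is
   at most countable.  [Y] is a subset of [M]; [tau] and [pibar] matter only on
   [Y], and [muY] is a measure on [M] that gives [Y] full mass.  The tower is a
   subset of [M * nat], and [muDelta] is a measure on that product. *)
Record nuh_data (R : realType) := NUHData {
  M : pointedMetricType R ;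
  T : {mfun Borel M >-> Borel M} ;
  Y : set M ;
  stable : set (set M) ;
  unstable : set (set M) ;
  idx : set nat ;
  cell : nat -> set M ;
  tau_cell : nat -> nat ;
  tau : M -> nat ;
  dYbar : measure_display ;
  Ybar : measurableType dYbar ;
  pibar : Borel M -> Ybar ;
  Fbar : Ybar -> Ybar ;
  taubar : Ybar -> nat ;
  mbar : probability Ybar R ;
  zeta : Ybar -> R ;
  mubar : probability Ybar R ;
  muY : probability (Borel M) R ;
  muDelta : probability (Borel M * nat)%type R }.

Arguments M {R} S : rename.
Arguments T {R} S : rename.
Arguments Y {R} S : rename.
Arguments stable {R} S : rename.
Arguments unstable {R} S : rename.
Arguments idx {R} S : rename.
Arguments cell {R} S : rename.
Arguments tau_cell {R} S : rename.
Arguments tau {R} S : rename.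
Arguments dYbar {R} S : rename.
Arguments Ybar {R} S : rename.
Arguments pibar {R} S : rename.
Arguments Fbar {R} S : rename.
Arguments taubar {R} S : rename.
Arguments mbar {R} S : rename.
Arguments zeta {R} S : rename.
Arguments mubar {R} S : rename.
Arguments muY {R} S : rename.
Arguments muDelta {R} S : rename.

Section nuh.
Context (R : realType) (S : nuh_data R).

(* W is a family of disjoint sets, so this is the member of W containing y. *)
Definition disk_at (W : set (set (M S))) (y : M S) : set (M S) :=
  \bigcup_(V in [set V | W V /\ V y]) V.

Definition induced (y : M S) : M S := iter (tau S y) (T S) y.

Definition cellbar (j : nat) : set (Ybar S) := pibar S @` cell S j.

Definition sep_time (y z : M S) :=
  separation_time induced (idx S) (cell S) y z.

Definition mean_return_time : R := \int[muY S]_(y in Y S) (tau S y)%:R.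

Definition tower : set (M S * nat) := [set p | Y S p.1 /\ (p.2 < tau S p.1)%N].

Definition tower_map (p : M S * nat) : M S * nat :=
  if (p.2.+1 < tau S p.1)%N then (p.1, p.2.+1) else (induced p.1, 0%N).

Definition tower_proj (p : Borel (M S) * nat) : Borel (M S) :=
  iter p.2 (T S) p.1.

Lemma measurable_tower_proj : measurable_fun setT tower_proj.
Proof.
have mT n : measurable_fun setT (fun y : Borel (M S) => iter n (T S) y).
  elim: n => [|n IH] /=; first exact: measurable_id.
  exact: (measurableT_comp (@measurable_funPT _ _ _ _ (T S)) IH).
move=> _ A mA; rewrite setTI.
have -> : tower_proj @^-1` A =
    \bigcup_l (((fun y => iter l (T S) y) @^-1` A) `*` [set l]).
  apply/seteqP; split => [[y l] /= Ayl|[y l] [k _ [/= Aky ->]]] //.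
  by exists l.
apply: bigcupT_measurable => l; apply: measurableX => //.
by rewrite -[X in measurable X]setTI; exact: mT.
Qed.

HB.instance Definition _ := isMeasurableFun.Build _ _ _ _
  tower_proj measurable_tower_proj.

Definition mu : probability (Borel (M S)) R :=
  distribution (muDelta S) tower_proj.

Record nonuniformly_hyperbolic (theta K K0 rho0 : R) : Prop := {
  nuh_theta : 0 < theta < 1 ;
  nuh_K : 0 < K ;
  nuh_K0 : 1 <= K0 ;
  nuh_rho0 : 0 < rho0 < 1 ;
  nuh_measurable_Y : measurable (Y S : set (Borel (M S))) ;
  nuh_stable_disjoint : trivIset (stable S) id ;
  nuh_stable_cover : Y S `<=` \bigcup_(W in stable S) W ;
  nuh_unstable_disjoint : trivIset (unstable S) id ;
  nuh_unstable_cover : Y S `<=` \bigcup_(W in unstable S) W ;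
  nuh_product : forall Ws Wu, stable S Ws -> unstable S Wu ->
    exists x, Ws `&` Wu = [set x] ;
  nuh_partition : partition (idx S) (cell S) (Y S) ;
  nuh_cell_saturated : forall j y, idx S j -> cell S j y ->
    disk_at (stable S) y `<=` cell S j ;
  nuh_tau_ge1 : forall j, idx S j -> (1 <= tau_cell S j)%N ;
  nuh_tau_gcd : forall k : nat,
    (forall j, idx S j -> (k %| tau_cell S j)%N) -> k = 1%N ;
  nuh_tau : forall j y, idx S j -> cell S j y -> tau S y = tau_cell S j ;
  nuh_stable_invariant : forall j y, idx S j -> cell S j y ->
    [set iter (tau_cell S j) (T S) z | z in disk_at (stable S) y]
      `<=` disk_at (stable S) (iter (tau_cell S j) (T S) y) ;
  nuh_induced : forall y, Y S y -> Y S (induced y) ;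
  nuh_contraction : forall y z n, Y S y -> Y S z -> disk_at (stable S) y z ->
    mdist (iter n induced y) (iter n induced z) <= K0 * rho0 ^+ n ;
  nuh_expansion : forall y z n, Y S y -> Y S z -> disk_at (unstable S) y z ->
    mdist (iter n induced y) (iter n induced z)
      <= K0 * pow_sub rho0 (sep_time y z) n ;
  nuh_intermediate : forall y z j, Y S y -> Y S z ->
    (j < minn (tau S y) (tau S z))%N ->
    mdist (iter j (T S) y) (iter j (T S) z)
      <= K0 * (mdist y z + mdist (induced y) (induced z)) ;
  nuh_quotient_surj : pibar S @` Y S = setT ;
  nuh_quotient_eq : forall y z, Y S y -> Y S z ->
    pibar S y = pibar S z <-> disk_at (stable S) z y ;
  nuh_quotient_measurable : measurable_fun (Y S : set (Borel (M S))) (pibar S) ;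
  nuh_Fbar : forall y, Y S y -> Fbar S (pibar S y) = pibar S (induced y) ;
  nuh_taubar : forall y, Y S y -> taubar S (pibar S y) = tau S y ;
  nuh_separate : separate_points (Fbar S) (idx S) cellbar ;
  nuh_uniformly_expanding :
    uniformly_expanding (Fbar S) (idx S) cellbar (mbar S) (zeta S)
      (d_theta theta (Fbar S) (idx S) cellbar) theta^-1 K ;
  nuh_mubar_ac : forall B, measurable B -> mbar S B = 0%E -> mubar S B = 0%E ;
  nuh_mubar_invariant : forall B, measurable B ->
    mubar S (Fbar S @^-1` B) = mubar S B ;
  nuh_tau_integrable :
    (mubar S).-integrable setT (fun y => (taubar S y)%:R%:E) ;
  nuh_muY_full : muY S (Y S) = 1%E ;
  nuh_muY_invariant : forall A : set (Borel (M S)), measurable A ->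
    muY S (Y S `&` induced @^-1` A) = muY S A ;
  nuh_muY_proj : forall B, measurable B ->
    muY S (Y S `&` pibar S @^-1` B) = mubar S B ;
  nuh_muDelta_full : muDelta S tower = 1%E ;
  nuh_muDelta_invariant : forall B : set (Borel (M S) * nat), measurable B ->
    muDelta S (tower `&` tower_map @^-1` B) = muDelta S B ;
  nuh_muDelta : forall (l : nat) (A : set (Borel (M S))), measurable A ->
    A `<=` [set y | Y S y /\ (l.+1 <= tau S y)%N] ->
    muDelta S (A `*` [set l]) = (mean_return_time^-1%:E * muY S A)%E }.

Record return_time_data (I : seq nat) (delta : R) : Prop := {
  rtd_delta : 0 < delta ;
  rtd_pos : forall i, i \in I -> (0 < i)%N ;
  rtd_gcd : \big[gcdn/0%N]_(i <- I) i = 1%N ;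
  rtd_mass : forall i, i \in I ->
    (delta%:E <= mubar S [set y | taubar S y = i])%E }.

Definition correlation (v w : M S -> R) (n : nat) : R :=
  \int[mu]_x (v x * w (iter n (T S) x))
    - (\int[mu]_x v x) * (\int[mu]_x w x).

End nuh.

Arguments induced {R} S y.
Arguments sep_time {R} S y z.
Arguments correlation {R} S v w n.

(* Parameters (lambda, K, max I_k, delta, C_tau, beta, eta, rho_0, K_0) of the
   polynomial case; max I_k ranges over nat with its discrete topology. *)
Definition poly_params (R : realType) : Type :=
  (R * R * nat * R * R * R * R * R * R)%type.

(* Parameters (lambda, K, max I_k, delta, C_tau, A, gamma, eta, rho_0, K_0) of
   the stretched exponential case. *)
Definition exp_params (R : realType) : Type :=
  (R * R * nat * R * R * R * R * R * R * R)%type.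

Definition poly_domain (R : realType) : set (poly_params R) :=
  [set p | let: (lambda, K, N, delta, Ctau, beta, eta, rho0, K0) := p in
     [/\ [/\ 1 < lambda, 0 < K, (0 < N)%N & 0 < delta],
         0 < Ctau, 1 < beta, 0 < eta <= 1 & 0 < rho0 < 1 /\ 1 <= K0]].

Definition exp_domain (R : realType) : set (exp_params R) :=
  [set p | let: (lambda, K, N, delta, Ctau, A, gamma, eta, rho0, K0) := p in
     [/\ [/\ 1 < lambda, 0 < K, (0 < N)%N & 0 < delta],
         0 < Ctau, 0 < A, 0 < gamma <= 1 &
         [/\ 0 < eta <= 1, 0 < rho0 < 1 & 1 <= K0]]].

(* Main.v *)
(* The cells of number at least J are lumped into a single letter of huge return
   time, so that everything happens on the finite set of words read up to a
   given time.  A density that is log-Lipschitz for d_theta becomes a function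
   on words in a cone; returning maps a cone well inside itself, so a fixed
   fraction of the reference measure can be split off.  Since gcd I_k = 1, all
   large times are hit with a probability bounded below, hence two such measures
   can be coupled on a return at a common time; the memory of the initial
   measure satisfies a renewal inequality governed by the tail of tau, which
   gives the rate a_n.  The invariant measure is in the cone because its density
   on the itinerary sigma-algebra is approximated by cylinder functions, which
   bounded distortion pushes into the cone.  Along T^(l + k), with k = n / 8, an
   observable depends on the word alone up to rho^(number of returns): the
   product structure turns agreement of itineraries into contraction in the past
   and in the future.  All constants depend only on a bound N for the parameters
   and are then majorized by a piecewise linear function of the parameters. *)
Require Import Defs.
From mathcomp Require Import all_boot all_order all_algebra.
From mathcomp Require Import all_classical all_reals all_analysis.
From mathcomp Require Import measurable_realfun.
From mathcomp Require Import ring lra zify.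
Import Order.TTheory GRing.Theory Num.Theory.
Import numFieldNormedType.Exports.
Local Open Scope classical_set_scope.
Local Open Scope ring_scope.

Set Implicit Arguments.
Unset Strict Implicit.
Unset Printing Implicit Defensive.

(** * Families of decay rates *)

(** The constants must serve all systems with given parameters, while each system has its own space
    and measures. Two devices reduce this to finite combinatorics. At a fixed time n only a horizon
    H matters, so a measure on the quotient is replaced by its masses on words; H is chosen before
    the truncation level J, and no constant depends on either. The rates are indexed by an exponent
    in a compact range and by a level c in nat; losing a constant always means passing to a level c'
    that is fixed before any system is given. Coupling is not done on pairs of orbits. What decays
    is the supremum minus the infimum of an expected value over all normalized cone elements and all
    remaining times at least n. Allowing all these times makes the quantity nonincreasing in n and
    includes the comparison of different times, which aperiodicity must provide. The same reference
    measure is split off in the supremum and in the infimum, so its unknown expected value cancels.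
    The constant first subtracted from w is not its mean but an expectation in the truncated system.
    It does not depend on v, so testing with v = 1 exchanges it for the mean. *)

Section rates.
Context {R : realType}.

(** Turns a rate into a tail o >= k with value 1 at k = 0, so that its decrements serve as the
    weights of o = k. *)
Definition capped (a : nat -> R) (k : nat) : R :=
  if k is 0 then 1 else Num.min 1 (a k).

(** [A] bounds the tails of return times and [A'] the correlations; [rate_sum] links them, and there
    the polynomial case loses one power. [x] is the exponent and [c] a level, and each closure
    property gives a level that is uniform in [x]. In [rate_solve], the delay [N0.+1] is the time
    that coupling needs and q < 1 is what it leaves. *)
Record decay_rates (X : Type) (A A' : X -> nat -> nat -> R) : Prop := {
  rate_ge0 : forall x c n, 0 <= A x c n ;
  rate_gt0 : forall x c n, 0 < A' x c n ;
  rate_mono : forall x c c' n, (c <= c')%N -> A' x c n <= A' x c' n ;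
  rate_noninc : forall x c n n', (n <= n')%N -> A' x c n' <= A' x c n ;
  rate_scale : forall c k, exists c', forall x n,
    k%:R * A' x c n <= A' x c' n ;
  rate_sum : forall c, exists c', forall x k H,
    \sum_(l < H) A x c (k + l)%N <= A' x c' k ;
  rate_dilate : forall c d, exists c', forall x n,
    A' x c (n %/ d.+1)%N <= A' x c' n ;
  rate_small : forall c k, exists W, forall x, k%:R * A' x c W <= 1 ;
  rate_solve : forall c (q : R) N0, 0 <= q < 1 -> exists c', forall x M H,
    (forall n, (n <= H)%N -> 0 <= M n <= 2) ->
    (forall t, (t + N0.+1 <= H)%N ->
      M (t + N0.+1)%N <= q * (\sum_(k < t.+1)
          (capped (A' x c) k - capped (A' x c) k.+1) * M (t - k)%N)
        + 2 * capped (A' x c) t.+1) ->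
    forall n, (n <= H)%N -> M n <= A' x c' n }.

End rates.

(** * Polynomial rates *)

Section power_rate.
Context {R : realType}.
Implicit Types (x y b : R).

(** Makes tail sums telescope. For r = (x + 1) / x, ln r >= 1 / (x + 1), so r^b >= 1 + b / (x + 1).
    The factor 1 + 2 / b then reduces the claim to (b + 2) / (x + 1 + b) >= 1 / x, an equality at x
    = 1. *)
Lemma powR_bernoulli x b : 1 <= x -> 0 < b ->
  x `^ (- (b + 1)) <= (1 + 2 / b) * (x `^ (- b) - (x + 1) `^ (- b)).
Proof.
move=> x1 b0; have x0 : 0 < x by lra.
have y0 : 0 < (x + 1) / x by rewrite divr_gt0//; lra.
set r := (x + 1) / x.
have lnr : (x + 1)^-1 <= ln r.
  have -> : r = (1 + (- (x + 1)^-1))^-1.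
    rewrite /r; field; apply/andP; split; lra.
  rewrite lnV ?posrE; last first.
    by rewrite subr_gt0 invf_lt1; lra.
  rewrite lerNr; apply: le_ln1Dx; rewrite ltrN2 invf_lt1; lra.
have r_b : 1 + b / (x + 1) <= r `^ b.
  rewrite /powR gt_eqF//; apply: le_trans (expR_ge1Dx _).
  by rewrite lerD2l ler_pM2l.
have xb0 : 0 < x `^ b by exact: powR_gt0.
have e1 : (x + 1) `^ b = x `^ b * r `^ b.
  by rewrite -powRM ?(ltW x0) ?(ltW y0)// /r mulrC divfK// gt_eqF.
rewrite !powRN e1 powRD; last by rewrite (gt_eqF x0) implybT.
rewrite (powRr1 (ltW x0)).
set X := x `^ b in xb0 *; set Rb := r `^ b in r_b *.
have d0 : 0 < b / (x + 1) by rewrite divr_gt0//; lra.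
have Rb0 : 0 < Rb by lra.
have -> : (X * x)^-1 = X^-1 * x^-1 by rewrite invfM.
have -> : (1 + 2 / b) * (X^-1 - (X * Rb)^-1) = X^-1 * ((1 + 2 / b) * (1 - Rb^-1)).
  by field; rewrite !gt_eqF.
rewrite ler_pM2l ?invr_gt0//.
apply: (@le_trans _ _ ((1 + 2 / b) * (1 - (1 + b / (x + 1))^-1))); last first.
  rewrite ler_wpM2l//; first by rewrite addr_ge0// divr_ge0// ltW.
  by rewrite lerD2l lerN2 lef_pV2 ?posrE//; lra.
have -> : (1 + 2 / b) * (1 - (1 + b / (x + 1))^-1) = (b + 2) / (x + 1 + b).
  field; rewrite !gt_eqF//; lra.
rewrite ler_pdivlMr; last lra.
rewrite mulrC ler_pdivrMr//.
nra.
Qed.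

(** The exponent is kept in a compact part of the positive axis, so that every constant below
    depends on N alone. It will be beta - 1. *)
Definition power_range (N : nat) : Type :=
  {b : R | (N.+1%:R^-1 <= b <= N.+1%:R)}.

Definition power_tail N (x : power_range N) (c n : nat) : R :=
  c.+1%:R * n.+1%:R `^ (- (sval x + 1)).

Definition power_rate N (x : power_range N) (c n : nat) : R :=
  c.+1%:R * n.+1%:R `^ (- sval x).

Lemma power_range_gt0 N (x : power_range N) : 0 < sval x.
Proof. by case: x => b /= /andP[+ _]; apply: lt_le_trans; rewrite invr_gt0. Qed.

Lemma power_rate_noninc N (x : power_range N) c n n' : (n <= n')%N ->
  power_rate x c n' <= power_rate x c n.
Proof.
move=> nn; rewrite /power_rate ler_wpM2l// !powRN lef_pV2 ?posrE ?powR_gt0//.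
by apply: ge0_ler_powR; rewrite ?nnegrE ?(ltW (power_range_gt0 x))// ler_nat.
Qed.

Lemma power_rate_sum N c : exists c', forall (x : power_range N) k H,
  \sum_(l < H) power_tail x c (k + l)%N <= power_rate x c' k.
Proof.
exists (c.+1 * (1 + 2 * N.+1))%N => x k H.
have b0 := power_range_gt0 x.
pose u l : R := (k + l).+1%:R `^ (- sval x).
have step l : power_tail x c (k + l)%N <=
    c.+1%:R * (1 + 2 / sval x) * (u l - u l.+1).
  rewrite /power_tail -mulrA ler_wpM2l//.
  have := @powR_bernoulli ((k + l).+1%:R) (sval x).
  rewrite ler1n => /(_ isT b0); rewrite /u addnS.
  by rewrite -(natr1 (k + l).+1).
apply: le_trans; first by apply: ler_sum => l _; exact: step.
rewrite -mulr_sumr.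
have -> : \sum_(l < H) (u l - u l.+1) = u 0%N - u H.
  elim: H => [|H IH]; first by rewrite big_ord0 subrr.
  by rewrite big_ord_recr/= IH; lra.
apply: (@le_trans _ _ (c.+1%:R * (1 + 2 / sval x) * u 0%N)).
  rewrite ler_wpM2l ?mulr_ge0 ?addr_ge0 ?divr_ge0 ?(ltW b0)//.
  by rewrite lerBlDr lerDl powR_ge0.
rewrite /u addn0 /power_rate ler_wpM2r ?powR_ge0//.
have ibN : (sval x)^-1 <= N.+1%:R.
  rewrite -[leRHS]invrK lef_pV2 ?posrE ?invr_gt0//.
  by case: (x) => b /= /andP[].
apply: (@le_trans _ _ (c.+1 * (1 + 2 * N.+1))%:R); last by rewrite ler_nat.
rewrite natrM natrD natrM ler_wpM2l// lerD2l ler_pM2l//.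
Qed.

Lemma power_rate_dilate N c d : exists c', forall (x : power_range N) n,
  power_rate x c (n %/ d.+1)%N <= power_rate x c' n.
Proof.
exists (c.+1 * d.+1 ^ N.+1)%N => x n; have b0 := power_range_gt0 x.
have h : n.+1%:R <= d.+1%:R * (n %/ d.+1).+1%:R :> R.
  rewrite -natrM ler_nat mulnC.
  by have := ltn_ceil n (isT : 0 < d.+1)%N.
have h2 : n.+1%:R `^ sval x <= d.+1%:R ^+ N.+1 * (n %/ d.+1).+1%:R `^ sval x :> R.
  apply: (@le_trans _ _ ((d.+1%:R * (n %/ d.+1).+1%:R) `^ sval x)).
    by apply: ge0_ler_powR; rewrite ?nnegrE ?mulr_ge0 ?(ltW b0).
  rewrite powRM// ler_wpM2r ?powR_ge0// -powR_mulrn//.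
  by apply: ler_powR; rewrite ?ler1n//; case: (x) => b /= /andP[].
rewrite /power_rate !powRN.
apply: (@le_trans _ _ (c.+1%:R * d.+1%:R ^+ N.+1 * (n.+1%:R `^ sval x)^-1)).
  rewrite -mulrA ler_wpM2l// ler_pdivlMr ?powR_gt0// mulrC.
  by rewrite ler_pdivrMr ?powR_gt0.
rewrite ler_wpM2r ?invr_ge0 ?powR_ge0// -natrX -natrM ler_nat; lia.
Qed.

Lemma power_rate_small N c k : exists W, forall (x : power_range N),
  k%:R * power_rate x c W <= 1.
Proof.
exists ((k * c.+1).+1 ^ N.+1)%N => x; have b0 := power_range_gt0 x.
rewrite /power_rate powRN mulrA -natrM ler_pdivrMr ?powR_gt0// mul1r.
apply: (@le_trans _ _ (k * c.+1).+1%:R); first by rewrite ler_nat.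
have -> : (k * c.+1).+1%:R = ((k * c.+1).+1 ^ N.+1)%:R `^ (N.+1%:R^-1) :> R.
  by rewrite natrX -powR_mulrn// -powRrM divff// powRr1.
apply: (@le_trans _ _ (((k * c.+1).+1 ^ N.+1).+1%:R `^ (N.+1%:R^-1))).
  by apply: ge0_ler_powR; rewrite ?nnegrE// ler_nat.
by apply: ler_powR; rewrite ?ler1n//; case: (x) => b /= /andP[].
Qed.

End power_rate.

Section capped_theory.
Context {R : realType} (a : nat -> R).
Hypothesis a_gt0 : forall n, 0 < a n.
Hypothesis a_noninc : forall n n', (n <= n')%N -> a n' <= a n.

Lemma capped_ge0 k : 0 <= capped a k.
Proof. by case: k => [|k] //=; rewrite le_min ler01 (ltW (a_gt0 _)). Qed.

Lemma capped_le1 k : capped a k <= 1.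
Proof. by case: k => [|k] //=; rewrite ge_min lexx. Qed.

Lemma capped_le k : capped a k.+1 <= a k.+1.
Proof. by rewrite /= ge_min lexx orbT. Qed.

Lemma cappedS k : capped a k.+1 <= capped a k.
Proof.
case: k => [|k]; first exact: capped_le1.
rewrite /= le_min ge_min lexx/= ge_min; apply/orP; right; exact: a_noninc.
Qed.

Lemma capped_telescope j m : (j <= m)%N ->
  \sum_(k < m) (capped a k - capped a k.+1) * (j <= k)%:R
    = capped a j - capped a m.
Proof.
elim: m => [|m IH]; first by rewrite leqn0 => /eqP->; rewrite big_ord0 subrr.
rewrite leq_eqVlt big_ord_recr/= => /predU1P[->|].
  rewrite ltnn mulr0 addr0 subrr; apply: big1 => i _.
  by rewrite leqNgt (leq_trans (ltn_ord i)) ?mulr0.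
by rewrite ltnS => jm; rewrite IH// jm mulr1; lra.
Qed.

Lemma capped_total m : \sum_(k < m) (capped a k - capped a k.+1) = 1 - capped a m.
Proof.
rewrite -[X in _ = X - _]/(capped a 0) -(capped_telescope (leq0n m)).
by apply: eq_bigr => i _; rewrite leq0n mulr1.
Qed.

Lemma cappedS_le j k : (j <= k)%N -> capped a k.+1 <= capped a j.+1.
Proof.
elim: k => [|k IH]; first by rewrite leqn0 => /eqP ->.
rewrite leq_eqVlt => /predU1P[->//|/IH]; apply: le_trans; exact: cappedS.
Qed.

(** Up to k0 the terms are bounded by B, beyond k0 by 2; the weights beyond k0 telescope and combine
    with the boundary term into the tail at [k0.+1]. *)
Lemma capped_sum_split (M : nat -> R) (q B : R) k0 t : 0 <= q <= 1 -> 0 <= B ->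
  (k0 <= t)%N -> (forall k, (k <= k0)%N -> M (t - k)%N <= B) ->
  (forall k, (k <= t)%N -> M (t - k)%N <= 2) ->
  q * (\sum_(k < t.+1) (capped a k - capped a k.+1) * M (t - k)%N)
    + 2 * capped a t.+1 <= q * B + 2 * capped a k0.+1.
Proof.
move=> /andP[q0 q1] B0 k0t MB M2.
have hs : \sum_(k < t.+1) (capped a k - capped a k.+1) * M (t - k)%N <=
    \sum_(k < t.+1) ((capped a k - capped a k.+1) * B
      + 2 * ((capped a k - capped a k.+1) * (k0 < k)%:R)).
  apply: ler_sum => k _; have kt : (k <= t)%N by rewrite -ltnS.
  rewrite (mulrCA 2) -mulrDr ler_wpM2l ?subr_ge0 ?cappedS//.
  by have := M2 _ kt; case: ltnP => [_|/MB]; rewrite ?mulr1 ?mulr0; lra.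
rewrite big_split/= -mulr_suml -mulr_sumr capped_total in hs.
rewrite (@capped_telescope k0.+1 t.+1 k0t) in hs.
move: hs (capped_ge0 t.+1) (cappedS_le k0t).
move: (capped a t.+1) (capped a k0.+1) => u v.
set x := \sum_(k < t.+1) _; move: x => x xy u0 uv.
have := mulr_ge0 (mulr_ge0 q0 u0) B0.
have : 0 <= (1 - q) * (v - u) by rewrite mulr_ge0// subr_ge0.
have : q * x <= q * ((1 - u) * B + 2 * (v - u)) by rewrite ler_wpM2l.
lra.
Qed.

End capped_theory.

Section power_solve.
Context {R : realType}.

Lemma power_rate_gt0 N (x : power_range (R:=R) N) c n : 0 < power_rate x c n.
Proof. by rewrite mulr_gt0// powR_gt0. Qed.

Lemma cut_fraction (D N0 t k0 n : nat) : n = (t + N0.+1)%N -> (k0 <= t)%N ->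
  (k0 * (2 * D) <= n.+1)%N -> (2 * D * N0.+1 < n.+1)%N ->
  (D * n.+1 <= D * (t - k0).+1 + n.+1)%N.
Proof.
move=> nt k0t; rewrite nt -(subnK k0t).
by move: (t - k0)%N => r; rewrite addnK => h1 h2; lia.
Qed.

Lemma powR_cut (b kap x y : R) (n : nat) : 0 < b -> b <= n%:R -> 0 < kap < 1 ->
  0 < x -> 0 < y -> (1 - kap) * x <= y ->
  y `^ (- b) <= (1 - kap) ^- n * x `^ (- b).
Proof.
move=> b0 bn /andP[kap0 kap1] x0 y0 xy.
have kap1' : 0 <= 1 - kap by rewrite subr_ge0 ltW.
have kap1'' : 0 < 1 - kap by rewrite subr_gt0.
rewrite !powRN -invfM lef_pV2 ?posrE ?mulr_gt0 ?exprn_gt0 ?powR_gt0//.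
apply: (@le_trans _ _ (((1 - kap) * x) `^ b)).
  rewrite powRM ?(ltW x0)// ler_wpM2r ?powR_ge0//.
  by rewrite -powR_mulrn//; apply: ger_powR => //; rewrite kap1'' gerBl ltW.
by apply: ge0_ler_powR; rewrite ?nnegrE ?mulr_ge0 ?(ltW b0) ?(ltW x0) ?(ltW y0).
Qed.

Lemma bernoulli_le (kap : R) n : 0 <= kap <= 1 -> 1 - n%:R * kap <= (1 - kap) ^+ n.
Proof.
move=> /andP[k0 k1]; elim: n => [|i IHi]; first by rewrite expr0 mul0r subr0.
rewrite exprS -natr1; have i0 : 0 <= i%:R :> R by [].
have : (1 - kap) * (1 - i%:R * kap) <= (1 - kap) * (1 - kap) ^+ i.
  by rewrite ler_wpM2l// subr_ge0.
nra.
Qed.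

(** Strong induction for M n <= K (n + 1)^-b. The sum is split at k0 close to n / (2D). The terms up
    to k0 look back by a fraction at most 1 / D of n, which costs a factor (1 - 1 / D)^-(N + 1), and
    q times this is at most (1 + q) / 2. The rest is a tail at a time of order n, itself O(n^-b),
    and is absorbed by K. *)
Lemma power_rate_solve N c (q : R) N0 : 0 <= q < 1 ->
  exists c', forall (x : power_range N) M H,
    (forall n, (n <= H)%N -> 0 <= M n <= 2) ->
    (forall t, (t + N0.+1 <= H)%N ->
      M (t + N0.+1)%N <= q * (\sum_(k < t.+1)
          (capped (power_rate x c) k - capped (power_rate x c) k.+1)
            * M (t - k)%N)
        + 2 * capped (power_rate x c) t.+1) ->
    forall n, (n <= H)%N -> M n <= power_rate x c' n.
Proof.
move=> /andP[q0 q1].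
(* This D makes (N + 1) / D at most (1 - q) / 2, so (1 - 1 / D)^(N + 1) >= (1 + q) / 2 by Bernoulli,
   and q <= ((1 + q) / 2)^2. *)
have [D D0 hD] : exists2 D, (0 < D)%N & 2 * N.+1%:R / (1 - q) <= D%:R :> R.
  exists (Num.bound (2 * N.+1%:R / (1 - q))).+1 => //.
  rewrite (le_trans (ltW (archi_boundP _)))// ?ler_nat//.
  by rewrite divr_ge0// ?subr_ge0 ?ltW.
have D0R : 0 < D%:R :> R by rewrite ltr0n.
have [Z [Z0 ZE]] : exists Z : R, 0 <= Z /\ Z = c.+1%:R * (2 * D)%:R ^+ N.+1.
  by eexists; split; last reflexivity; rewrite mulr_ge0// exprn_ge0.
have [B [B0 BE]] : exists B : R, 0 <= B /\ B = (2 * D * N0.+1)%:R ^+ N.+1.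
  by eexists; split; last reflexivity; rewrite exprn_ge0.
(* [2 * B] pays for small n, where only M n <= 2 is known, and [4 * Z] for the terms beyond k0. *)
have [K [K0 KB KZ]] : exists K : R, [/\ 0 <= K, 2 * B <= K & 4 * Z <= K * (1 - q)].
  have q1' : 0 < 1 - q by rewrite subr_gt0.
  have dz : 0 <= 4 * Z / (1 - q) by rewrite divr_ge0 ?mulr_ge0// ltW.
  exists (2 * B + 4 * Z / (1 - q)); split; first by rewrite addr_ge0// mulr_ge0.
    by rewrite lerDl.
  by rewrite -ler_pdivrMr// lerDr mulr_ge0.
have [kap [kap0 kap1 kapE kapq]] : exists kap : R,
    [/\ 0 < kap, kap < 1, kap = D%:R^-1 & q * (1 - kap) ^- N.+1 <= (1 + q) / 2].
  have kap0 : 0 < D%:R^-1 :> R by rewrite invr_gt0.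
  have kapN : N.+1%:R * D%:R^-1 <= (1 - q) / 2.
    rewrite ler_pdivrMr// -ler_pdivrMl; last by rewrite divr_gt0// subr_gt0.
    by rewrite invf_div mulrAC.
  have kap1 : D%:R^-1 < 1 :> R.
    have : D%:R^-1 <= N.+1%:R * D%:R^-1 :> R by rewrite ler_peMl ?(ltW kap0)// ler1n.
    by lra.
  exists D%:R^-1; split=> //.
  rewrite ler_pdivrMr ?exprn_gt0 ?subr_gt0//.
  apply: (@le_trans _ _ ((1 + q) / 2 * (1 - N.+1%:R * D%:R^-1))); last first.
    rewrite ler_wpM2l ?divr_ge0 ?addr_ge0//; apply: bernoulli_le.
    by rewrite !ltW.
  by move: (N.+1%:R * D%:R^-1) kapN => z; nra.
exists (Num.bound K) => x M H M02 MH.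
have b0 := power_range_gt0 x.
have bN : sval x <= N.+1%:R by case: (x) => b /= /andP[].
have powN (z : R) : 1 <= z -> z `^ sval x <= z ^+ N.+1.
  by move=> z1; rewrite -powR_mulrn; [exact: ler_powR|rewrite (le_trans ler01)].
suff main n : (n <= H)%N -> M n <= K * n.+1%:R `^ (- sval x).
  move=> n nH; apply: (le_trans (main n nH)).
  rewrite ler_wpM2r ?powR_ge0//; apply: ltW; apply: lt_le_trans (archi_boundP K0) _.
  by rewrite ler_nat.
have [m] := ubnP n; elim: m n => // m IH n; rewrite ltnS => nm nH.
have [small|big] := leqP n.+1 (2 * D * N0.+1)%N.
  have /andP[_ M2] := M02 _ nH; apply: (le_trans M2).
  rewrite powRN ler_pdivlMr ?powR_gt0//; apply: le_trans KB.
  rewrite ler_pM2l// BE; apply: (le_trans (powN _ _)); first by rewrite ler1n.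
  by rewrite lerXn2r ?nnegrE// ler_nat.
have N0n : (N0.+1 <= n)%N.
  rewrite -ltnS; apply: leq_trans big; rewrite ltnS leq_pmull//.
  by rewrite muln_gt0.
have [t nt] : exists t, n = (t + N0.+1)%N by exists (n - N0.+1)%N; rewrite subnK.
have := MH t; rewrite -nt => /(_ nH) Mn; apply: (le_trans Mn) => {Mn MH}.
have [k0 k0h k0n] : exists2 k0, (k0 * (2 * D) <= n.+1)%N & (n.+1 <= 2 * D * k0.+2)%N.
  exists (n.+1 %/ (2 * D))%N; first exact: leq_trunc_div.
  rewrite mulnC; apply: (@leq_trans ((n.+1 %/ (2 * D)).+1 * (2 * D))%N).
    by apply/ltnW/ltn_ceil; rewrite muln_gt0.
  by rewrite leq_mul2r leqnSn orbT.
have k0t : (k0 <= t)%N by move: k0h big D0; rewrite nt; clear; nia.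
have tn i : (i <= t)%N -> (i < n)%N by rewrite nt addnS ltnS => /leq_trans; apply; exact: leq_addr.
have bnd0 i : 0 <= K * i%:R `^ (- sval x) by rewrite mulr_ge0// powR_ge0.
apply: le_trans.
  apply: (@capped_sum_split _ _ (power_rate_gt0 x c) _ M q
    (K * (t - k0).+1%:R `^ (- sval x)) k0 t) => //.
  - by move=> *; apply: power_rate_noninc.
  - by rewrite q0 ltW.
  - move=> k kk; apply: (@le_trans _ _ (K * (t - k).+1%:R `^ (- sval x))).
      apply: IH; first by rewrite (leq_trans (tn _ _))// leq_subr.
      by rewrite (leq_trans _ nH)// ltnW// tn// leq_subr.
    rewrite ler_wpM2l// !powRN lef_pV2 ?posrE ?powR_gt0//.
    by apply: ge0_ler_powR; rewrite ?nnegrE ?(ltW b0)// ler_nat ltnS leq_sub2l.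
  - move=> k kt; suff /M02 /andP[] : (t - k <= H)%N by [].
    by rewrite (leq_trans _ nH)// ltnW// tn// leq_subr.
have n1 : 0 < n.+1%:R :> R by [].
have t1 : (1 - kap) * n.+1%:R <= (t - k0).+1%:R.
  have e := cut_fraction nt k0t k0h big.
  have : (D * n.+1)%:R <= (D * (t - k0).+1 + n.+1)%:R :> R by rewrite ler_nat.
  rewrite natrD !natrM -lerBlDr => e'.
  have -> : (1 - kap) * n.+1%:R = kap * (D%:R * n.+1%:R - n.+1%:R).
    by rewrite kapE; field; rewrite gt_eqF.
  by rewrite kapE mulrC ler_pdivrMr// [leRHS]mulrC.
have b1 : (t - k0).+1%:R `^ (- sval x) <= (1 - kap) ^- N.+1 * n.+1%:R `^ (- sval x).
  by apply: powR_cut => //; rewrite kap0.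
have T2 : capped (power_rate x c) k0.+1 <= Z * n.+1%:R `^ (- sval x).
  apply: (le_trans (capped_le _ _)).
  rewrite /power_rate ZE -mulrA ler_wpM2l// !powRN ler_pdivlMr ?powR_gt0//.
  rewrite mulrC ler_pdivrMr ?powR_gt0//.
  apply: (@le_trans _ _ (((2 * D)%:R * k0.+2%:R) `^ sval x)).
    apply: ge0_ler_powR; rewrite ?nnegrE ?mulr_ge0 ?(ltW b0)//.
    by rewrite -natrM ler_nat.
  rewrite powRM// ler_wpM2r ?powR_ge0//; apply: powN.
  by rewrite ler1n muln_gt0.
move: (n.+1%:R `^ (- sval x)) (powR_ge0 n.+1%:R (- sval x)) b1 T2.
move: (_ `^ (- sval x)) (capped _ _) => u v P P0 b1 T2.
move: ((1 - kap) ^- N.+1) b1 kapq => X b1 Xq.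
have h1 : q * (K * u) <= (1 + q) / 2 * (K * P).
  apply: (@le_trans _ _ (q * X * (K * P))).
    by rewrite -mulrA ler_wpM2l// mulrCA ler_wpM2l.
  by rewrite ler_wpM2r// mulr_ge0.
have h2 : 4 * Z * P <= K * (1 - q) * P by rewrite ler_wpM2r.
move: T2 h1 h2; clear; lra.
Qed.

Lemma power_decay_rates N :
  decay_rates (@power_tail R N) (@power_rate R N).
Proof.
split.
- by move=> x c n; rewrite mulr_ge0// powR_ge0.
- exact: power_rate_gt0.
- by move=> x c c' n cc; rewrite ler_wpM2r ?powR_ge0// ler_nat.
- exact: power_rate_noninc.
- move=> c k; exists (k * c.+1)%N => x n.
  by rewrite mulrA ler_wpM2r ?powR_ge0// -natrM ler_nat.
- exact: power_rate_sum.
- exact: power_rate_dilate.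
- exact: power_rate_small.
- exact: power_rate_solve.
Qed.

End power_solve.

(** * Stretched exponential rates *)

Section stretched_rate.
Context {R : realType}.
Implicit Types (a b g : R).

(** For c in [0, a + b], c / (a + b) <= (c / (a + b))^g because g <= 1; add the cases c = a and c =
    b. *)
Lemma powR_subadditive a b g : 0 <= a -> 0 <= b -> 0 < g <= 1 ->
  (a + b) `^ g <= a `^ g + b `^ g.
Proof.
move=> a0 b0 /andP[g0 g1].
have [s0|s0] := leP (a + b) 0.
  have -> : a + b = 0 by apply/eqP; rewrite eq_le s0 addr_ge0.
  by rewrite powR0 ?gt_eqF// addr_ge0// powR_ge0.
have frac (c : R) : 0 <= c -> c <= a + b -> (a + b) `^ g * (c / (a + b)) <= c `^ g.
  move=> c0 cs; rewrite -{2}[c](divfK (lt0r_neq0 s0)) powRM ?divr_ge0 ?(ltW s0)//.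
  rewrite mulrC ler_wpM2r ?powR_ge0//.
  have [->|c1] := eqVneq c 0; first by rewrite mul0r powR_ge0.
  have c2 : 0 < c by rewrite lt0r c1.
  by apply: ger1_powR => //; rewrite divr_gt0//= ler_pdivrMr// mul1r.
apply: le_trans (lerD (frac a a0 _) (frac b b0 _)); rewrite ?lerDl ?lerDr//.
by rewrite -mulrDr -mulrDl divff ?mulr1// gt_eqF.
Qed.

Definition stretched_range (N : nat) : Type := {g : R | (N.+1%:R^-1 <= g <= 1)}.

(** The level sets both the prefactor and the rate in the exponent, so one index carries every
    loss. *)
Definition stretched_rate N (x : stretched_range N) (c n : nat) : R :=
  c.+1%:R * expR (- (n%:R `^ sval x / c.+1%:R)).

Lemma stretched_range_gt0 N (x : stretched_range N) : 0 < sval x <= 1.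
Proof.
by case: x => g /= /andP[+ ->]; rewrite andbT; apply: lt_le_trans; rewrite invr_gt0.
Qed.

Lemma natpow_le N (x : stretched_range N) n n' : (n <= n')%N ->
  n%:R `^ sval x <= n'%:R `^ sval x.
Proof.
move=> nn; have /andP[x0 _] := stretched_range_gt0 x.
by apply: ge0_ler_powR; rewrite ?nnegrE ?(ltW x0)// ler_nat.
Qed.

Lemma natpow_add N (x : stretched_range N) n m :
  (n + m)%:R `^ sval x <= n%:R `^ sval x + m%:R `^ sval x.
Proof. by rewrite natrD; apply: powR_subadditive => //; exact: stretched_range_gt0. Qed.

Lemma natpow_id N (x : stretched_range N) n : n%:R `^ sval x <= n%:R.
Proof.
have /andP[x0 x1] := stretched_range_gt0 x; case: n => [|n].
  by rewrite powR0// gt_eqF.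
by apply: ler1_powR => //; rewrite ler1n.
Qed.

Lemma natpow_root N (x : stretched_range N) n :
  n%:R <= (n%:R `^ sval x) ^+ N.+1.
Proof.
case: n => [|n]; first by rewrite exprn_ge0// powR_ge0.
rewrite -powR_mulrn ?powR_ge0// -powRrM.
rewrite -[leLHS]powRr1//; apply: ler_powR; first by rewrite ler1n.
case: x => g /= /andP[gN _].
by rewrite -ler_pdivrMr// div1r.
Qed.

(** With m = 3 (N + 1), exp y >= y^m / m! beats l^3 for every exponent at least 1 / (N + 1), and the
    terms telescope against 1 / l - 1 / (l + 1). The weight [l.+1] is the first moment needed in
    [stretched_weights]. *)
Lemma stretched_summable N c : exists S : R, 0 <= S /\
  forall (x : stretched_range N) H,
    \sum_(l < H) l.+1%:R * expR (- (l%:R `^ sval x / c.+1%:R)) <= S.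
Proof.
pose m := (3 * N.+1)%N; pose C : R := 4 * (m`!%:R * c.+1%:R ^+ m).
have C0 : 0 <= C by rewrite mulr_ge0// mulr_ge0// exprn_ge0.
exists (1 + C); split; first by rewrite addr_ge0.
move=> x; case=> [|H]; first by rewrite big_ord0 addr_ge0.
suff : \sum_(l < H.+1) l.+1%:R * expR (- (l%:R `^ sval x / c.+1%:R))
    <= 1 + C * (1 - H.+1%:R^-1).
  by move/le_trans; apply; rewrite lerD2l ler_piMr// gerBl invr_ge0.
have /andP[x0 _] := stretched_range_gt0 x.
elim: H => [|H IH].
  by rewrite big_ord1 powR0 ?gt_eqF// mul0r oppr0 expR0 invr1 subrr mulr0 addr0 mulr1.
rewrite big_ord_recr/=.
suff : H.+2%:R * expR (- (H.+1%:R `^ sval x / c.+1%:R))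
    <= C * (H.+1%:R^-1 - H.+2%:R^-1).
  move=> h; apply: le_trans (lerD IH h) _.
  by rewrite -addrA -mulrDr addrA subrK.
set l := H.+1; have l0 : 0 < l%:R :> R by [].
pose y := l%:R `^ sval x / c.+1%:R.
have y0 : 0 <= y by rewrite divr_ge0// powR_ge0.
have ey : l%:R ^+ 3 / (m`!%:R * c.+1%:R ^+ m) <= expR y.
  apply: (@le_trans _ _ (1 + y ^+ m / m`!%:R)).
    apply: (@le_trans _ _ (y ^+ m / m`!%:R)); last by rewrite lerDr.
    rewrite invfM mulrA mulrAC ler_wpM2r ?invr_ge0// /y expr_div_n.
    rewrite ler_wpM2r ?invr_ge0 ?exprn_ge0// /m mulnC exprM lerXn2r ?nnegrE ?exprn_ge0 ?powR_ge0//.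
    exact: natpow_root.
  by rewrite /m mulSn addnS addSn; apply: expR_ge1Dxn.
have F0 : 0 < m`!%:R * c.+1%:R ^+ m :> R.
  by rewrite mulr_gt0 ?ltr0n ?fact_gt0// exprn_gt0.
rewrite expRN -/y ler_pdivrMr ?expR_gt0//.
have -> : C * (l%:R^-1 - l.+1%:R^-1) = C / (l%:R * l.+1%:R).
  by rewrite -(natr1 l); field; rewrite gt_eqF//= gt_eqF//; lra.
apply: (@le_trans _ _ (C / (l%:R * l.+1%:R) * (l%:R ^+ 3 / (m`!%:R * c.+1%:R ^+ m)))).
  have -> : C / (l%:R * l.+1%:R) * (l%:R ^+ 3 / (m`!%:R * c.+1%:R ^+ m))
      = 4 * l%:R ^+ 2 / l.+1%:R.
    by rewrite /C; move: (_ * _ ^+ m) F0 => F F0; field; rewrite !gt_eqF.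
  rewrite ler_pdivlMr// -!natrM -natrX -natrM ler_nat /l; nia.
by rewrite ler_wpM2l// divr_ge0.
Qed.

Lemma stretched_rate_gt0 N (x : stretched_range N) c n : 0 < stretched_rate x c n.
Proof. by rewrite mulr_gt0// expR_gt0. Qed.

Lemma stretched_rate_mono N (x : stretched_range N) c c' n : (c <= c')%N ->
  stretched_rate x c n <= stretched_rate x c' n.
Proof.
move=> cc; apply: ler_pM; rewrite ?expR_ge0 ?ler_nat//.
rewrite ler_expR lerN2 ler_wpM2l ?powR_ge0// lef_pV2 ?posrE//.
by rewrite ler_nat.
Qed.

Lemma stretched_rate_noninc N (x : stretched_range N) c n n' : (n <= n')%N ->
  stretched_rate x c n' <= stretched_rate x c n.
Proof.
move=> nn; rewrite ler_wpM2l// ler_expR lerN2 ler_wpM2r ?invr_ge0//.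
exact: natpow_le.
Qed.

Lemma stretched_rate_scale N c (K : R) : exists c', forall (x : stretched_range N) n,
  K * stretched_rate x c n <= stretched_rate x c' n.
Proof.
exists (Num.bound (`|K| * c.+1%:R) + c)%N => x n.
have K0 : 0 <= `|K| * c.+1%:R by rewrite mulr_ge0.
rewrite mulrA; apply: (@le_trans _ _ (`|K| * c.+1%:R * expR (- (n%:R `^ sval x / c.+1%:R)))).
  by rewrite ler_wpM2r ?expR_ge0// ler_wpM2r// ler_norm.
apply: ler_pM; rewrite ?expR_ge0//.
  apply: ltW; apply: (lt_le_trans (archi_boundP K0)); rewrite ler_nat.
  by rewrite -addnS leq_addr.
rewrite ler_expR lerN2 ler_wpM2l ?powR_ge0// lef_pV2 ?posrE//.
by rewrite ler_nat ltnS leq_addl.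
Qed.

(* Half of the decay is spent on making the sum converge. *)
Lemma stretched_rate_sum N c : exists c', forall (x : stretched_range N) k H,
  \sum_(l < H) stretched_rate x c (k + l)%N <= stretched_rate x c' k.
Proof.
have [S [S0 hS]] := stretched_summable N (c.*2.+1).
have [c' hc'] := stretched_rate_scale N c.*2.+1 (c.+1%:R * S).
exists c' => x k H; apply: le_trans (hc' x k).
have c2 : c.*2.+2%:R = 2 * c.+1%:R :> R by rewrite -natrM mul2n doubleS.
apply: (@le_trans _ _ (c.+1%:R * S * expR (- (k%:R `^ sval x / c.*2.+2%:R)))); last first.
  rewrite ler_wpM2l ?mulr_ge0// /stretched_rate ler_peMl ?expR_ge0//.
  by rewrite ler1n.
apply: (@le_trans _ _ (c.+1%:R * (\sum_(l < H) l.+1%:R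
    * expR (- (l%:R `^ sval x / c.*2.+2%:R))) * expR (- (k%:R `^ sval x / c.*2.+2%:R)))).
  rewrite -mulrA mulr_suml mulr_sumr; apply: ler_sum => l _.
  rewrite ler_wpM2l// -mulrA -expRD.
  apply: (@le_trans _ _ (expR (- (l%:R `^ sval x / c.*2.+2%:R)
     - k%:R `^ sval x / c.*2.+2%:R))).
    rewrite ler_expR -opprD lerN2 -mulrDl c2 invfM mulrA ler_wpM2r ?invr_ge0//.
    rewrite ler_pdivrMr// mulr_natr mulr2n.
    by apply: lerD; apply: natpow_le; rewrite ?leq_addl ?leq_addr.
  by rewrite ler_peMl ?expR_ge0// ler1n.
by rewrite ler_wpM2r ?expR_ge0// ler_wpM2l.
Qed.

Lemma stretched_rate_dilate N c d : exists c', forall (x : stretched_range N) n,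
  stretched_rate x c (n %/ d.+1)%N <= stretched_rate x c' n.
Proof.
have [c' hc'] := stretched_rate_scale N (c.+1 * d.+1).-1 (expR 1).
exists c' => x n; apply: le_trans (hc' x n).
have cd : (c.+1 * d.+1).-1.+1 = (c.+1 * d.+1)%N by rewrite prednK.
rewrite /stretched_rate cd mulrCA; apply: ler_pM; rewrite ?expR_ge0//.
  by rewrite ler_nat leq_pmulr.
rewrite -expRD ler_expR natrM.
have h : n%:R `^ sval x <= d.+1%:R * ((n %/ d.+1)%:R `^ sval x + 1).
  have /andP[x0 x1] := stretched_range_gt0 x.
  apply: (@le_trans _ _ ((d.+1 * (n %/ d.+1 + 1))%:R `^ sval x)).
    by apply: natpow_le; rewrite mulnC addn1 ltnW// ltn_ceil.
  rewrite natrM powRM// ler_pM ?powR_ge0//; first exact: natpow_id.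
  by apply: (le_trans (natpow_add _ _ _)); rewrite powR1.
have c0 : 0 < c.+1%:R :> R by [].
have d0 : 0 < d.+1%:R :> R by [].
have c1 : 1 <= c.+1%:R :> R by rewrite ler1n.
have h2 : n%:R `^ sval x / (c.+1%:R * d.+1%:R)
    <= (n %/ d.+1)%:R `^ sval x / c.+1%:R + c.+1%:R^-1.
  rewrite -[X in _ + X]mul1r -mulrDl invfM [c.+1%:R^-1 * _]mulrC mulrA.
  by rewrite ler_wpM2r ?invr_ge0// ler_pdivrMr// mulrC.
have h3 : c.+1%:R^-1 <= 1 :> R by rewrite invf_le1.
by rewrite lerNl opprD opprK addrC lerBlDr (le_trans h2)// lerD2l.
Qed.

Lemma stretched_rate_small N c k : exists W, forall (x : stretched_range N),
  k%:R * stretched_rate x c W <= 1.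
Proof.
exists ((k * c.+1 * c.+1) ^ N.+1)%N => x; set w := (k * c.+1 * c.+1)%N.
have h : w%:R <= (w ^ N.+1)%:R `^ sval x :> R.
  have [->|w0] := posnP w; first by rewrite powR_ge0.
  have : (w ^ N.+1)%:R <= ((w ^ N.+1)%:R `^ sval x) ^+ N.+1 :> R.
    exact: natpow_root.
  by rewrite {1}natrX ler_pXn2r ?nnegrE ?powR_ge0.
rewrite /stretched_rate expRN mulrA ler_pdivrMr ?expR_gt0// mul1r.
apply: (@le_trans _ _ (w%:R / c.+1%:R)).
  have -> : w%:R = k%:R * c.+1%:R * c.+1%:R :> R by rewrite /w !natrM.
  by rewrite mulfK ?pnatr_eq0.
apply: (@le_trans _ _ ((w ^ N.+1)%:R `^ sval x / c.+1%:R)).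
  by rewrite ler_wpM2r// invr_ge0.
by apply: le_trans (expR_ge1Dx _); rewrite lerDr.
Qed.

Lemma expR_le1Dxe (y : R) : expR y <= 1 + y * expR y.
Proof.
have := expR_ge1Dx (- y); rewrite -(ler_pM2r (expR_gt0 y)) -expRD addNr expR0.
by rewrite mulrDl mul1r mulNr lerBlDr.
Qed.

(** An exponential moment of small rate b exceeds 1 only by O(b): exp y <= 1 + y exp y, half of the
    decay of the weights absorbs exp (b k^g), and the other half sums the factor k^g <= k. *)
Lemma stretched_weights N (x : stretched_range N) c (b S : R) t :
  0 <= b <= (2 * c.+1%:R)^-1 ->
  \sum_(l < t.+1) l.+1%:R * expR (- (l%:R `^ sval x / c.*2.+2%:R)) <= S ->
  \sum_(k < t.+1) (capped (stretched_rate x c) k - capped (stretched_rate x c) k.+1)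
    * expR (b * k%:R `^ sval x) <= 1 + b * (c.+1%:R * S).
Proof.
move=> /andP[b0 bc] hS; set T := capped (stretched_rate x c).
have x0 := stretched_range_gt0 x.
have T0 k : 0 <= T k by apply: capped_ge0; exact: stretched_rate_gt0.
have TS k : T k.+1 <= T k.
  by apply: cappedS => *; apply: stretched_rate_noninc.
apply: (@le_trans _ _ (\sum_(k < t.+1) (T k - T k.+1)
   + \sum_(k < t.+1) b * (c.+1%:R * (k.+1%:R * expR (- (k%:R `^ sval x / c.*2.+2%:R)))))).
  rewrite -big_split/=; apply: ler_sum => k _.
  apply: (@le_trans _ _ ((T k - T k.+1) * (1 + (b * k%:R `^ sval x) * expR (b * k%:R `^ sval x)))).
    by rewrite ler_wpM2l ?subr_ge0 ?TS ?expR_le1Dxe.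
  rewrite mulrDr mulr1 lerD2l.
  case: (nat_of_ord k) => [|{}k].
    rewrite powR0; last by case/andP: x0 => /gt_eqF ->.
    by rewrite mulr0 mul0r mulr0 !mulr_ge0// expR_ge0.
  apply: (@le_trans _ _ (T k.+1 * ((b * k.+1%:R `^ sval x) * expR (b * k.+1%:R `^ sval x)))).
    by rewrite ler_wpM2r ?gerBl// !mulr_ge0 ?expR_ge0 ?powR_ge0.
  rewrite -mulrA mulrCA ler_wpM2l//.
  apply: (@le_trans _ _ (c.+1%:R * expR (- (k.+1%:R `^ sval x / c.+1%:R))
     * (k.+2%:R * expR (k.+1%:R `^ sval x / (2 * c.+1%:R))))).
    apply: ler_pM; rewrite ?T0 ?mulr_ge0 ?expR_ge0 ?powR_ge0//; first exact: capped_le.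
    apply: ler_pM; rewrite ?expR_ge0 ?powR_ge0//.
      by apply: (le_trans (natpow_id _ _)); rewrite ler_nat.
    by rewrite ler_expR mulrC ler_wpM2l ?powR_ge0.
  rewrite -mulrA ler_wpM2l// mulrCA ler_wpM2l// -expRD ler_expR.
  have -> : c.*2.+2%:R = 2 * c.+1%:R :> R by rewrite -natrM mul2n doubleS.
  rewrite le_eqVlt; apply/orP; left; apply/eqP.
  have : c.+1%:R != 0 :> R by rewrite pnatr_eq0.
  by move: (_ `^ _) (c.+1%:R) => z C C0; field.
rewrite capped_total -mulr_sumr -mulr_sumr lerD ?gerBl//.
by rewrite ler_wpM2l// ler_wpM2l.
Qed.

(** Exponential weights replace the splitting of the polynomial case. With the ansatz M n <= C exp
    (- b n^g), the inequality n^g <= (t - k)^g + k^g + (N0 + 1) turns the renewal sum into the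
    moment of [stretched_weights]; times q it stays below (1 + q) / 2 for small b. *)
Lemma stretched_rate_solve N c (q : R) N0 : 0 <= q < 1 ->
  exists c', forall (x : stretched_range N) M H,
    (forall n, (n <= H)%N -> 0 <= M n <= 2) ->
    (forall t, (t + N0.+1 <= H)%N ->
      M (t + N0.+1)%N <= q * (\sum_(k < t.+1)
          (capped (stretched_rate x c) k - capped (stretched_rate x c) k.+1)
            * M (t - k)%N)
        + 2 * capped (stretched_rate x c) t.+1) ->
    forall n, (n <= H)%N -> M n <= stretched_rate x c' n.
Proof.
move=> /andP[q0 q1].
have [S [S0 hS]] := stretched_summable N (c.*2.+1).
have q1' : 0 < 1 - q by rewrite subr_gt0.
have c0 : 0 < c.+1%:R :> R by [].
have [b [b0 b1 bc bZ]] : exists b : R, [/\ 0 < b, b <= 1, b <= (2 * c.+1%:R)^-1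
    & b * (N0.+1%:R + c.+1%:R * S) <= (1 - q) / 2].
  set Z := N0.+1%:R + _; have Z0 : 0 <= Z by rewrite addr_ge0// mulr_ge0.
  have D0 : 0 < Z + 2 * c.+1%:R + 1 by lra.
  exists ((1 - q) / 2 / (Z + 2 * c.+1%:R + 1)); split.
  - by rewrite !divr_gt0.
  - by rewrite ler_pdivrMr//; lra.
  - rewrite ler_pdivrMr// [leRHS]mulrC ler_pdivlMr ?mulr_gt0//; nra.
  - rewrite mulrAC ler_pdivrMr//; nra.
have [C [C0 C1 C2]] : exists C : R, [/\ 0 <= C, 2 * expR N0.+1%:R <= C
    & 2 * (c.+1%:R * expR N0.+1%:R) <= (1 - q) / 2 * C].
  have e0 := expR_gt0 (N0.+1%:R : R).
  exists (2 * expR N0.+1%:R + 4 * (c.+1%:R * expR N0.+1%:R) / (1 - q)).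
  have d0 : 0 <= 4 * (c.+1%:R * expR N0.+1%:R) / (1 - q).
    by rewrite divr_ge0 ?(ltW q1')// !mulr_ge0// ltW.
  split; [lra|lra|].
  rewrite mulrDr (_ : _ / 2 * (_ / _) = 2 * (c.+1%:R * expR N0.+1%:R)).
    by rewrite lerDr mulr_ge0 ?divr_ge0//; lra.
  by field; rewrite gt_eqF.
have qe : q * expR (b * (N0.+1%:R + c.+1%:R * S)) <= (1 + q) / 2.
  have := expR_ge1Dx (- (b * (N0.+1%:R + c.+1%:R * S))).
  rewrite expRN; move: (b * _) bZ (expR_gt0 (b * (N0.+1%:R + c.+1%:R * S))) => y yq.
  move=> e0 h; rewrite -ler_pdivlMr//.
  apply: (@le_trans _ _ ((1 + q) / 2 * (1 - y))); last first.
    by rewrite ler_wpM2l// divr_ge0//; lra.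
  apply: (@le_trans _ _ ((1 + q) / 2 * ((1 + q) / 2))); last first.
    by rewrite ler_wpM2l//; lra.
  have := sqr_ge0 (1 - q); rewrite expr2; lra.
(* The level is both a prefactor, at least C, and an inverse rate, at least 1 / b. *)
exists (Num.bound C + Num.bound b^-1)%N => x M H M02 MH.
suff main n : (n <= H)%N -> M n <= C * expR (- (b * n%:R `^ sval x)).
  move=> n nH; apply: (le_trans (main n nH)).
  apply: ler_pM; rewrite ?expR_ge0//.
    apply: ltW; apply: (lt_le_trans (archi_boundP C0)).
    by rewrite ler_nat -addnS leq_addr.
  rewrite ler_expR lerN2 mulrC ler_wpM2r ?powR_ge0//.
  rewrite -[leRHS]invrK lef_pV2 ?posrE ?invr_gt0//.
  apply: ltW; apply: lt_le_trans (archi_boundP _) _; first by rewrite invr_ge0 ltW.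
  by rewrite ler_nat leqW// leq_addl.
have [m] := ubnP n; elim: m n => // m IH n; rewrite ltnS => nm nH.
have [small|big] := ltnP n N0.+1.
  have /andP[_ M2] := M02 _ nH; apply: (le_trans M2).
  apply: (@le_trans _ _ (2 * expR N0.+1%:R * expR (- N0.+1%:R))).
    by rewrite -mulrA -expRD subrr expR0 mulr1.
  apply: ler_pM; rewrite ?mulr_ge0 ?expR_ge0// ler_expR lerN2.
  apply: (@le_trans _ _ (1 * n%:R)).
    by apply: ler_pM; rewrite ?powR_ge0 ?(ltW b0)// natpow_id.
  by rewrite mul1r ler_nat ltnW.
have [t nt] : exists t, n = (t + N0.+1)%N by exists (n - N0.+1)%N; rewrite subnK.
have := MH t; rewrite -nt => /(_ nH) Mn; apply: (le_trans Mn) => {Mn MH}.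
pose E := expR (- (b * n%:R `^ sval x)).
have E0 : 0 <= E by exact: expR_ge0.
have ha : \sum_(k < t.+1)
    (capped (stretched_rate x c) k - capped (stretched_rate x c) k.+1) * M (t - k)%N
    <= C * E * expR (b * N0.+1%:R) * (1 + b * (c.+1%:R * S)).
  apply: (@le_trans _ _ (\sum_(k < t.+1)
    (C * E * expR (b * N0.+1%:R)) *
     ((capped (stretched_rate x c) k - capped (stretched_rate x c) k.+1)
       * expR (b * k%:R `^ sval x)))); last first.
    rewrite -mulr_sumr ler_wpM2l ?mulr_ge0 ?expR_ge0//.
    by apply: stretched_weights; rewrite ?hS// ltW.
  apply: ler_sum => k _; rewrite mulrCA ler_wpM2l//.
    by rewrite subr_ge0; apply: cappedS => *; apply: stretched_rate_noninc.
  have kt : (k <= t)%N by rewrite -ltnS.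
  have tkn : (t - k < n)%N by rewrite nt addnS ltnS (leq_trans (leq_subr _ _))// leq_addr.
  apply: (le_trans (IH _ _ _)).
  - exact: leq_trans tkn nm.
  - by rewrite (leq_trans _ nH)// ltnW.
  rewrite -!mulrA ler_wpM2l// -!expRD ler_expR.
  have : n%:R `^ sval x <= (t - k)%:R `^ sval x + (k%:R `^ sval x + N0.+1%:R).
    rewrite (_ : n = (t - k + (k + N0.+1))%N); last by rewrite addnA subnK// nt.
    apply: (le_trans (natpow_add _ _ _)); rewrite lerD2l.
    by apply: (le_trans (natpow_add _ _ _)); rewrite lerD2l natpow_id.
  rewrite -(ler_pM2l b0); lra.
have hb : 2 * capped (stretched_rate x c) t.+1 <= (1 - q) / 2 * C * E.
  apply: (@le_trans _ _ (2 * (c.+1%:R * expR N0.+1%:R) * E)); last by rewrite ler_wpM2r.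
  rewrite -mulrA ler_pM2l//; apply: (le_trans (capped_le _ _)).
  rewrite -mulrA ler_wpM2l// -expRD ler_expR.
  have : n%:R `^ sval x <= t.+1%:R `^ sval x + N0.+1%:R.
    rewrite (_ : n = (t.+1 + N0)%N); last by rewrite nt addnS addSn.
    apply: (le_trans (natpow_add _ _ _)); rewrite lerD2l.
    by apply: (le_trans (natpow_id _ _)); rewrite ler_nat.
  rewrite -(ler_pM2l b0).
  have : b * t.+1%:R `^ sval x <= t.+1%:R `^ sval x / c.+1%:R.
    rewrite mulrC ler_wpM2l ?powR_ge0//; apply: (le_trans bc).
    rewrite lef_pV2 ?posrE ?mulr_gt0//; lra.
  have : b * N0.+1%:R <= N0.+1%:R by rewrite ler_piMl.
  rewrite mulrDr; move: (_ / c.+1%:R) (b * n%:R `^ _) (b * t.+1%:R `^ _) => u v w.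
  by move: (b * N0.+1%:R) (N0.+1%:R) => y z; clear; lra.
apply: le_trans (lerD (ler_wpM2l q0 ha) hb) _.
have hc : q * (C * E * expR (b * N0.+1%:R) * (1 + b * (c.+1%:R * S)))
    <= (1 + q) / 2 * (C * E).
  apply: (@le_trans _ _ (q * expR (b * (N0.+1%:R + c.+1%:R * S)) * (C * E))).
    rewrite (mulrDr b) expRD; have := expR_ge1Dx (b * (c.+1%:R * S)).
    move: (expR (b * (c.+1%:R * S))) (1 + _) (expR (b * _)) (expR_ge0 (b * N0.+1%:R)).
    move=> u v w w0 vu; rewrite (_ : q * (C * E * w * v) = q * (w * v) * (C * E)).
      by rewrite ler_wpM2r ?mulr_ge0// ler_wpM2l// ler_wpM2l.
    by ring.
  by rewrite ler_wpM2r// mulr_ge0.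
apply: le_trans (lerD hc (lexx _)) _.
rewrite -/E -(mulrA ((1 - q) / 2)) -mulrDl (_ : _ / 2 + _ / 2 = 1) ?mul1r//.
by field.
Qed.

Lemma stretched_decay_rates N :
  decay_rates (@stretched_rate N) (@stretched_rate N).
Proof.
split.
- by move=> x c n; exact/ltW/stretched_rate_gt0.
- exact: stretched_rate_gt0.
- exact: stretched_rate_mono.
- exact: stretched_rate_noninc.
- by move=> c k; exact: stretched_rate_scale.
- exact: stretched_rate_sum.
- exact: stretched_rate_dilate.
- exact: stretched_rate_small.
- exact: stretched_rate_solve.
Qed.

End stretched_rate.

(** * Words and cones of measures *)

Section stopping_words.
Variables (J : nat) (tau : nat -> nat).

Fixpoint stop_fuel (f h : nat) : seq (seq nat) :=
  if f is f'.+1 then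
    flatten [seq if (tau j <= h)%N then
                   [seq j :: u | u <- stop_fuel f' (h - tau j)%N]
                 else [:: [:: j]] | j <- iota 0 J.+1]
  else [::].

(* The words over the letters 0, ..., J that are read up to the first time
   exceeding h, when reading the letter j takes the time tau j. *)
Definition stop (h : nat) := stop_fuel h.+1 h.

Definition duration (u : seq nat) : nat := sumn (map tau u).

(** The excluded letter J lumps many cells and is not a single branch, so no distortion bound is
    claimed across it. *)
Definition good (u : seq nat) : bool := all (fun j => (j < J)%N) u.

Hypothesis tau_gt0 : forall j, (0 < tau j)%N.

Lemma stop_fuelS f h : stop_fuel f.+1 h =
  flatten [seq if (tau j <= h)%N then [seq j :: u | u <- stop_fuel f (h - tau j)%N]
               else [:: [:: j]] | j <- iota 0 J.+1].
Proof. by []. Qed.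

Lemma stop_fuelE f h : (h < f)%N -> stop_fuel f h = stop h.
Proof.
rewrite /stop; have [n] := ubnP h; elim: n f h => // n IH [//|f] h.
rewrite !ltnS => hn hf.
rewrite !stop_fuelS; congr flatten; apply: eq_map => j; case: ifP => // jh.
have := tau_gt0 j => j0.
by rewrite IH ?[in RHS]IH//; move: j0 jh hn hf; clear; lia.
Qed.

Lemma sum_stop (R : realType) (F : seq nat -> R) h :
  \sum_(u <- stop h) F u = \sum_(j < J.+1)
    (if (tau j <= h)%N then \sum_(u <- stop (h - tau j)%N) F (val j :: u)
     else F [:: val j]).
Proof.
rewrite {1}/stop stop_fuelS big_flatten big_map.
rewrite -[iota 0 J.+1]/(index_iota 0 J.+1) big_mkord; apply: eq_bigr => j _.
case: ifP => jh; last by rewrite big_seq1.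
rewrite big_map stop_fuelE//; have := tau_gt0 j; lia.
Qed.

(** The strong Markov property on words: stop beyond h, then restart with the time that is left
    until h'. *)
Lemma sum_stop_refine (R : realType) (F : seq nat -> R) h h' : (h <= h')%N ->
  \sum_(u <- stop h') F u = \sum_(u <- stop h)
    (if (duration u <= h')%N
     then \sum_(u' <- stop (h' - duration u)%N) F (u ++ u') else F u).
Proof.
have [n] := ubnP h; elim: n h h' F => // n IH h h' F; rewrite ltnS => hn hh.
rewrite !sum_stop; apply: eq_bigr => j _.
have j0 := tau_gt0 j; case: (leqP (tau j) h) => jh.
  rewrite (leq_trans jh hh) (IH (h - tau j)%N (h' - tau j)%N); last 2 first.
  - by move: j0 jh hn; clear; lia.
  - exact: leq_sub2r.
  apply: eq_bigr => u _; rewrite /duration/= -/(duration u) leq_subRL.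
    by rewrite subnDA.
  exact: leq_trans jh hh.
by rewrite /duration/= addn0.
Qed.

Lemma stopP h u : u \in stop h ->
  [/\ (h < duration u)%N, u != [::] & all (fun j => (j <= J)%N) u].
Proof.
have [n] := ubnP h; elim: n h u => // n IH h u; rewrite ltnS => hn.
rewrite {1}/stop stop_fuelS => /flattenP[s /mapP[j + ->{s}]].
rewrite mem_iota /= add0n ltnS => jJ.
have j0 := tau_gt0 j; case: ifP => jh.
  case/mapP => v; rewrite stop_fuelE; last by move: j0 jh; clear; lia.
  move=> /IH[]; first by move: j0 jh hn; clear; lia.
  move=> hv v0 vJ ->; split => //=; last by rewrite jJ.
  by rewrite /duration/= -/(duration v); move: hv jh; clear; lia.
rewrite inE => /eqP ->; split => //=; last by rewrite jJ.
by rewrite /duration/= addn0 ltnNge jh.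
Qed.

Lemma duration_cat u v : duration (u ++ v) = (duration u + duration v)%N.
Proof. by rewrite /duration map_cat sumn_cat. Qed.

(** The letter J alone outlasts H, so the truncation is invisible in words completed before the
    horizon. *)
Lemma good_stop H h u : (H < tau J)%N -> u \in stop h -> (duration u <= H)%N ->
  good u.
Proof.
move=> HJ /stopP[_ _]; elim: u => //= j u IH /andP[jJ uJ].
rewrite /duration/= -/(duration u) => jH; rewrite IH// ?andbT; last first.
  exact: leq_trans (leq_addl _ _) jH.
rewrite ltn_neqAle jJ andbT; apply/eqP => jE; subst j.
by move: (leq_ltn_trans jH HJ); rewrite ltnNge leq_addr.
Qed.

End stopping_words.

Section cones.
Context {R : realType}.
Variables (J : nat).
Implicit Types (m nu : seq nat -> R) (theta L K : R).

Definition shift nu (w : seq nat) : seq nat -> R := fun u => nu (w ++ u).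

Lemma shift_shift nu v w : shift (shift nu v) w = shift nu (v ++ w).
Proof. by apply/funext => u; rewrite /shift catA. Qed.

Definition additive_words nu :=
  forall w : seq nat, \sum_(j < J.+1) nu (rcons w (val j)) = nu w.

Lemma additive_shift nu w : additive_words nu -> additive_words (shift nu w).
Proof. by move=> h v; rewrite /shift -h; apply: eq_bigr => j _; rewrite rcons_cat. Qed.

(* Masses of cylinders of a measure whose density with respect to the measure
   with cylinder masses m is log-Lipschitz, with constant L, for d_theta. *)
Record cone m theta L nu : Prop := {
  cone_ge0 : forall w, 0 <= nu w ;
  cone_additive : additive_words nu ;
  cone_distortion : forall w u u', good J w ->
    nu (w ++ u) * m (w ++ u')
      <= expR (L * theta ^+ size w) * (nu (w ++ u') * m (w ++ u)) }.

(** The one-branch distortion of the inverse Jacobian along the letter j, cross-multiplied so that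
    null cylinders are allowed. *)
Record reference m theta K : Prop := {
  reference_ge0 : forall w, 0 <= m w ;
  reference_additive : additive_words m ;
  reference_mass : m [::] = 1 ;
  reference_distortion : forall j w u u', good J (j :: w) ->
    m (j :: w ++ u) * m (w ++ u')
      <= expR (K * theta ^+ size w) * (m (j :: w ++ u') * m (w ++ u)) }.

Lemma sum_additive nu : additive_words nu -> \sum_(j < J.+1) nu [:: val j] = nu [::].
Proof. by move=> <-; apply: eq_bigr. Qed.

Lemma sum_stop_mass tau nu h : (forall j, (0 < tau j)%N) -> additive_words nu ->
  \sum_(u <- stop J tau h) nu u = nu [::].
Proof.
move=> tau0; have [n] := ubnP h; elim: n h nu => // n IH h nu; rewrite ltnS => hn nuA.
rewrite sum_stop// -(sum_additive nuA); apply: eq_bigr => j _.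
case: ifP => // jh; have j0 := tau0 j.
rewrite (IH _ (shift nu [:: val j])); last exact: additive_shift.
  by rewrite /shift cats0.
by move: j0 jh hn; clear; lia.
Qed.

Section cone_theory.
Variables (m : seq nat -> R) (theta K L L' : R).
Hypothesis m_ref : reference m theta K.
Hypothesis theta01 : 0 < theta < 1.
Hypothesis K_ge0 : 0 <= K.
Hypothesis L_ge0 : 0 <= L.
Hypothesis LL' : L < L'.
Hypothesis KL : K + theta * L' <= L.

Lemma cone_mono nu : cone m theta L nu -> cone m theta L' nu.
Proof.
case=> n0 nA nd; split=> // w u u' gw; apply: (le_trans (nd w u u' gw)).
case/andP: theta01 => t0 _.
rewrite ler_wpM2r ?mulr_ge0 ?n0 ?(reference_ge0 m_ref)//.
by rewrite ler_expR ler_wpM2r ?exprn_ge0 ?ltW.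
Qed.

Lemma reference_cone : cone m theta L m.
Proof.
split; [exact: reference_ge0 m_ref|exact: reference_additive m_ref|].
move=> w u u' _; rewrite [m (w ++ u) * _]mulrC.
rewrite ler_peMl ?mulr_ge0 ?(reference_ge0 m_ref)// -expR0 ler_expR.
by case/andP: theta01 => t0 _; rewrite mulr_ge0 ?exprn_ge0 ?(ltW t0).
Qed.

Lemma cone_le nu u : cone m theta L' nu -> nu u <= expR L' * (nu [::] * m u).
Proof.
case=> n0 nA nd; have := nd [::] u [::] isT; rewrite !cat0s (reference_mass m_ref).
by rewrite mulr1 expr0 mulr1.
Qed.

Lemma cone_ge nu u : cone m theta L nu -> nu [::] * m u <= expR L * nu u.
Proof.
case=> n0 nA nd; have := nd [::] [::] u isT; rewrite !cat0s (reference_mass m_ref).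
by rewrite mulr1 expr0 mulr1.
Qed.

(** One more letter scales the constant L' by theta, and dividing out the branch adds K; K + theta
    L' <= L. The division is by m (j :: w ++ u'). If this vanishes, the distortion of m makes one of
    two reference masses vanish, and by [cone_le] the left side is 0 in both cases. *)
Lemma cone_shift1 nu j : (j < J)%N -> cone m theta L' nu ->
  cone m theta L (shift nu [:: j]).
Proof.
move=> jJ nuC; have [n0 nA nd] := nuC; split.
- by move=> w; exact: n0.
- exact: additive_shift.
move=> w u u' gw; have gjw : good J (j :: w) by rewrite /= jJ.
rewrite /shift /=.
have m0 := reference_ge0 m_ref.
have H1 := nd (j :: w) u u' gjw.
have H2 := reference_distortion m_ref (u) (u') gjw.
have H3 := cone_le (j :: w ++ u) nuC.
rewrite /= in H1.
case/andP: theta01 => t0 t1.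
have eL : expR (L' * theta ^+ (size w).+1) * expR (K * theta ^+ size w)
    <= expR (L * theta ^+ size w).
  rewrite -expRD ler_expR exprS mulrA -mulrDl ler_wpM2r ?exprn_ge0 ?(ltW t0)//.
  by rewrite addrC (mulrC L').
move: (m0 (j :: w ++ u)) (m0 (j :: w ++ u')) (m0 (w ++ u)) (m0 (w ++ u')).
move: (n0 (j :: w ++ u)) (n0 (j :: w ++ u')) (n0 [::]).
move: eL (expR_ge0 (L' * theta ^+ (size w).+1)) (expR_ge0 (K * theta ^+ size w)) H1 H2 H3.
move: (expR (L * _)) (expR (L' * theta ^+ _)) (expR (K * _)) (expR L').
move: (m (j :: w ++ u)) (m (j :: w ++ u')) (m (w ++ u)) (m (w ++ u')).
move: (nu (j :: w ++ u)) (nu (j :: w ++ u')) (nu [::]).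
move=> a a' n b b' c c' e e1 e2 e3 ee e10 e20 H1 H2 H3 a0 a'0 n0' b0 b'0 c0 c'0.
have [b'E|b'N] := eqVneq b' 0.
  have : b * c' = 0.
    by apply/eqP; rewrite eq_le mulr_ge0// andbT (le_trans H2)// b'E mul0r mulr0.
  move/eqP; rewrite mulf_eq0 => /orP[/eqP bE|/eqP ->]; last first.
    rewrite mulr0 !mulr_ge0//; apply: le_trans ee; exact: mulr_ge0.
  have -> : a = 0 by apply/eqP; rewrite eq_le a0 andbT (le_trans H3)// bE !mulr0.
  rewrite mul0r !mulr_ge0//; apply: le_trans ee; exact: mulr_ge0.
have b'1 : 0 < b' by rewrite lt0r b'N.
rewrite -(ler_pM2r b'1).
apply: (@le_trans _ _ (e1 * (a' * b) * c')).
  by rewrite mulrAC ler_wpM2r.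
apply: (@le_trans _ _ (e1 * a' * (e2 * (b' * c)))).
  by rewrite -!mulrA ler_wpM2l// ler_wpM2l.
have -> : e1 * a' * (e2 * (b' * c)) = (e1 * e2) * (a' * c * b') by ring.
by rewrite -(mulrA e) ler_wpM2r ?mulr_ge0.
Qed.

Lemma cone_shift nu w : good J w -> w != [::] -> cone m theta L' nu ->
  cone m theta L (shift nu w).
Proof.
elim: w nu => // j w IH nu /= /andP[jJ gw] _ nuC.
have := cone_shift1 jJ nuC; case: w IH gw => [//|j' w] IH gw nuj.
rewrite -(cat1s j) -shift_shift; apply: IH => //; exact: cone_mono.
Qed.

(** For a = [theta ^+ size w], the subtraction in [cone_extract] requires extraction (exp (L' a) -
    1) <= (exp (L' a) - exp (L a)) exp (- L). Bounding exp (L' a) - 1 above by a L' exp L' and the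
    difference below by (L' - L) a gives this ratio. *)
Definition extraction := (L' - L) * expR (- L) / (L' * expR L').

Lemma extraction_gt0 : 0 < extraction.
Proof.
by rewrite divr_gt0// mulr_gt0 ?expR_gt0 ?subr_gt0//; exact: le_lt_trans LL'.
Qed.

(* A multiple of the reference measure can be subtracted at the price of
   increasing the log-Lipschitz constant of the density from L to L'. *)
Lemma cone_extract nu : cone m theta L nu ->
  cone m theta L' (fun u => nu u - extraction * nu [::] * m u).
Proof.
move=> nuC; have [n0 nA nd] := nuC; have m0 := reference_ge0 m_ref.
have e0 := extraction_gt0; have L'0 : 0 < L' by exact: le_lt_trans LL'.
have eL : extraction * (L' * expR L') = (L' - L) * expR (- L).
  by rewrite /extraction divfK// gt_eqF// mulr_gt0 ?expR_gt0.
have low u : nu [::] * m u * expR (- L) <= nu u.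
  by rewrite expRN ler_pdivrMr ?expR_gt0// mulrC (mulrC (nu u)) mulrC; exact: cone_ge.
split.
- move=> w; rewrite subr_ge0 -mulrA mulrC; apply: le_trans (low w).
  rewrite ler_wpM2l ?mulr_ge0// ltW//.
  rewrite -(ltr_pM2r (mulr_gt0 L'0 (expR_gt0 L'))) eL mulrC ltr_pM2l ?expR_gt0//.
  apply: (@le_lt_trans _ _ L'); first by rewrite gerBl.
  by rewrite ltr_pMr// expR_gt1.
- move=> w; rewrite sumrB nA; congr (_ - _); rewrite -mulr_sumr.
  by rewrite (reference_additive m_ref).
move=> w u u' gw; have := nd w u u' gw; have := low (w ++ u').
have := m0 (w ++ u); have := m0 (w ++ u').
case/andP: theta01 => t0 t1.
have a0 : 0 <= theta ^+ size w by rewrite exprn_ge0 ?ltW.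
have a1 : theta ^+ size w <= 1 by rewrite exprn_ile1 ?ltW.
move: (theta ^+ size w) a0 a1 => a a0 a1.
have x1 : expR (L' * a) - 1 <= a * (L' * expR L').
  have := expR_ge1Dx (- (L' * a)); rewrite -(ler_pM2r (expR_gt0 (L' * a))).
  rewrite -expRD addNr expR0 mulrDl mul1r mulNr lerBlDr => h.
  rewrite lerBlDl; apply: (le_trans h); rewrite lerD2l mulrA [a * L']mulrC.
  rewrite ler_wpM2l ?mulr_ge0 ?(ltW L'0)// ler_expR.
  by rewrite ler_piMr ?(ltW L'0).
have x2 : (L' - L) * a <= expR (L' * a) - expR (L * a).
  have -> : expR (L' * a) = expR (L * a) * expR ((L' - L) * a).
    by rewrite -expRD -mulrDl addrC subrK.
  have l1 : 1 <= expR (L * a) by rewrite -expR0 ler_expR mulr_ge0.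
  have l2 := expR_ge1Dx ((L' - L) * a).
  have l3 : 0 <= (L' - L) * a by rewrite mulr_ge0// subr_ge0 ltW.
  nra.
have key : extraction * (expR (L' * a) - 1)
    <= (expR (L' * a) - expR (L * a)) * expR (- L).
  apply: (@le_trans _ _ (a * (extraction * (L' * expR L')))).
    by rewrite mulrCA ler_wpM2l// ltW.
  by rewrite eL mulrCA mulrA ler_wpM2r ?expR_ge0.
have x3 : 0 <= expR (L' * a) - expR (L * a).
  by apply: le_trans x2; rewrite mulr_ge0// subr_ge0 ltW.
move: key x3 (n0 [::]); clear.
move: extraction (expR (L' * a)) (expR (L * a)) (expR (- L)).
move: (nu (w ++ u)) (nu (w ++ u')) (m (w ++ u)) (m (w ++ u')) (nu [::]).
move=> a1 a' b b' n e x x' y key x3 n0 b'0 b0 low dist.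
have h1 : e * (x - 1) * (n * b') <= (x - x') * a'.
  apply: (@le_trans _ _ ((x - x') * y * (n * b'))).
    by rewrite ler_wpM2r// mulr_ge0.
  by rewrite -mulrA ler_wpM2l// mulrC.
have h2 : e * (x - 1) * (n * b') * b <= (x - x') * a' * b by rewrite ler_wpM2r.
lra.
Qed.

End cone_theory.
End cones.

(** * Loss of memory of the return process *)

Section abel.
Context {R : realType}.

Lemma abel_sum (T F : nat -> R) n : T 0%N = 1 ->
  F 0%N + \sum_(k < n) (F k.+1 - F k) * T k.+1
    = \sum_(k < n) (T k - T k.+1) * F k + T n * F n.
Proof.
move=> T0; elim: n => [|n IH]; first by rewrite !big_ord0 T0 mul1r addr0 add0r.
by rewrite !big_ord_recr/= addrA IH; ring.
Qed.

(** Stochastic domination. Abel summation writes a mean of F through its increments and the tails of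
    o; the increments are nonnegative, so larger tails give a larger mean. *)
Lemma weighted_tail_le (I : Type) (r : seq I) (w : I -> R) (o : I -> nat)
    (T F : nat -> R) n :
  T 0%N = 1 -> (forall i, 0 <= w i) -> \sum_(i <- r) w i = 1 ->
  (forall k, (k < n)%N -> \sum_(i <- r) (k < o i)%:R * w i <= T k.+1) ->
  (forall k, (k < n)%N -> F k <= F k.+1) ->
  \sum_(i <- r) w i * F (minn (o i) n)
    <= \sum_(k < n) (T k - T k.+1) * F k + T n * F n.
Proof.
move=> T0 w0 w1 wT FF; rewrite -abel_sum//.
have FE i : F (minn (o i) n) = F 0%N + \sum_(k < n) (F k.+1 - F k) * (k < o i)%:R.
  elim: n {wT FF} => [|n IH]; first by rewrite minn0 big_ord0 addr0.
  rewrite big_ord_recr/= addrA -IH; have [no|] := boolP (n < o i)%N.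
    by rewrite (minn_idPr no) (minn_idPr (ltnW no)) mulr1 addrC subrK.
  rewrite -leqNgt => no.
  by rewrite (minn_idPl no) (minn_idPl (leqW no)) mulr0 addr0.
under eq_bigr do rewrite FE mulrDr mulr_sumr.
rewrite big_split/= -mulr_suml w1 mul1r lerD2l exchange_big/=.
apply: ler_sum => k _.
under eq_bigr do rewrite mulrC -mulrA.
by rewrite -mulr_sumr ler_wpM2l ?subr_ge0 ?FF ?wT.
Qed.

End abel.

Section one_step.
Context {R : realType}.
Variables (J H : nat) (tau : nat -> nat).
Variables (m : seq nat -> R) (theta K L L' : R).
Hypothesis tau_gt0 : forall j, (0 < tau j)%N.
Hypothesis tauJ : (H < tau J)%N.
Hypothesis m_ref : reference J m theta K.
Hypothesis theta01 : 0 < theta < 1.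
Hypothesis K_ge0 : 0 <= K.
Hypothesis L_ge0 : 0 <= L.
Hypothesis LL' : L < L'.
Hypothesis KL : K + theta * L' <= L.
Implicit Type nu : seq nat -> R.

Let state := cone J m theta L'.
Let stopt := stop J tau.
Let dur := duration tau.

Lemma state_shift nu h u : state nu -> u \in stopt h -> (dur u <= H)%N ->
  cone J m theta L (shift nu u).
Proof.
move=> nuC us uH; have [_ u0 _] := stopP tau_gt0 us.
by apply: (cone_shift m_ref theta01 LL' KL) => //; exact: good_stop us uH.
Qed.

Lemma state_shiftW nu h u : state nu -> u \in stopt h -> (dur u <= H)%N ->
  state (shift nu u).
Proof. by move=> nuC us uH; apply: (cone_mono m_ref theta01 LL'); exact: state_shift us uH. Qed.

Lemma reference_state : state m.
Proof. by apply: (cone_mono m_ref theta01 LL'); exact: (reference_cone m_ref theta01 L_ge0). Qed.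

Lemma state_scale nu (c : R) : 0 <= c -> state nu -> state (fun u => c * nu u).
Proof.
move=> c0 [n0 nA nd]; split=> [w|w|w u u' gw]; first exact: mulr_ge0.
  by rewrite -mulr_sumr nA.
by rewrite -!mulrA [leRHS]mulrCA ler_wpM2l//; exact: nd.
Qed.

(** An abstract conditional expectation: [nu] is the law of the future at a return and [s] the time
    still to run. [tf_refine] is the Markov property at the first return after h; words that return
    only after s are known through their mass alone, hence [Y]. *)
Record tower_functional (e : nat -> (seq nat -> R) -> R) : Prop := {
  tf_bound : forall s nu, state nu -> `|e s nu| <= nu [::] ;
  tf_scale : forall s c nu, e s (fun u => c * nu u) = c * e s nu ;
  tf_extract : forall s c nu, e s (fun u => nu u - c * m u) = e s nu - c * e s m ;
  tf_refine : forall s h nu, state nu -> (h <= s)%N ->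
    exists2 Y : seq nat -> R, (forall u, u \in stopt h -> `|Y u| <= nu u) &
    e s nu = \sum_(u <- stopt h)
      (if (dur u <= s)%N then e (s - dur u)%N (shift nu u) else Y u) }.

Lemma tower_functionalN e : tower_functional e ->
  tower_functional (fun s nu => - e s nu).
Proof.
case=> b sc ex rf; split.
- by move=> s nu nuC; rewrite normrN; exact: b.
- by move=> s c nu; rewrite sc mulrN.
- by move=> s c nu; rewrite ex; ring.
- move=> s h nu nuC hs; have [Y Yn ->] := rf s h nu nuC hs.
  exists (fun u => - Y u); first by move=> u us; rewrite normrN; exact: Yn.
  by rewrite -sumrN; apply: eq_bigr => u _; case: ifP.
Qed.

(** All times from n to the horizon are included, so that the supremum [hi] is nonincreasing in
    n. *)
Definition values (e : nat -> (seq nat -> R) -> R) (n : nat) : set R :=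
  [set r | exists s nu, [/\ (n <= s <= H)%N, state nu, nu [::] = 1 & r = e s nu]].

Definition hi e n : R := sup (values e n).

Section hi_theory.
Variable e : nat -> (seq nat -> R) -> R.
Hypothesis e_bound : forall s nu, state nu -> `|e s nu| <= nu [::].

Lemma values_ub n : ubound (values e n) 1.
Proof.
move=> _ [s [nu [_ nuC n1 ->]]]; rewrite -n1.
exact: le_trans (ler_norm _) (e_bound _ nuC).
Qed.

Lemma values_n0 n : (n <= H)%N -> values e n !=set0.
Proof.
move=> nH; exists (e n m), n, m; rewrite leqnn nH (reference_mass m_ref).
by split=> //; exact: reference_state.
Qed.

Lemma le_hi1 n s nu : (n <= s <= H)%N -> state nu -> nu [::] = 1 -> e s nu <= hi e n.
Proof.
move=> ns nuC n1; apply: ub_le_sup; first by exists 1; exact: values_ub.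
by exists s, nu.
Qed.

Lemma hi_le n b : (n <= H)%N ->
  (forall s nu, (n <= s <= H)%N -> state nu -> nu [::] = 1 -> e s nu <= b) ->
  hi e n <= b.
Proof.
move=> nH hb; apply: ge_sup; first exact: values_n0.
by move=> _ [s [nu [ns nuC n1 ->]]]; exact: hb.
Qed.

Lemma hi_noninc n n' : (n <= n' <= H)%N -> hi e n' <= hi e n.
Proof.
move=> /andP[nn' n'H]; apply: hi_le => // s nu /andP[ns sH] nuC n1.
by apply: le_hi1 => //; rewrite (leq_trans nn' ns).
Qed.

Lemma hi_le1 n : (n <= H)%N -> hi e n <= 1.
Proof. by move=> nH; apply: ge_sup; [exact: values_n0|exact: values_ub]. Qed.

Hypothesis e_scale : forall s c nu, e s (fun u => c * nu u) = c * e s nu.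

Lemma le_hi n s nu : (n <= s <= H)%N -> state nu -> e s nu <= hi e n * nu [::].
Proof.
move=> ns nuC; have [n0|n0] := eqVneq (nu [::]) 0.
  by rewrite n0 mulr0 -n0; exact: le_trans (ler_norm _) (e_bound _ nuC).
have n1 : 0 < nu [::] by rewrite lt0r n0 (cone_ge0 nuC).
rewrite -ler_pdivrMr// mulrC -e_scale; apply: le_hi1 => //.
  by apply: state_scale => //; rewrite invr_ge0 ltW.
by rewrite mulVf.
Qed.

End hi_theory.

Variable a : nat -> R.
Hypothesis a_gt0 : forall n, 0 < a n.
Hypothesis a_noninc : forall n n', (n <= n')%N -> a n' <= a n.
Hypothesis overshoot : forall nu t k, state nu -> (t <= H)%N ->
  \sum_(u <- stopt t) (t + k < dur u)%:R * nu u <= a k * nu [::].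

Variables (N0 : nat) (c_hit : R).
Hypothesis c_hit_ge0 : 0 <= c_hit.
Hypothesis hit : forall nu d, state nu -> (N0.+1 <= d <= H)%N ->
  c_hit * nu [::] <= \sum_(u <- stopt d.-1) (dur u == d)%:R * nu u.

Let eps := extraction L L'.

(** Put d = s - t and stop at the first return at a time at least d. An overshoot of k leaves the
    time t - k, hence the weights. With probability at least [c_hit] the return is exactly at d;
    there eps times the reference measure is split off and contributes [e t m] in place of [hi e t].
    This value is unknown, but for [- e] it appears with the opposite sign. *)
Lemma hi_step e t : tower_functional e -> (t + N0.+1 <= H)%N ->
  hi e (t + N0.+1)%N <= \sum_(k < t.+1) (capped a k - capped a k.+1) * hi e (t - k)%N
    + capped a t.+1 - eps * c_hit * (hi e t - e t m).
Proof.
move=> eF tH; have eb := tf_bound eF; have es := tf_scale eF.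
have eps0 : 0 < eps := extraction_gt0 L_ge0 LL'.
apply: hi_le => // s nu /andP[ts sH] nuC n1.
set d := (s - t)%N; have dE : s = (t + d)%N by rewrite subnKC// (leq_trans _ ts)// leq_addr.
have dN0 : (N0.+1 <= d <= H)%N.
  by move: ts sH; rewrite dE leq_add2l => -> /= dH; rewrite (leq_trans _ dH)// leq_addl.
have d0 : (0 < d)%N by case/andP: dN0; case: (d).
have hs : (d.-1 <= s)%N by rewrite dE (leq_trans (leq_pred _))// leq_addl.
have hdH : (d.-1 <= H)%N by exact: leq_trans hs sH.
have [Y Yn ->] := tf_refine eF nuC hs.
pose F k := if (k <= t)%N then hi e (t - k)%N else 1.
have hi0 : 0 <= hi e t - e t m.
  rewrite subr_ge0; apply: (le_hi1 eb); last exact: (reference_mass m_ref).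
    by rewrite leqnn (leq_trans _ tH)// leq_addr.
  exact: reference_state.
have tH' : (t <= H)%N by rewrite (leq_trans _ tH)// leq_addr.
apply: (@le_trans _ _ (\sum_(u <- stopt d.-1)
    (nu u * F (minn (dur u - d) t.+1)
      - eps * (hi e t - e t m) * ((dur u == d)%:R * nu u)))).
  rewrite big_seq [leRHS]big_seq; apply: ler_sum => u us.
  have [du u0 _] := stopP tau_gt0 us; rewrite -/dur prednK// in du.
  have nuu : 0 <= nu u by exact: (cone_ge0 nuC).
  case: (leqP (dur u) s) => dus; last first.
    have -> : (minn (dur u - d) t.+1 = t.+1)%N.
      by apply/minn_idPr; rewrite ltn_subRL addnC -dE.
    rewrite /F ltnn mulr1 gtn_eqF; last by rewrite (leq_ltn_trans _ dus)// dE leq_addl.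
    by rewrite mul0r mulr0 subr0; exact: le_trans (ler_norm _) (Yn _ us).
  have udH : (dur u <= H)%N by exact: leq_trans dus sH.
  have shE : shift nu u [::] = nu u by rewrite /shift cats0.
  have duE : (dur u - d <= t)%N by rewrite leq_subLR addnC -dE.
  rewrite (minn_idPl (leqW duE)) /F duE.
  case: eqP => [due|_]; last first.
    rewrite mul0r mulr0 subr0 mulrC -shE; apply: (le_hi eb es).
      by move: (dur u) dE du dus sH => x; clear; lia.
    exact: state_shiftW us udH.
  rewrite due subnn subn0 mul1r dE addnK.
  have sc := state_shift nuC us udH.
  (* The remainder, of mass (1 - eps) [nu u], is still a state, so [hi] bounds it; the gain is the
     factor 1 - eps. *)
  have ec := cone_extract m_ref theta01 L_ge0 LL' sc.
  have := le_hi eb es (_ : (t <= t <= H)%N) ec; rewrite leqnn tH' => /(_ isT).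
  rewrite (tf_extract eF) shE (reference_mass m_ref) mulr1 -/eps.
  move: (e t (shift nu u)) (hi e t) (e t m) (nu u) (eps) => p q r n e' h.
  by rewrite -subr_ge0 in h; rewrite -subr_ge0; apply: le_trans h _; rewrite le_eqVlt;
    apply/orP; left; apply/eqP; ring.
rewrite sumrB -mulr_sumr.
have hF := @weighted_tail_le R _ (stopt d.-1) (fun u => nu u) (fun u => (dur u - d)%N)
  (capped a) F t.+1 erefl (cone_ge0 nuC).
apply: (@le_trans _ _ (\sum_(k < t.+1) (capped a k - capped a k.+1) * F k
    + capped a t.+1 * F t.+1 - eps * (hi e t - e t m) * c_hit)); last first.
  rewrite {2}/F ltnn mulr1 [X in _ - X]mulrAC lerD2r lerD2r; apply: ler_sum => k _.
  by rewrite /F -ltnS ltn_ord.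
apply: lerB; last first.
  rewrite (ler_wpM2l (mulr_ge0 (ltW eps0) hi0))//.
  by have := hit nuC dN0; rewrite n1 mulr1.
apply: hF.
- by rewrite (sum_stop_mass _ tau_gt0 (cone_additive nuC)).
- move=> k kt; rewrite /= le_min; apply/andP; split.
    apply: (@le_trans _ _ (nu [::])); last by rewrite n1.
    rewrite -(sum_stop_mass (J := J) (nu := nu) d.-1 tau_gt0 (cone_additive nuC)).
    apply: ler_sum => u _; rewrite ler_piMl ?(cone_ge0 nuC)//.
    by rewrite -[leRHS]/(1%:R) ler_nat leq_b1.
  have := overshoot k.+1 nuC hdH; rewrite n1 mulr1; apply: le_trans.
  rewrite le_eqVlt; apply/orP; left; apply/eqP; apply: eq_bigr => u _.
  by rewrite ltn_subRL (_ : d.-1 + k.+1 = d + k)%N// addnS -addSn prednK.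
- move=> k kt; rewrite /F (_ : (k <= t)%N = true)//; case: ifP => k1t.
    by apply: (hi_noninc eb); rewrite leq_sub2l//= (leq_trans (leq_subr _ _) tH').
  by apply: (hi_le1 eb); rewrite (leq_trans (leq_subr _ _) tH').
Qed.

End one_step.

(** * Large multiples of a gcd as sums of generators *)

Section numerical_semigroup.

Definition represents (I : seq nat) (i : nat) :=
  exists2 s : seq nat, {subset s <= I} & sumn s = i.

(** Induction on the generators. Let g' be the gcd of the others, i = q gcd(g', a), and al the
    Bezout coefficient with g' dividing gcd(g', a) + al a. The number of copies of a is taken
    congruent to - q al modulo g' and at most g'; what is left is a multiple of g' and still at
    least N. *)
Lemma represents_gcd (I : seq nat) : (forall i, i \in I -> (0 < i)%N) ->
  exists N, forall i, (N <= i)%N -> (\big[gcdn/0%N]_(a <- I) a %| i)%N ->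
    represents I i.
Proof.
elim: I => [_|a I IH aI].
  by exists 0%N => i _; rewrite big_nil dvd0n => /eqP ->; exists [::].
have [|N hN] := IH; first by move=> i iI; apply: aI; rewrite inE iI orbT.
have a0 : (0 < a)%N by apply: aI; rewrite inE eqxx.
set g' := \big[gcdn/0%N]_(b <- I) b in hN *.
exists (N + g' * a)%N => i Ni; rewrite big_cons -/g'.
have [g0|g0] := posnP g'.
  rewrite g0 gcdn0 => /dvdnP[q ->]; exists (nseq q a).
    by move=> x /nseqP[-> _]; rewrite inE eqxx.
  by rewrite sumn_nseq mulnC.
rewrite gcdnC => /dvdnP[q iq].
have [al _ hal] := Bezoutl a g0.
have yg : ((q * al) %% g' < g')%N by rewrite ltn_mod.
set y := ((q * al) %% g')%N in yg.
have xag : ((g' - y) * a <= g' * a)%N by rewrite leq_mul2r leq_subr orbT.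
have xi : ((g' - y) * a <= i)%N.
  by apply: leq_trans xag (leq_trans _ Ni); exact: leq_addl.
have [||s sI si] := hN (i - (g' - y) * a)%N.
- by rewrite leq_subRL// addnC (leq_trans _ Ni)// leq_add2l.
- have h2 : (g' %| ((g' - y) + q * al) * a)%N.
    apply: dvdn_mulr; rewrite (divn_eq (q * al) g') -/y addnCA subnK; last exact: ltnW.
    by rewrite dvdn_add// dvdn_mull.
  rewrite -(dvdn_addl _ h2) mulnDl addnA subnK// iq -mulnA -mulnDr.
  exact: dvdn_mull.
exists (nseq (g' - y) a ++ s).
  by move=> x; rewrite mem_cat => /orP[/nseqP[-> _]|/sI]; rewrite inE ?eqxx// => ->; rewrite orbT.
by rewrite sumn_cat sumn_nseq si mulnC subnKC.
Qed.

Lemma dvdn_biggcd_seq (I : seq nat) j : j \in I ->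
  (\big[gcdn/0%N]_(a <- I) a %| j)%N.
Proof.
elim: I => // a I IH; rewrite big_cons inE => /predU1P[->|/IH]; first exact: dvdn_gcdl.
by apply: dvdn_trans; exact: dvdn_gcdr.
Qed.

(* The bound is uniform because there are finitely many sets of generators. *)
Lemma represents_uniform Nmax : exists N, forall I : seq nat,
  (forall i, i \in I -> (0 < i <= Nmax)%N) -> \big[gcdn/0%N]_(a <- I) a = 1%N ->
  forall i, (N <= i)%N -> represents I i.
Proof.
have /choice[f hf] (B : {set 'I_Nmax.+1}) : exists N,
    (forall i : nat, i \in map val (enum B) -> (0 < i)%N) ->
    \big[gcdn/0%N]_(a <- map val (enum B)) a = 1%N ->
    forall i, (N <= i)%N -> represents (map val (enum B)) i.
  have [pos|npos] := pselect (forall i : nat, i \in map val (enum B) -> (0 < i)%N).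
    have [N hN] := represents_gcd pos; exists N => _ g1 i Ni.
    by apply: hN => //; rewrite g1 dvd1n.
  by exists 0%N.
exists (\max_B f B) => I IN gI i Ni.
pose B : {set 'I_Nmax.+1} := finset (fun i => val i \in I).
have memB (j : nat) : (j \in map val (enum B)) = (j \in I).
  apply/mapP/idP => [[k + ->]|jI]; first by rewrite mem_enum inE.
  have /andP[_ jN] := IN _ jI; exists (Ordinal (jN : j < Nmax.+1)%N) => //.
  by rewrite mem_enum inE.
have [|||s sB si] := hf B _ _ i.
- by move=> j; rewrite memB => /IN /andP[].
- apply/eqP; rewrite -dvdn1 -gI.
  rewrite [X in (_ %| X)%N]big_seq.
  apply: (big_ind (fun g => \big[gcdn/0%N]_(a <- map val (enum B)) a %| g)%N).
  - exact: dvdn0.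
  - by move=> x y dx dy; rewrite dvdn_gcd dx.
  move=> j jI.
  by apply: dvdn_biggcd_seq; rewrite memB.
- by rewrite (leq_trans _ Ni)//; exact: (leq_bigmax B).
by exists s => // x /sB; rewrite memB.
Qed.

End numerical_semigroup.

(** * Overshoots and exact hitting times *)

Section first_passage.
Context {R : realType}.
Variables (J H : nat) (tau : nat -> nat).
Variables (m : seq nat -> R) (theta K L L' : R).
Hypothesis tau_gt0 : forall j, (0 < tau j)%N.
Hypothesis tauJ : (H < tau J)%N.
Hypothesis m_ref : reference J m theta K.
Hypothesis theta01 : 0 < theta < 1.
Hypothesis K_ge0 : 0 <= K.
Hypothesis L_ge0 : 0 <= L.
Hypothesis LL' : L < L'.
Hypothesis KL : K + theta * L' <= L.
Implicit Type nu : seq nat -> R.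

Let state := cone J m theta L'.
Let stopt := stop J tau.
Let dur := duration tau.

Lemma letter_good j : (j < J.+1)%N -> (tau j <= H)%N -> (j < J)%N.
Proof.
rewrite ltnS leq_eqVlt => /predU1P[->|//].
by rewrite leqNgt tauJ.
Qed.

Lemma state_letter nu j : state nu -> (j < J.+1)%N -> (tau j <= H)%N ->
  state (shift nu [:: j]).
Proof.
move=> nuC jJ jH; apply: (cone_mono m_ref theta01 LL').
by apply: (cone_shift1 m_ref theta01 KL) => //; exact: letter_good.
Qed.

Lemma state_mass nu : state nu -> \sum_(j < J.+1) nu [:: val j] = nu [::].
Proof. by move=> nuC; apply: sum_additive; exact: (cone_additive nuC). Qed.

Section overshoot.
Variable b : nat -> R.
Hypothesis tail : forall nu i, state nu ->
  \sum_(j < J.+1) (i <= tau j)%:R * nu [:: val j] <= b i * nu [::].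
Hypothesis b_ge0 : forall i, 0 <= b i.

(** Sum over the time t - l of the last return up to t: the next return time must be at least k + 1
    + l, which has conditional probability at most [b (k.+1 + l)]. In the induction the term l = t
    belongs to the first letter. *)
Lemma overshoot_le nu t k : state nu -> (t <= H)%N ->
  \sum_(u <- stopt t) (t + k < dur u)%:R * nu u
    <= (\sum_(l < t.+1) b (k.+1 + l)%N) * nu [::].
Proof.
have [n] := ubnP t; elim: n t nu => // n IH t nu; rewrite ltnS => tn nuC tH.
rewrite sum_stop// [X in X * _]big_ord_recr/= mulrDl.
apply: (@le_trans _ _ (\sum_(j < J.+1) ((\sum_(l < t) b (k.+1 + l)%N) * nu [:: val j]
    + ((k.+1 + t <= tau j)%N%:R * nu [:: val j])))); last first.
  by rewrite big_split/= -mulr_sumr state_mass// lerD2l; exact: tail.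
apply: ler_sum => j _; have j0 := tau_gt0 j.
have nuj : 0 <= nu [:: val j] by exact: (cone_ge0 nuC).
case: ifP => jt; last first.
  rewrite /dur /duration /= addn0 addSn [(k + t)%N]addnC lerDr mulr_ge0//.
  by rewrite sumr_ge0.
have jt1 : (t - tau j < t)%N by move: j0 jt; clear; lia.
have jH : (tau j <= H)%N by exact: leq_trans jt tH.
have := IH (t - tau j)%N (shift nu [:: val j]) (leq_trans jt1 tn)
  (state_letter nuC (ltn_ord j) jH) (leq_trans (leq_subr _ _) tH).
rewrite {2}/shift cats0 => h.
apply: (@le_trans _ _ ((\sum_(l < (t - tau j).+1) b (k.+1 + l)%N) * nu [:: val j])).
  apply: le_trans h; rewrite le_eqVlt; apply/orP; left; apply/eqP.
  apply: eq_bigr => u _; rewrite /dur /duration/= -/(duration tau u).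
  by rewrite (_ : (t + k < _) = (t - tau j + k < duration tau u))%N//;
    move: jt; clear; lia.
apply: (@le_trans _ _ ((\sum_(l < t) b (k.+1 + l)%N) * nu [:: val j])).
  rewrite ler_wpM2r// -!(big_mkord xpredT (fun l => b (k.+1 + l)%N)).
  by rewrite (big_cat_nat (leq0n _) jt1)/= lerDl sumr_ge0.
by rewrite lerDl mulr_ge0.
Qed.

End overshoot.

(** The mass of a return exactly at time d. A word of duration d = [d'.+1] is one that first exceeds
    d' and does so without overshoot, hence [stopt d']. *)
Definition hitting (d : nat) nu : R :=
  if d is d'.+1 then \sum_(u <- stopt d') (dur u == d)%:R * nu u else nu [::].

Lemma hittingS d nu : (0 < d)%N -> hitting d nu = \sum_(j < J.+1)
  (if (tau j <= d)%N then hitting (d - tau j)%N (shift nu [:: val j]) else 0).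
Proof.
case: d => // d _; rewrite /hitting sum_stop//; apply: eq_bigr => j _.
have j0 := tau_gt0 j; case: (leqP (tau j) d) => jd.
  rewrite (leqW jd) subSn//; apply: eq_bigr => u _.
  by rewrite /dur /duration/= -/(duration tau u) -[in RHS](eqn_add2l (tau j)) addnS subnKC.
rewrite /dur /duration/= addn0; case: (ltngtP (tau j) d.+1) => jd1.
- by move: jd jd1; rewrite ltnS => /leq_trans/[apply]; rewrite ltnn.
- by rewrite mul0r.
- by rewrite jd1 subnn mul1r.
Qed.

Lemma hitting_ge0 d nu : state nu -> 0 <= hitting d nu.
Proof.
move=> nuC; case: d => [|d]; first exact: (cone_ge0 nuC).
by apply: sumr_ge0 => u _; rewrite mulr_ge0// (cone_ge0 nuC).
Qed.

Section hit_lower_bound.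
Variables (I : seq nat) (delta : R).
Hypothesis delta01 : 0 < delta <= 1.
Hypothesis I_gt0 : forall i, i \in I -> (0 < i)%N.
Hypothesis I_mass : forall nu i, state nu -> i \in I ->
  delta * nu [::] <= \sum_(j < J.+1) ((tau j == i) && (j < J)%N)%:R * nu [:: val j].

Lemma hitting_represents nu (s : seq nat) : {subset s <= I} -> (sumn s <= H)%N ->
  state nu -> delta ^+ size s * nu [::] <= hitting (sumn s) nu.
Proof.
case/andP: delta01 => d0 d1.
elim: s nu => [|i s IH] nu sI sH nuC; first by rewrite mul1r.
have iI : i \in I by apply: sI; rewrite inE eqxx.
have sI' : {subset s <= I} by move=> x xs; apply: sI; rewrite inE xs orbT.
rewrite /= in sH *; have i0 := I_gt0 iI.
have sH' : (sumn s <= H)%N by rewrite (leq_trans _ sH)// leq_addl.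
have iH : (i <= H)%N by rewrite (leq_trans _ sH)// leq_addr.
rewrite hittingS ?addn_gt0 ?i0// exprSr -mulrA.
apply: (@le_trans _ _ (delta ^+ size s * \sum_(j < J.+1)
    ((tau j == i) && (j < J)%N)%:R * nu [:: val j])).
  by rewrite ler_wpM2l ?exprn_ge0 ?(ltW d0)//; exact: I_mass.
rewrite mulr_sumr; apply: ler_sum => j _.
case: eqP => [ji|_] /=; last first.
  rewrite mul0r mulr0; case: ifP => // jis.
  apply: hitting_ge0; apply: state_letter => //; exact: leq_trans jis sH.
case: (ltnP j J) => jJ; last first.
  rewrite mul0r mulr0; case: ifP => // jis.
  apply: hitting_ge0; apply: state_letter => //; exact: leq_trans jis sH.
rewrite ji leq_addr addKn mul1r.
have -> : nu [:: val j] = shift nu [:: val j] [::] by rewrite /shift cats0.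
by apply: IH => //; apply: state_letter; rewrite ?ji ?ltn_ord.
Qed.

Lemma size_le_sumn (s : seq nat) : {subset s <= I} -> (size s <= sumn s)%N.
Proof.
elim: s => //= i s IH sI; rewrite -add1n leq_add//.
  by apply: I_gt0; apply: sI; rewrite inE eqxx.
by apply: IH => x xs; apply: sI; rewrite inE xs orbT.
Qed.

Variables (N1 W : nat) (a : nat -> R).
Hypothesis N1_gt0 : (0 < N1)%N.
Hypothesis I_represents : forall i, (N1 <= i)%N -> represents I i.
Hypothesis overshoot : forall nu t k, state nu -> (t <= H)%N ->
  \sum_(u <- stopt t) (t + k < dur u)%:R * nu u <= a k * nu [::].
Hypothesis aW : 2 * a W <= 1.

Lemma hitting_window i nu : (N1 <= i <= N1 + W)%N -> (i <= H)%N -> state nu ->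
  delta ^+ (N1 + W) * nu [::] <= hitting i nu.
Proof.
move=> /andP[N1i iB] iH nuC; have [s sI si] := I_represents N1i.
case/andP: delta01 => d0 d1.
rewrite -si; apply: le_trans (hitting_represents sI _ nuC); last by rewrite si.
rewrite ler_wpM2r ?(cone_ge0 nuC)//; apply: ler_wiXn2l; rewrite ?(ltW d0)//.
by rewrite (leq_trans (size_le_sumn sI))// si.
Qed.

(* The last passage before time d - N1 - W is followed, with probability at
   least 1/2, by a return at a time from which d is reached with a positive
   probability. *)
Lemma hitting_lower_bound d nu : (N1 <= d <= H)%N -> state nu ->
  delta ^+ (N1 + W) / 2 * nu [::] <= hitting d nu.
Proof.
move=> /andP[N1d dH] nuC; case/andP: delta01 => d0 d1.
have nu0 : 0 <= nu [::] by exact: (cone_ge0 nuC).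
set c1 := delta ^+ (N1 + W); have c10 : 0 <= c1 by rewrite exprn_ge0 ?ltW.
have [dB|dB] := leqP d (N1 + W)%N.
  apply: (@le_trans _ _ (c1 * nu [::])).
    by rewrite ler_wpM2r// ler_piMr//; lra.
  by apply: hitting_window; rewrite // N1d.
have [t dE] : exists t, d = (t + (N1 + W).+1)%N.
  by exists (d - (N1 + W).+1)%N; rewrite subnK.
have tH : (t <= H)%N by rewrite (leq_trans _ dH)// dE leq_addr.
have /= ov := overshoot W nuC tH.
apply: (@le_trans _ _ (\sum_(u <- stopt t) (c1 * nu u - c1 * ((t + W.+1 < dur u)%:R * nu u)))).
  rewrite sumrB -!mulr_sumr (sum_stop_mass _ tau_gt0 (cone_additive nuC)).
  rewrite -mulrBr -mulrA ler_wpM2l//.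
  have ov' : \sum_(u <- stopt t) (t + W.+1 < dur u)%:R * nu u <= a W * nu [::].
    apply: le_trans ov; apply: ler_sum => u _; rewrite ler_wpM2r ?(cone_ge0 nuC)//.
    rewrite ler_nat; case: ltnP => //= h; rewrite lt0b addnS in h *.
    by rewrite (ltn_trans _ h).
  have : 2 * a W * nu [::] <= nu [::] by rewrite ler_piMl.
  by move: ov'; move: (\sum_(u <- _) _) (a W) => x y; lra.
case: d dE dH N1d dB => // d dE dH N1d dB.
rewrite /hitting (sum_stop_refine J tau_gt0 _ (_ : t <= d)%N); last by move: dE; clear; lia.
rewrite big_seq [leRHS]big_seq; apply: ler_sum => u us.
have [tu u0 _] := stopP tau_gt0 us; rewrite -/dur in tu *.
have nuu : 0 <= nu u by exact: (cone_ge0 nuC).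
case: (leqP (dur u) d) => ud; last first.
  have -> : (t + W.+1 < dur u)%N by apply: leq_ltn_trans ud; move: dE N1_gt0; clear; lia.
  by rewrite mul1r subrr mulr_ge0.
have udH : (dur u <= H)%N by rewrite (leq_trans ud)// ltnW.
have shC : state (shift nu u).
  exact: (state_shiftW tau_gt0 tauJ m_ref theta01 LL' KL) us udH.
have -> : \sum_(u' <- stop J tau (d - dur u)) (dur (u ++ u') == d.+1)%:R * nu (u ++ u')
    = hitting (d - dur u).+1 (shift nu u).
  apply: eq_bigr => u' _; rewrite /dur duration_cat -/dur.
  by rewrite -[in RHS](eqn_add2l (dur u)) addnS subnKC.
have shE : shift nu u [::] = nu u by rewrite /shift cats0.
case: ltnP => tW.
  by rewrite mul1r subrr; exact: hitting_ge0.
rewrite mul0r mulr0 subr0 -shE; apply: hitting_window => //.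
  by rewrite -subSn//; move: dE tu tW ud; clear; lia.
by rewrite -subSn// (leq_trans (leq_subr _ _)).
Qed.

End hit_lower_bound.
End first_passage.

(** * Renewal inequalities for return counts and for the oscillation *)

Section oscillation.
Context {R : realType}.
Variables (J H : nat) (tau : nat -> nat).
Variables (m : seq nat -> R) (theta K L L' : R).
Hypothesis tau_gt0 : forall j, (0 < tau j)%N.
Hypothesis tauJ : (H < tau J)%N.
Hypothesis m_ref : reference J m theta K.
Hypothesis theta01 : 0 < theta < 1.
Hypothesis K_ge0 : 0 <= K.
Hypothesis L_ge0 : 0 <= L.
Hypothesis LL' : L < L'.
Hypothesis KL : K + theta * L' <= L.
Implicit Type nu : seq nat -> R.

Let state := cone J m theta L'.
Let stopt := stop J tau.
Let dur := duration tau.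

Let shift0 nu u : shift nu u [::] = nu u.
Proof. by rewrite /shift cats0. Qed.

Let mass nu h : state nu -> \sum_(u <- stopt h) nu u = nu [::].
Proof. by move=> nuC; exact: (sum_stop_mass _ tau_gt0 (cone_additive nuC)). Qed.

Variable a : nat -> R.
Hypothesis a_gt0 : forall n, 0 < a n.
Hypothesis a_noninc : forall n n', (n <= n')%N -> a n' <= a n.

Section returns.
Variable rho : R.
Hypothesis rho01 : 0 <= rho <= 1.

(* For u in stop s, (size u).-1 is the number of returns up to time s. *)
Definition return_weight (s : nat) nu : R :=
  \sum_(u <- stopt s) rho ^+ (size u).-1 * nu u.

Lemma return_weightS s nu : return_weight s nu = \sum_(j < J.+1)
  (if (tau j <= s)%N then rho * return_weight (s - tau j)%N (shift nu [:: val j])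
   else nu [:: val j]).
Proof.
rewrite /return_weight sum_stop//; apply: eq_bigr => j _.
case: ifP => js; last by rewrite mul1r.
rewrite mulr_sumr big_seq [RHS]big_seq; apply: eq_bigr => u us.
have [_ u0 _] := stopP tau_gt0 us.
by rewrite mulrA -exprS prednK// lt0n size_eq0.
Qed.

Lemma return_weight_bound s nu : state nu -> `|return_weight s nu| <= nu [::].
Proof.
move=> nuC; case/andP: rho01 => r0 r1.
have p0 u : 0 <= rho ^+ (size u : nat).-1 * nu u.
  by rewrite mulr_ge0 ?exprn_ge0// (cone_ge0 nuC).
rewrite ger0_norm ?sumr_ge0// -(mass s nuC); apply: ler_sum => u _.
by rewrite ler_piMl ?(cone_ge0 nuC)// exprn_ile1.
Qed.

Lemma return_weight_scale s c nu :
  return_weight s (fun u => c * nu u) = c * return_weight s nu.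
Proof. by rewrite /return_weight mulr_sumr; apply: eq_bigr => u _; rewrite mulrCA. Qed.

Hypothesis tail : forall nu k, state nu ->
  \sum_(j < J.+1) (k <= tau j)%:R * nu [:: val j] <= a k * nu [::].

(** Each return contributes a factor rho, so the weights satisfy a renewal inequality with q = rho
    and delay 1 by decomposing along the first letter. From a time at least [t.+1], a return at tau
    leaves at least t - (tau - 1), hence the predecessors. *)
Lemma return_weight_step t : (t.+1 <= H)%N ->
  hi J H m theta L' return_weight t.+1 <= rho * (\sum_(k < t.+1)
     (capped a k - capped a k.+1) * hi J H m theta L' return_weight (t - k)%N)
   + 2 * capped a t.+1.
Proof.
move=> tH; case/andP: rho01 => r0 r1; have eb := return_weight_bound.
have es := return_weight_scale.
apply: (hi_le m_ref theta01 L_ge0 LL') => // s nu /andP[ts sH] nuC n1.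
pose hiR := hi J H m theta L' return_weight.
pose F k := if (k <= t)%N then hiR (t - k)%N else 1.
have tails k : \sum_(j < J.+1) (k < (tau j).-1)%:R * nu [:: val j] <= capped a k.+1.
  rewrite /= le_min; apply/andP; split.
    apply: (@le_trans _ _ (nu [::])); last by rewrite n1.
    rewrite -(sum_additive (cone_additive nuC)); apply: ler_sum => j _.
    by rewrite ler_piMl ?(cone_ge0 nuC)// lern1 leq_b1.
  have := tail k.+2 nuC; rewrite n1 mulr1 => h.
  apply: (@le_trans _ _ (a k.+2)); last exact: a_noninc.
  apply: le_trans h; rewrite le_eqVlt; apply/orP; left; apply/eqP.
  by apply: eq_bigr => j _; rewrite -ltnS prednK.
apply: (@le_trans _ _ (\sum_(j < J.+1) (rho * (nu [:: val j] * F (minn (tau j).-1 t.+1))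
    + (t < (tau j).-1)%:R * nu [:: val j]))).
  rewrite return_weightS; apply: ler_sum => j _.
  have nuj : 0 <= nu [:: val j] by exact: (cone_ge0 nuC).
  have j0 := tau_gt0 j.
  case: ifP => js; last first.
    have jt : (t < (tau j).-1)%N by move: js ts j0; clear; lia.
    rewrite jt mul1r lerDr !mulr_ge0//.
    by rewrite (minn_idPr jt) /F ltnn.
  have jH : (tau j <= H)%N by exact: leq_trans js sH.
  have sC := state_letter tauJ m_ref theta01 LL' KL nuC (ltn_ord j) jH.
  case: (ltnP t (tau j).-1) => jt.
    rewrite (minn_idPr jt) /F ltnn mulr1 mul1r (@le_trans _ _ (rho * nu [:: val j]))//.
      rewrite ler_wpM2l// -(shift0 nu [:: val j]).
      exact: le_trans (ler_norm _) (eb _ _ sC).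
    by rewrite lerDl.
  rewrite mul0r addr0 ler_wpM2l// mulrC -(shift0 nu [:: val j]).
  rewrite (_ : minn _ _ = (tau j).-1) ?/F ?jt; last exact/minn_idPl/leqW.
  apply: (le_hi eb es) => //.
  by move: js ts sH jt j0; clear; lia.
rewrite big_split/= -mulr_sumr.
apply: (@le_trans _ _ (rho * (\sum_(k < t.+1) (capped a k - capped a k.+1) * F k
    + capped a t.+1 * F t.+1) + capped a t.+1)).
  apply: lerD; last exact: tails.
  rewrite ler_wpM2l//.
  apply: (@weighted_tail_le R _ _ (fun j : 'I_J.+1 => nu [:: val j])
    (fun j => (tau j).-1) (capped a) F) => //.
  - by move=> j; exact: (cone_ge0 nuC).
  - by rewrite (sum_additive (cone_additive nuC)).
  move=> k kt; have kt' : (k <= t)%N by [].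
  have tkH : (t - k <= H)%N by rewrite (leq_trans (leq_subr _ _))// ltnW.
  rewrite /F kt'; case: ifP => k1t.
    by apply: (hi_noninc m_ref theta01 L_ge0 LL' eb); rewrite leq_sub2l.
  exact: (hi_le1 m_ref theta01 L_ge0 LL' eb).
rewrite mulrDr -addrA lerD//.
  rewrite ler_wpM2l// le_eqVlt; apply/orP; left; apply/eqP; apply: eq_bigr => k _.
  by rewrite /F -ltnS ltn_ord.
rewrite /F ltnn mulr1.
by rewrite mulr_natl mulr2n lerD2r ler_piMl ?(capped_ge0 a_gt0 t.+1).
Qed.

End returns.

Section expectation.
Variables (g : nat -> seq nat -> R) (lag : nat).
Hypothesis g_bound : forall s u, `|g s u| <= 1.
Hypothesis g_step : forall s j u, (tau j <= s)%N -> g s (j :: u) = g (s - tau j)%N u.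

(** Words are read for [lag] longer than s because the observable at time s looks ahead by that
    much. *)
Definition expectation (s : nat) nu : R :=
  \sum_(u <- stopt (s + lag)) g s u * nu u.

Lemma g_cat s u v : (dur u <= s)%N -> g s (u ++ v) = g (s - dur u)%N v.
Proof.
elim: u s => [|j u IH] s; first by rewrite subn0.
rewrite /dur /duration/= -/(duration tau u) => us.
have js : (tau j <= s)%N by rewrite (leq_trans _ us)// leq_addr.
by rewrite g_step// IH ?subnDA// /dur leq_subRL.
Qed.

Lemma expectation_functional :
  tower_functional J tau m theta L' expectation.
Proof.
split.
- move=> s nu nuC; rewrite -(mass (s + lag) nuC).
  apply: (le_trans (ler_norm_sum _ _ _)); apply: ler_sum => u _.
  by rewrite normrM [`|nu u|]ger0_norm ?ler_piMl ?(cone_ge0 nuC).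
- move=> s c nu; rewrite /expectation mulr_sumr; apply: eq_bigr => u _.
  by rewrite mulrCA.
- move=> s c nu; rewrite /expectation mulr_sumr -sumrB; apply: eq_bigr => u _.
  by ring.
move=> s h nu nuC hs; have hsl : (h <= s + lag)%N by rewrite (leq_trans hs)// leq_addr.
exists (fun u => if (dur u <= s + lag)%N then
    \sum_(u' <- stopt (s + lag - dur u)%N) g s (u ++ u') * nu (u ++ u')
  else g s u * nu u).
  move=> u us; have nu0 w : 0 <= nu w by exact: (cone_ge0 nuC).
  have gn w : `|g s w * nu w| <= nu w.
    by rewrite normrM [`|nu w|]ger0_norm// ler_piMl.
  case: ifP => // _; apply: (le_trans (ler_norm_sum _ _ _)).
  apply: (@le_trans _ _ (\sum_(u' <- stopt (s + lag - dur u)%N) shift nu u u')).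
    by apply: ler_sum => u' _; exact: gn.
  rewrite (sum_stop_mass _ tau_gt0); last exact/additive_shift/(cone_additive nuC).
  by rewrite shift0.
rewrite /expectation (sum_stop_refine J tau_gt0 _ hsl); apply: eq_bigr => u _.
rewrite -/dur; have [us|us] := leqP (dur u) s; last by [].
rewrite (leq_trans us (leq_addr _ _)) addnC -addnBA// addnC.
by apply: eq_bigr => u' _; rewrite g_cat.
Qed.

End expectation.

Variable e : nat -> (seq nat -> R) -> R.
Hypothesis eF : tower_functional J tau m theta L' e.

(** Supremum minus infimum over normalized states and times from n to H; the infimum is written
    through [- e] so that [hi_step] serves both. *)
Definition oscillation (n : nat) : R :=
  hi J H m theta L' e n + hi J H m theta L' (fun s nu => - e s nu) n.

Let eNF := tower_functionalN eF.
Let hiE := hi J H m theta L' e.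
Let hiN := hi J H m theta L' (fun s nu => - e s nu).

Lemma reference_le_hi n : (n <= H)%N -> e n m <= hiE n /\ - e n m <= hiN n.
Proof.
move=> nH; have nn : (n <= n <= H)%N by rewrite leqnn.
have mC : state m by exact: (reference_state m_ref theta01 L_ge0 LL').
split; first by apply: (le_hi1 (tf_bound eF)) => //; exact: reference_mass m_ref.
apply: (@le_hi1 _ _ _ _ _ _ (fun s nu => - e s nu)) => //; last exact: reference_mass m_ref.
exact: (tf_bound eNF).
Qed.

Lemma oscillation_bound n : (n <= H)%N -> 0 <= oscillation n <= 2.
Proof.
move=> nH; have [h1 h2] := reference_le_hi nH.
have h3 := hi_le1 m_ref theta01 L_ge0 LL' (tf_bound eF) nH.
have h4 := hi_le1 m_ref theta01 L_ge0 LL' (tf_bound eNF) nH.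
rewrite /oscillation -/hiE -/hiN in h3 h4 *.
by move: (hiE n) (hiN n) (e n m) h1 h2 h3 h4 => x y z; lra.
Qed.

Lemma oscillation_noninc n n' : (n <= n' <= H)%N -> oscillation n' <= oscillation n.
Proof.
move=> nn; apply: lerD.
  exact: (hi_noninc m_ref theta01 L_ge0 LL' (tf_bound eF)).
exact: (hi_noninc m_ref theta01 L_ge0 LL' (tf_bound eNF)).
Qed.

Lemma oscillation_ge n s s' nu nu' : (n <= s <= H)%N -> (n <= s' <= H)%N ->
  state nu -> state nu' ->
  e s nu * nu' [::] - e s' nu' * nu [::] <= oscillation n * nu [::] * nu' [::].
Proof.
move=> ns ns' nuC nuC'.
have h1 := le_hi (tf_bound eF) (tf_scale eF) ns nuC.
have h2 := le_hi (tf_bound eNF) (tf_scale eNF) ns' nuC'.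
have n0 := cone_ge0 nuC [::]; have n0' := cone_ge0 nuC' [::].
rewrite /oscillation -/hiE -/hiN in h1 h2 *.
have h3 : e s nu * nu' [::] <= hiE n * nu [::] * nu' [::] by rewrite ler_wpM2r.
have h4 : - e s' nu' * nu [::] <= hiN n * nu' [::] * nu [::] by rewrite ler_wpM2r.
by rewrite /= in h4; move: (hiE n) (hiN n) h3 h4 => x y; lra.
Qed.

Hypothesis overshoot : forall nu t k, state nu -> (t <= H)%N ->
  \sum_(u <- stopt t) (t + k < dur u)%:R * nu u <= a k * nu [::].
Variables (N0 : nat) (c_hit : R).
Hypothesis c_hit_ge0 : 0 <= c_hit.
Hypothesis hit : forall nu d, state nu -> (N0.+1 <= d <= H)%N ->
  c_hit * nu [::] <= \sum_(u <- stopt d.-1) (dur u == d)%:R * nu u.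

(** Adding [hi_step] for e and for [- e] cancels [e t m] and leaves minus extraction times [c_hit]
    times the oscillation at t. By monotonicity the oscillation at [t + N0.+1] may stand there
    instead; moved to the left, it produces the inverse factor. *)
Lemma oscillation_step t : (t + N0.+1 <= H)%N ->
  oscillation (t + N0.+1)%N <= (1 + extraction L L' * c_hit)^-1 *
   (\sum_(k < t.+1) (capped a k - capped a k.+1) * oscillation (t - k)%N)
   + 2 * capped a t.+1.
Proof.
move=> tH; have tH' : (t <= H)%N by rewrite (leq_trans _ tH)// leq_addr.
have c0 : 0 <= extraction L L' * c_hit.
  by rewrite mulr_ge0// ltW// extraction_gt0.
have h1 := hi_step tau_gt0 tauJ m_ref theta01 L_ge0 LL' KL overshoot
  hit eF tH.
have h2 := hi_step tau_gt0 tauJ m_ref theta01 L_ge0 LL' KL overshoot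
  hit eNF tH.
have h3 : oscillation (t + N0.+1)%N <= oscillation t.
  by apply: oscillation_noninc; rewrite leq_addr.
have hS : \sum_(k < t.+1) (capped a k - capped a k.+1) * oscillation (t - k)%N
  = \sum_(k < t.+1) (capped a k - capped a k.+1) * hiE (t - k)%N
   + \sum_(k < t.+1) (capped a k - capped a k.+1) * hiN (t - k)%N.
  by rewrite -big_split/=; apply: eq_bigr => k _; rewrite -mulrDr.
have T0 := capped_ge0 a_gt0 t.+1.
have c1 : 0 < 1 + extraction L L' * c_hit by rewrite ltr_pwDl.
rewrite -(ler_pM2r c1) [leRHS]mulrDl (mulrC (1 + extraction L L' * c_hit)^-1) divfK ?gt_eqF// hS.
have h5 : oscillation (t + N0.+1)%N * (extraction L L' * c_hit) <=
  oscillation t * (extraction L L' * c_hit) by rewrite ler_wpM2r.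
have h6 : 2 * capped a t.+1 <= 2 * capped a t.+1 * (1 + extraction L L' * c_hit).
  by rewrite ler_peMr ?mulr_ge0// lerDl.
have hO : oscillation t = hiE t + hiN t by [].
have hO' : oscillation (t + N0.+1)%N = hiE (t + N0.+1)%N + hiN (t + N0.+1)%N by [].
rewrite -/hiE -/hiN in h1 h2.
move: h1 h2 h5 h6; rewrite hO hO' /=.
set S1 := \sum_(k < t.+1) _ * hiE _; set S2 := \sum_(k < t.+1) _ * hiN _.
move: S1 S2 (capped a t.+1) (extraction L L' * c_hit) (e t m) (hiE t) (hiN t)
  (hiE (t + N0.+1)%N) (hiN (t + N0.+1)%N) => S1 S2 T c z x y x' y'.
lra.
Qed.

End oscillation.

(** * Constants uniform over all truncated systems *)

Section chain_constants.
Context {R : realType} (X : Type) (A A' : X -> nat -> nat -> R).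
Hypothesis AA' : decay_rates A A'.
Variables (theta K L L' : R).
Hypothesis theta01 : 0 < theta < 1.
Hypothesis L_ge0 : 0 <= L.
Hypothesis LL' : L < L'.
Hypothesis KL : K + theta * L' <= L.
Variables (c0 Nmax : nat) (delta rho : R).
Hypothesis delta01 : 0 < delta <= 1.
Hypothesis rho01 : 0 <= rho < 1.

(** All that the symbolic argument needs of a truncated system, required of every state and with
    constants that see neither J, H, tau nor m. The lemmas below fix a level before the chain is
    given. *)
Record chain (x : X) (J H : nat) (tau : nat -> nat) (m : seq nat -> R) : Prop := {
  chain_tau : forall j, (0 < tau j)%N ;
  chain_horizon : (H < tau J)%N ;
  chain_reference : reference J m theta K ;
  chain_tail : forall nu i, cone J m theta L' nu ->
    \sum_(j < J.+1) (i <= tau j)%:R * nu [:: val j] <= A x c0 i * nu [::] ;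
  chain_mass : exists I : seq nat, [/\ forall i, i \in I -> (0 < i <= Nmax)%N,
    \big[gcdn/0%N]_(i <- I) i = 1%N &
    forall nu i, cone J m theta L' nu -> i \in I -> delta * nu [::]
      <= \sum_(j < J.+1) ((tau j == i) && (j < J)%N)%:R * nu [:: val j]] }.

Lemma overshoot_constant : exists c, forall x J H tau m, chain x J H tau m ->
  forall nu t k, cone J m theta L' nu -> (t <= H)%N ->
    \sum_(u <- stop J tau t) (t + k < duration tau u)%:R * nu u
      <= A' x c k * nu [::].
Proof.
have [c hc] := rate_sum AA' c0; exists c => x J H tau m S nu t k nuC tH.
have [tau0 tauJ mr tl _] := S.
apply: le_trans (overshoot_le tau0 tauJ mr theta01 LL' KL tl _ k nuC tH) _.
  by move=> i; exact: (rate_ge0 AA').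
rewrite ler_wpM2r ?(cone_ge0 nuC)//; apply: (le_trans (hc x k.+1 t.+1)).
exact: (rate_noninc AA').
Qed.

Lemma return_constant : exists c, forall x J H tau m, chain x J H tau m ->
  forall s nu, cone J m theta L' nu -> (s <= H)%N ->
    return_weight J tau rho s nu <= A' x c s * nu [::].
Proof.
have [c hc] := rate_sum AA' c0.
have [c' hc'] := rate_solve AA' c 0 rho01.
exists c' => x J H tau m S s nu nuC sH; have [tau0 tauJ mr tl _] := S.
have rho01' : 0 <= rho <= 1 by case/andP: rho01 => -> /ltW.
have eb s' nu' : cone J m theta L' nu' ->
  `|return_weight J tau rho s' nu'| <= nu' [::] by exact: return_weight_bound.
have es := return_weight_scale J tau rho.
have tl' nu' k : cone J m theta L' nu' ->
    \sum_(j < J.+1) (k <= tau j)%:R * nu' [:: val j] <= A' x c k * nu' [::].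
  move=> nuC'; apply: (le_trans (tl nu' k nuC')); rewrite ler_wpM2r ?(cone_ge0 nuC')//.
  by have := hc x k 1%N; rewrite big_ord1 addn0.
pose M n := hi J H m theta L' (return_weight J tau rho) n.
have hM := @hc' x M H.
apply: (@le_trans _ _ (M s * nu [::])).
  by apply: (le_hi eb es); rewrite ?leqnn.
rewrite ler_wpM2r ?(cone_ge0 nuC)//; apply: hM => //.
  move=> n nH; apply/andP; split; last first.
    rewrite (le_trans (hi_le1 mr theta01 L_ge0 LL' eb nH))//.
    by rewrite -[leLHS]/(1%:R) ler_nat.
  have mC : cone J m theta L' m by exact: (reference_state mr theta01 L_ge0 LL').
  apply: le_trans (le_hi1 eb (_ : n <= n <= H)%N mC (reference_mass mr)).
    apply: sumr_ge0 => u _; rewrite mulr_ge0 ?(cone_ge0 mC)//.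
    by rewrite exprn_ge0//; case/andP: rho01.
  by rewrite leqnn.
move=> t; rewrite addn1 => tH.
apply: (return_weight_step tau0 tauJ mr theta01 L_ge0 LL' KL _ _ rho01') => //.
  by move=> k; exact: (rate_gt0 AA').
by move=> n n' nn; exact: (rate_noninc AA').
Qed.

(** Both the states and the times may differ. Taking for nu' the reference measure at one fixed time
    shows that all expectations at late times are close to one constant. *)
Lemma mixing_constant : exists c, forall x J H tau m, chain x J H tau m ->
  forall g lag, (forall s u, `|g s u| <= 1) ->
    (forall s j u, (tau j <= s)%N -> g s (j :: u) = g (s - tau j)%N u) ->
  forall n s s' nu nu', (n <= s <= H)%N -> (n <= s' <= H)%N ->
    cone J m theta L' nu -> cone J m theta L' nu' ->
    `|expectation J tau g lag s nu * nu' [::] - expectation J tau g lag s' nu' * nu [::]|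
      <= A' x c n * nu [::] * nu' [::].
Proof.
have [c1 ov] := overshoot_constant.
have [N1 hN1] := represents_uniform Nmax.
(* W makes an overshoot beyond W have probability at most 1/2, hence the 1/2 in [ch]. *)
have [W hW] := rate_small AA' c1 2.
case/andP: (delta01) => d0 d1.
pose ch := delta ^+ (N1.+1 + W) / 2.
have ch0 : 0 < ch by rewrite divr_gt0// exprn_gt0.
have ec : 0 < extraction L L' * ch by rewrite mulr_gt0// extraction_gt0.
have q01 : 0 <= (1 + extraction L L' * ch)^-1 < 1.
  have p0 : 0 < 1 + extraction L L' * ch by rewrite addr_gt0.
  by rewrite invr_ge0 (ltW p0)/= invf_lt1// ltrDl.
have [c hc] := rate_solve AA' c1 N1 q01.
exists c => x J H tau m S g lag gb gs n s s' nu nu' ns ns' nuC nuC'.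
have [tau0 tauJ mr tl [I [IN gI Im]]] := S.
have eF' : tower_functional J tau m theta L' (expectation J tau g lag).
  exact: expectation_functional.
have ov' nu0 t k : cone J m theta L' nu0 -> (t <= H)%N ->
    \sum_(u <- stop J tau t) (t + k < duration tau u)%:R * nu0 u
      <= A' x c1 k * nu0 [::] by exact: (ov _ _ _ _ _ S).
have hit nu0 d : cone J m theta L' nu0 -> (N1.+1 <= d <= H)%N ->
    ch * nu0 [::] <= \sum_(u <- stop J tau d.-1) (duration tau u == d)%:R * nu0 u.
  move=> nu0C; case: d => // d /andP[N1d dH].
  rewrite -[leRHS]/(hitting J tau d.+1 nu0).
  apply: (hitting_lower_bound tau0 tauJ mr theta01 LL' KL delta01 _ Im _ _ ov') => //.
  - by move=> i /IN /andP[].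
  - by move=> i N1i; apply: hN1 => //; exact: ltnW.
  - by rewrite N1d.
have osc : oscillation J H m theta L' (expectation J tau g lag) n <= A' x c n.
  apply: (hc x _ H) => //.
  - move=> k kH; exact: (oscillation_bound mr theta01 L_ge0 LL' eF').
  - move=> t tH; apply: (oscillation_step tau0 tauJ mr theta01 L_ge0 LL' KL _ eF' ov' _ hit) => //.
    + by move=> k; exact: (rate_gt0 AA').
    + exact: ltW.
  - by case/andP: ns => + sH => /leq_trans; apply.
have n0 := cone_ge0 nuC [::]; have n0' := cone_ge0 nuC' [::].
have hosc : oscillation J H m theta L' (expectation J tau g lag) n * nu [::] * nu' [::]
    <= A' x c n * nu [::] * nu' [::] by rewrite ler_wpM2r// ler_wpM2r.
rewrite ler_norml; apply/andP; split; last first.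
  exact: le_trans (oscillation_ge eF' ns ns' nuC nuC') hosc.
rewrite lerNl opprB; apply: le_trans (oscillation_ge eF' ns' ns nuC' nuC) _.
by rewrite mulrAC.
Qed.

End chain_constants.

(** * Observables on the symbolic tower *)

Section return_counts.
Variables (J : nat) (tau : nat -> nat).
Hypothesis tau_gt0 : forall j, (0 < tau j)%N.

Fixpoint count_returns (s : nat) (u : seq nat) : nat :=
  if u is j :: v then
    if (tau j <= s)%N then (count_returns (s - tau j) v).+1 else 0
  else 0.

(* The number of returns in the time interval ]t, t + k]. *)
Fixpoint returns_between (t k : nat) (u : seq nat) : nat :=
  if u is j :: v then
    if (tau j <= t)%N then returns_between (t - tau j) k v
    else if (tau j <= t + k)%N then (count_returns (t + k - tau j) v).+1 else 0
  else 0.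

Fixpoint cut (h : nat) (u : seq nat) : seq nat :=
  if u is j :: v then
    if (tau j <= h)%N then j :: cut (h - tau j) v else [:: j]
  else [::].

Lemma mem_stop_cons j u h : (j :: u \in stop J tau h) =
  (j <= J)%N && (if (tau j <= h)%N then u \in stop J tau (h - tau j) else u == [::]).
Proof.
rewrite {1}/stop stop_fuelS; apply/flattenP/andP => [[s /mapP[i + ->{s}]]|[jJ]].
  rewrite mem_iota /= add0n ltnS => iJ; case: ifP => ih.
    case/mapP => v + [-> ->]; rewrite stop_fuelE// ?iJ ?ih//.
    by have := tau_gt0 i; move: ih; clear; lia.
  by rewrite inE => /eqP[-> ->]; rewrite iJ ih.
case: ifP => jh.
  move=> us; exists [seq j :: v | v <- stop J tau (h - tau j)].
    apply/mapP; exists j; first by rewrite mem_iota.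
    rewrite jh stop_fuelE//.
    by have := tau_gt0 j; move: jh; clear; lia.
  by apply/mapP; exists u.
move/eqP => ->; exists [:: [:: j]]; last by rewrite inE.
by apply/mapP; exists j; rewrite ?mem_iota ?jh.
Qed.

Lemma count_returns_stop s u v : u \in stop J tau s ->
  count_returns s (u ++ v) = (size u).-1.
Proof.
elim: u s => [|j u IH] s; first by move/(stopP tau_gt0) => [].
rewrite mem_stop_cons /= => /andP[_]; case: ifP => [js us|_ /eqP->//].
rewrite IH//; have [_ u0 _] := stopP tau_gt0 us.
by rewrite prednK// lt0n size_eq0.
Qed.

Lemma returns_between_stop t k u v : u \in stop J tau t ->
  returns_between t k (u ++ v) =
    if (duration tau u <= t + k)%N then (count_returns (t + k - duration tau u) v).+1 else 0%N.
Proof.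
elim: u t => [|j u IH] t; first by move/(stopP tau_gt0) => [].
rewrite mem_stop_cons /= => /andP[_]; rewrite /duration/= -/(duration tau u).
case: ifP => jt; last by move/eqP => ->; rewrite /duration/= addn0.
move/IH => ->.
have -> : (duration tau u <= t - tau j + k)%N = (tau j + duration tau u <= t + k)%N.
  by move: jt; clear; lia.
by rewrite subnDA addnBAC.
Qed.

Lemma cut_cat h u v : (h < duration tau u)%N -> cut h (u ++ v) = cut h u.
Proof.
elim: u h => [|j u IH] h; first by rewrite /duration.
rewrite /duration/= -/(duration tau u) => hu; case: ifP => // jh.
by rewrite IH//; move: jh hu; clear; lia.
Qed.

End return_counts.

(** * Words that start on a given floor of the tower *)

Section started_words.
Context {R : realType} (X : Type) (A A' : X -> nat -> nat -> R).
Hypothesis AA' : decay_rates A A'.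
Variables (theta K L L' : R).
Hypothesis theta01 : 0 < theta < 1.
Hypothesis L_ge0 : 0 <= L.
Hypothesis LL' : L < L'.
Hypothesis KL : K + theta * L' <= L.
Variables (c0 Nmax : nat) (delta rho : R).
Hypothesis rho01 : 0 <= rho < 1.
Variables (x : X) (J H : nat) (tau : nat -> nat) (m : seq nat -> R).
Hypothesis S : chain A theta K L' c0 Nmax delta x J H tau m.
Variable p : seq nat -> R.
Hypothesis p_cone : cone J m theta L' p.

Let state := cone J m theta L'.
Let tau_gt0 := chain_tau S.
Let tauJ := chain_horizon S.
Let m_ref := chain_reference S.
Let dur := duration tau.
Let stopt := stop J tau.

(** Floor l of the tower lies over the points whose first return time exceeds l. Words starting with
    J are discarded and charged to the part of the tower left out. *)
Definition starts_above (l : nat) (u : seq nat) : bool :=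
  if u is j :: _ then (l < tau j)%N && (j < J)%N else false.

Definition started (l : nat) (u : seq nat) : R := (starts_above l u)%:R * p u.

Definition started_mass (l : nat) : R := \sum_(j < J.+1) started l [:: val j].

Lemma started_ge0 l u : 0 <= started l u.
Proof. by rewrite mulr_ge0// (cone_ge0 p_cone). Qed.

Lemma started_cat l u v : u != [::] ->
  started l (u ++ v) = (starts_above l u)%:R * shift p u v.
Proof. by case: u. Qed.

Lemma started_massE l h : \sum_(u <- stopt h) started l u = started_mass l.
Proof.
rewrite sum_stop//; apply: eq_bigr => j _; case: ifP => // jh.
rewrite -mulr_sumr; congr (_ * _).
have := sum_stop_mass (h - tau j) tau_gt0
  (additive_shift [:: val j] (cone_additive p_cone)).
by rewrite /shift cats0.
Qed.

Lemma started_refine l h u : u \in stopt h -> (dur u <= H)%N ->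
  exists2 q : seq nat -> R, state q & (q [::] = p u /\
    forall v, started l (u ++ v) = (starts_above l u)%:R * q v).
Proof.
move=> us uH; have [_ u0 _] := stopP tau_gt0 us; exists (shift p u).
  exact: (state_shiftW tau_gt0 tauJ m_ref theta01 LL' KL p_cone us uH).
by split=> [|w]; [rewrite /shift cats0|exact: started_cat].
Qed.

Definition started_overshoot (l t k : nat) : R :=
  \sum_(u <- stopt t) (t + k < dur u)%:R * started l u.

(** Restricting the first return time to values above l destroys the cone property. The first letter
    is therefore treated apart: its own tail is the second term, and after it the measure is a state
    again. *)
Lemma started_overshoot_le l t k (a : R) : (t <= H)%N ->
  (forall nu t k', k' = k -> state nu -> (t <= H)%N ->
    \sum_(u <- stopt t) (t + k' < dur u)%:R * nu u <= a * nu [::]) -> 0 <= a ->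
  started_overshoot l t k <= a * started_mass l
    + \sum_(j < J.+1) (t + k < tau j)%:R * started l [:: val j].
Proof.
move=> tH ov a0; rewrite /started_overshoot sum_stop// mulr_sumr -big_split/=.
apply: ler_sum => j _; case: ifP => jt; last first.
  by rewrite /dur /duration/= addn0 lerDr mulr_ge0// started_ge0.
apply: (@le_trans _ _ (a * started l [:: val j])); last by rewrite lerDl mulr_ge0// started_ge0.
rewrite /started /=; case: (_ && _); last first.
  by rewrite mul0r mulr0 big1// => u _; rewrite mul0r mulr0.
rewrite mul1r.
have jH : (tau j <= H)%N by exact: leq_trans jt tH.
have sC := state_letter tauJ m_ref theta01 LL' KL p_cone (ltn_ord j) jH.
have := ov _ (t - tau j)%N k erefl sC (leq_trans (leq_subr _ _) tH).
rewrite {2}/shift cats0; apply: le_trans; rewrite le_eqVlt; apply/orP; left; apply/eqP.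
apply: eq_bigr => u _; rewrite mul1r /dur /duration/= -/(duration tau u).
by rewrite (_ : (t + k < _) = (t - tau j + k < duration tau u))%N//;
  move: jt; clear; lia.
Qed.

(** Stop at the first return after t. Unless it comes after t + k', at least k - k' of the window is
    left to a state, whose return weight is at most r. *)
Lemma started_returns l t k k' h (r : R) : (k' <= k)%N -> (t + k <= h)%N -> (t + k <= H)%N ->
  0 <= r ->
  (forall nu s, state nu -> (k - k' <= s)%N -> (s <= H)%N -> return_weight J tau rho s nu <= r * nu [::]) ->
  \sum_(u <- stopt h) rho ^+ (returns_between tau t k u) * started l u
    <= r * started_mass l + started_overshoot l t k'.
Proof.
move=> kk th tH r0 hr; have [rho0 rho1] := andP rho01.
have tht : (t <= h)%N by rewrite (leq_trans _ th)// leq_addr.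
rewrite (sum_stop_refine J tau_gt0 _ tht) -/dur.
rewrite -(started_massE l t) mulr_sumr -big_split/= big_seq [leRHS]big_seq.
apply: ler_sum => u us; have [tu u0 _] := stopP tau_gt0 us; rewrite -/dur in tu.
have s0 := started_ge0 l u.
have ler1 w : rho ^+ (returns_between tau t k w) * started l w <= started l w.
  by rewrite ler_piMl ?started_ge0// exprn_ile1// ltW.
have [uk|uk] := ltnP (t + k') (dur u).
  apply: (@le_trans _ _ (started l u)); last by rewrite mul1r lerDr mulr_ge0.
  case: ifP => // _.
  apply: (@le_trans _ _ (\sum_(u' <- stopt (h - dur u)) started l (u ++ u'))).
    by apply: ler_sum => u' _; exact: ler1.
  under eq_bigr do rewrite started_cat//.
  rewrite -mulr_sumr (sum_stop_mass _ tau_gt0); last exact/additive_shift/(cone_additive p_cone).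
  by rewrite /shift cats0.
have utk : (dur u <= t + k)%N by rewrite (leq_trans uk)// leq_add2l.
rewrite (leq_trans utk th) mul0r addr0.
have udH : (dur u <= H)%N by exact: leq_trans utk tH.
have [q qC [q0 qE]] := started_refine l us udH.
under eq_bigr do rewrite (returns_between_stop tau_gt0 _ _ us) -/dur utk qE mulrCA.
rewrite -mulr_sumr /started mulrCA ler_wpM2l// -q0.
set s := (t + k - dur u)%N.
have sH : (s <= H)%N by rewrite (leq_trans (leq_subr _ _)).
have ks : (k - k' <= s)%N by move: uk utk kk; rewrite /s; clear; lia.
apply: le_trans (hr q s qC ks sH).
have shd : (s <= h - dur u)%N by rewrite leq_sub2r.
rewrite (sum_stop_refine J tau_gt0 _ shd) /return_weight -/dur.
rewrite big_seq [leRHS]big_seq; apply: ler_sum => w ws.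
have qw0 z : 0 <= q z by exact: (cone_ge0 qC).
have rw v : rho ^+ (count_returns tau s (w ++ v)).+1 * q (w ++ v)
    <= rho ^+ (size w).-1 * q (w ++ v).
  rewrite (count_returns_stop tau_gt0 _ ws) exprSr -mulrA ler_wpM2l ?exprn_ge0//.
  by rewrite ler_piMl// ltW.
case: ifP => _; last by have := rw [::]; rewrite cats0.
apply: (@le_trans _ _ (\sum_(v <- stop J tau (h - dur u - dur w))
    rho ^+ (size w).-1 * shift q w v)).
  by apply: ler_sum => v _; exact: rw.
rewrite -mulr_sumr (sum_stop_mass _ tau_gt0); last exact/additive_shift/(cone_additive qC).
by rewrite /shift cats0.
Qed.

(** At the first return after t the factor V is determined. If the overshoot is at most k, a state
    with at least s0 time left follows, and its expectation is [ebar] up to b; otherwise the product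
    is bounded by 2. *)
Lemma started_mixing l t k s s0 b ebar (g : nat -> seq nat -> R) lag (V : seq nat -> R) :
  (t + k + s0 <= s)%N -> (s <= H)%N -> 0 <= b ->
  (forall s u, `|g s u| <= 1) ->
  (forall s j u, (tau j <= s)%N -> g s (j :: u) = g (s - tau j)%N u) ->
  `|ebar| <= 1 -> (forall u, `|V u| <= 1) ->
  (forall u v, (t < dur u)%N -> V (u ++ v) = V u) ->
  (forall nu s', state nu -> (s0 <= s' <= H)%N ->
     `|expectation J tau g lag s' nu - ebar * nu [::]| <= b * nu [::]) ->
  `|\sum_(u <- stopt (s + lag)) V u * (g s u - ebar) * started l u|
    <= b * started_mass l + 2 * started_overshoot l t k.
Proof.
move=> tks sH b0 gb gs eb Vb Vc hb.
have ts : (t <= s + lag)%N by move: tks; clear; lia.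
rewrite (sum_stop_refine J tau_gt0 _ ts) -/dur.
apply: (le_trans (ler_norm_sum _ _ _)).
rewrite -(started_massE l t) !mulr_sumr -big_split/= big_seq [leRHS]big_seq.
apply: ler_sum => u us; have [tu u0 _] := stopP tau_gt0 us; rewrite -/dur in tu.
have s00 := started_ge0 l u.
have le2 w : `|V w * (g s w - ebar) * started l w| <= 2 * started l w.
  rewrite normrM (ger0_norm (started_ge0 l w)) ler_wpM2r ?started_ge0//.
  rewrite normrM -[leRHS]mul1r ler_pM//; apply: (le_trans (ler_normB _ _)).
  by rewrite -[leRHS]/(1 + 1) lerD.
have [uk|uk] := ltnP (t + k) (dur u).
  apply: (@le_trans _ _ (2 * started l u)); last by rewrite mul1r lerDr mulr_ge0.
  case: ifP => // _; apply: (le_trans (ler_norm_sum _ _ _)).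
  apply: (@le_trans _ _ (\sum_(u' <- stopt (s + lag - dur u)) 2 * started l (u ++ u'))).
    by apply: ler_sum => u' _; exact: le2.
  under eq_bigr do rewrite started_cat//.
  rewrite -mulr_sumr -mulr_sumr (sum_stop_mass _ tau_gt0).
    by rewrite /shift cats0.
  exact/additive_shift/(cone_additive p_cone).
have us0 : (s0 <= s - dur u)%N by move: tks uk; clear; lia.
have uss : (dur u <= s)%N by move: tks uk; clear; lia.
rewrite (leq_trans uss (leq_addr _ _)) mul0r mulr0 addr0.
have udH : (dur u <= H)%N by exact: leq_trans uss sH.
have [q qC [q0 qE]] := started_refine l us udH.
have -> : \sum_(u' <- stop J tau (s + lag - dur u))
    V (u ++ u') * (g s (u ++ u') - ebar) * started l (u ++ u')
  = (starts_above l u)%:R * V u * (expectation J tau g lag (s - dur u) q - ebar * q [::]).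
  rewrite /expectation addnC -addnBA// addnC.
  rewrite -(sum_stop_mass (J := J) (s - dur u + lag) tau_gt0 (cone_additive qC)).
  rewrite mulr_sumr -sumrB mulr_sumr; apply: eq_bigr => u' _.
  by rewrite Vc// qE (g_cat gs _ uss); ring.
rewrite !normrM normr_nat /started mulrCA -mulrA ler_wpM2l//.
apply: (@le_trans _ _ (1 * (b * q [::]))); last by rewrite mul1r q0.
by rewrite ler_pM//; apply: hb; rewrite // us0 (leq_trans (leq_subr _ _)).
Qed.

(** A union bound: at most [h.+1] letters are read, as each takes a positive time, and each is J
    with conditional probability at most eta. *)
Lemma started_dagger l h (eta : R) : (h <= H)%N -> 0 <= eta ->
  (forall nu, state nu -> nu [:: J] <= eta * nu [::]) ->
  \sum_(u <- stopt h) (J \in u)%:R * started l u <= h.+1%:R * eta * started_mass l.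
Proof.
move=> hH eta0 he.
have main h' nu : (h' <= H)%N -> state nu ->
    \sum_(u <- stopt h') (J \in u)%:R * nu u <= h'.+1%:R * eta * nu [::].
  have [n] := ubnP h'; elim: n h' nu => // n IH h' nu; rewrite ltnS => hn hH' nuC.
  rewrite sum_stop// -natr1 mulrDl mul1r mulrDl.
  apply: (@le_trans _ _ (\sum_(j < J.+1) (h'%:R * eta * nu [:: val j]
      + (val j == J)%:R * nu [:: val j]))); last first.
    rewrite big_split/= -mulr_sumr (state_mass nuC) lerD2l.
    rewrite (bigD1 ord_max)//= eqxx mul1r big1 ?addr0; first exact: he.
    by move=> j jJ; rewrite (_ : (val j == J) = false) ?mul0r//; apply/negbTE.
  apply: ler_sum => j _; have nuj : 0 <= nu [:: val j] by exact: (cone_ge0 nuC).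
  case: ifP => jh; last first.
    by rewrite mem_seq1 eq_sym lerDr !mulr_ge0.
  have jH : (tau j <= H)%N by exact: leq_trans jh hH'.
  have jJ := letter_good tauJ (ltn_ord j) jH.
  have sC := state_letter tauJ m_ref theta01 LL' KL nuC (ltn_ord j) jH.
  have j0 := tau_gt0 j.
  have hlt : (h' - tau j < n)%N by move: jh j0 hn; clear; lia.
  have := IH (h' - tau j)%N _ hlt (leq_trans (leq_subr _ _) hH') sC.
  rewrite {2}/shift cats0 => h1; apply: (@le_trans _ _ (h'%:R * eta * nu [:: val j])); last first.
    by rewrite lerDl mulr_ge0.
  apply: le_trans (_ : _ <= (h' - tau j).+1%:R * eta * nu [:: val j]) _; last first.
    by rewrite ler_wpM2r// ler_wpM2r// ler_nat; move: jh j0; clear; lia.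
  apply: le_trans h1.
  rewrite le_eqVlt; apply/orP; left; apply/eqP; apply: eq_bigr => u _.
  by rewrite inE gtn_eqF.
rewrite /started_mass mulr_sumr sum_stop//; apply: ler_sum => j _.
rewrite /started /=; case: andP => [[_ jJ]|_]; last first.
  rewrite !mul0r !mulr0; case: ifP => // _.
  by rewrite big1// => u _; rewrite mul0r mulr0.
have nuj : 0 <= p [:: val j] by exact: (cone_ge0 p_cone).
case: ifP => jh; last first.
  by rewrite mem_seq1 gtn_eqF// mul0r mul1r !mulr_ge0.
have jH : (tau j <= H)%N by exact: leq_trans jh hH.
have sC := state_letter tauJ m_ref theta01 LL' KL p_cone (ltn_ord j) jH.
have := main (h - tau j)%N _ (leq_trans (leq_subr _ _) hH) sC.
rewrite {2}/shift cats0 => h1; rewrite mul1r.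
apply: le_trans (_ : _ <= (h - tau j).+1%:R * eta * p [:: val j]) _; last first.
  by rewrite ler_wpM2r// ler_wpM2r// ler_nat ltnS leq_subr.
apply: le_trans h1; rewrite le_eqVlt; apply/orP; left; apply/eqP.
by apply: eq_bigr => u _; rewrite inE gtn_eqF// mul1r.
Qed.

End started_words.

Section tower_estimate.
Context {R : realType} (X : Type) (A A' : X -> nat -> nat -> R).
Hypothesis AA' : decay_rates A A'.
Variables (theta K L L' : R).
Hypothesis theta01 : 0 < theta < 1.
Hypothesis L_ge0 : 0 <= L.
Hypothesis LL' : L < L'.
Hypothesis KL : K + theta * L' <= L.
Variables (c0 Nmax : nat) (delta rho : R).
Hypothesis delta01 : 0 < delta <= 1.
Hypothesis rho01 : 0 <= rho < 1.

(** Two windows for each of the two observables: returns in the first contract the past, those in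
    the second the future. The last term is the trivial bound on words that meet J. *)
Definition word_error (tau : nat -> nat) J (l n k : nat) (u : seq nat) : R :=
  rho ^+ returns_between tau l k u + rho ^+ returns_between tau (l + k) k u
  + rho ^+ returns_between tau (l + n) k u
  + rho ^+ returns_between tau (l + n + k) k u + (J \in u)%:R.

(** The time n pays for windows of length k = n / 8 and for overshoots of at most k2 = n / 16: the
    first observable is read off by l + 2k, and after the next return at least k is left for mixing.
    Summed over the floors, the masses M l are normalized by T, while the first-letter tails D l add
    up to a tail sum, again of order [A']. *)
Lemma tower_estimate : exists c, forall x J H tau m,
  chain A theta K L' c0 Nmax delta x J H tau m ->
  forall p, cone J m theta L' p -> p [::] = 1 ->
  forall n Hl (T eta : R) (gv gw : nat -> seq nat -> R),
  0 <= T <= 1 -> T * (\sum_(l < Hl) started_mass J tau p l) <= 1 ->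
  (Hl + n + (n %/ 8 + n %/ 8) <= H)%N ->
  0 <= eta -> (forall nu, cone J m theta L' nu -> nu [:: J] <= eta * nu [::]) ->
  H.+1%:R * eta <= A' x 0%N n ->
  (forall s u, `|gv s u| <= 1) -> (forall s u, `|gw s u| <= 1) ->
  (forall s j u, (tau j <= s)%N -> gw s (j :: u) = gw (s - tau j)%N u) ->
  (forall l u v, (l + (n %/ 8 + n %/ 8) < duration tau u)%N -> gv l (u ++ v) = gv l u) ->
  let k := (n %/ 8)%N in
  let ebar := expectation J tau gw (k + k) k m in
  `|ebar| <= 1 /\
  T * (\sum_(l < Hl) (`|\sum_(u <- stop J tau (l + n + (k + k)))
         gv l u * (gw (l + n)%N u - ebar) * started J tau p l u|
     + \sum_(u <- stop J tau (l + n + (k + k)))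
         word_error tau J l n k u * started J tau p l u)) <= A' x c n.
Proof.
have [co ov] := overshoot_constant AA' theta01 LL' KL c0 Nmax delta.
have [cr rt] := return_constant AA' theta01 L_ge0 LL' KL c0 Nmax delta rho01.
have [cm mx] := mixing_constant AA' theta01 L_ge0 LL' KL c0 Nmax delta01.
have [cs sm] := rate_sum AA' c0.
pose c1 := (co + cr + cm + cs)%N.
(* 18 = 12 + 6 from the bound [12 * a * M l + 6 * D l] on each floor; [15.+1] = 16 undoes k2 = n /
   16. *)
have [c2 hc2] := rate_scale AA' c1 18.
have [c3 hc3] := rate_dilate AA' c2 15.
exists c3 => x J H tau m S p pC p1 n Hl T eta gv gw /andP[T0 T1] TM HH eta0 he hH
  gvb gwb gws gvc k ebar.
have [tau0 tauJ mr tl _] := S.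
pose k2 := (n %/ 16)%N; pose a := A' x c1 k2.
have a0 : 0 <= a by exact/ltW/(rate_gt0 AA').
have k2k : (k2 + k2 <= k)%N by rewrite /k2 /k; clear; lia.
have kn : (k + k + k2 + k <= n)%N by rewrite /k2 /k; clear; lia.
have leA c i : (c <= c1)%N -> (k2 <= i)%N -> A' x c i <= a.
  move=> cc ki; apply: (le_trans (rate_noninc AA' x c ki)); exact: (rate_mono AA').
have eb : `|ebar| <= 1.
  have eF : tower_functional J tau m theta L' (expectation J tau gw (k + k)).
    exact: expectation_functional.
  have mC : cone J m theta L' m by exact: (reference_state mr theta01 L_ge0 LL').
  by rewrite -(reference_mass mr); exact: (tf_bound eF).
split=> //.
have HlH l : (l < Hl)%N -> (l + n + (k + k) <= H)%N.
  by move=> lH; apply: leq_trans HH; rewrite -/k !leq_add2r ltnW.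
have ov' nu t : cone J m theta L' nu -> (t <= H)%N ->
    \sum_(u <- stop J tau t) (t + k2 < duration tau u)%:R * nu u <= a * nu [::].
  move=> nuC tH; apply: (le_trans (ov _ _ _ _ _ S nu t k2 nuC tH)).
  by rewrite ler_wpM2r ?(cone_ge0 nuC)//; apply: leA => //; rewrite /c1; clear; lia.
have rt' nu s : cone J m theta L' nu -> (k - k2 <= s)%N -> (s <= H)%N ->
    return_weight J tau rho s nu <= a * nu [::].
  move=> nuC ks sH; apply: (le_trans (rt _ _ _ _ _ S s nu nuC sH)).
  rewrite ler_wpM2r ?(cone_ge0 nuC)//; apply: leA; first by rewrite /c1; clear; lia.
  by move: k2k ks; clear; lia.
pose M l := started_mass J tau p l.
have M0 l : 0 <= M l by apply: sumr_ge0 => j _; exact: (started_ge0 tau pC).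
pose D l := \sum_(j < J.+1) (l + k2 < tau j)%:R * p [:: val j].
have ovl l t : (l <= t)%N -> (t <= H)%N ->
    started_overshoot J tau p l t k2 <= a * M l + D l.
  move=> lt tH; apply: le_trans (started_overshoot_le theta01 LL' KL S pC l tH _ a0) _.
    by move=> nu t' k' -> nuC t'H; exact: ov'.
  rewrite lerD2l; apply: ler_sum => j _; rewrite /started.
  have pj : 0 <= p [:: val j] by exact: (cone_ge0 pC).
  rewrite mulrA ler_wpM2r// -natrM ler_nat.
  have [h1|h1] := ltnP (t + k2) (tau j); last by rewrite mul0n.
  by rewrite mul1n (leq_ltn_trans _ h1) ?leq_add2r// leq_b1.
(* The correlation gives 3 a M + 2 D, each of the four windows 2 a M + D, and the letter J gives a
   M. *)
have main l : (l < Hl)%N ->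
    `|\sum_(u <- stop J tau (l + n + (k + k)))
         gv l u * (gw (l + n)%N u - ebar) * started J tau p l u|
     + \sum_(u <- stop J tau (l + n + (k + k)))
         word_error tau J l n k u * started J tau p l u <= 12 * a * M l + 6 * D l.
  move=> lH; have hH' := HlH l lH.
  have H1 : `|\sum_(u <- stop J tau (l + n + (k + k)))
         gv l u * (gw (l + n)%N u - ebar) * started J tau p l u|
      <= a * M l + 2 * started_overshoot J tau p l (l + (k + k)) k2.
    apply: (@started_mixing _ _ A theta K L L' theta01 LL' KL c0 Nmax delta x J H tau m S
      p pC l (l + (k + k))%N k2 (l + n)%N k a ebar gw (k + k)%N (gv l)) => //.
    - by move: kn; clear; lia.
    - by move: hH'; clear; lia.
    - by move=> u v tu; apply: gvc.
    move=> nu s' nuC s'H.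
    have mC : cone J m theta L' m by exact: (reference_state mr theta01 L_ge0 LL').
    have kH : (k <= k <= H)%N by rewrite leqnn; case/andP: s'H => /leq_trans h /h.
    have := mx _ _ _ _ _ S gw (k + k)%N gwb gws k s' k nu m s'H kH nuC mC.
    rewrite (reference_mass mr) !mulr1; move/le_trans; apply.
    rewrite ler_wpM2r ?(cone_ge0 nuC)//; apply: leA; first by rewrite /c1; clear; lia.
    by move: k2k; clear; lia.
  have H2 t : (l <= t)%N -> (t + k <= l + n + (k + k))%N ->
      \sum_(u <- stop J tau (l + n + (k + k)))
        rho ^+ (returns_between tau t k u) * started J tau p l u <= a * M l + (a * M l + D l).
    move=> lt th; have tkH : (t + k <= H)%N by exact: leq_trans th hH'.
    have tH : (t <= H)%N by rewrite (leq_trans _ tkH)// leq_addr.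
    apply: le_trans (lerD (lexx _) (ovl l t lt tH)).
    apply: (started_returns theta01 LL' KL rho01 S pC) => //.
    by move: k2k; clear; lia.
  have H3 : \sum_(u <- stop J tau (l + n + (k + k))) (J \in u)%:R * started J tau p l u
      <= a * M l.
    apply: (le_trans (started_dagger theta01 LL' KL S pC l hH' eta0 he)).
    rewrite ler_wpM2r//; apply: (@le_trans _ _ (A' x 0%N n)).
      by apply: le_trans hH; rewrite ler_wpM2r// ler_nat ltnS.
    by apply: leA => //; rewrite /k2; exact: leq_div.
  have -> : \sum_(u <- stop J tau (l + n + (k + k)))
         word_error tau J l n k u * started J tau p l u =
    \sum_(u <- stop J tau (l + n + (k + k)))
      rho ^+ returns_between tau l k u * started J tau p l u
    + \sum_(u <- stop J tau (l + n + (k + k)))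
      rho ^+ returns_between tau (l + k) k u * started J tau p l u
    + \sum_(u <- stop J tau (l + n + (k + k)))
      rho ^+ returns_between tau (l + n) k u * started J tau p l u
    + \sum_(u <- stop J tau (l + n + (k + k)))
      rho ^+ returns_between tau (l + n + k) k u * started J tau p l u
    + \sum_(u <- stop J tau (l + n + (k + k))) (J \in u)%:R * started J tau p l u.
    by rewrite -!big_split/=; apply: eq_bigr => u _; rewrite -!mulrDl.
  have lkH : (l + (k + k) <= H)%N by move: hH'; clear; lia.
  have h20 := ovl l (l + (k + k))%N (leq_addr _ _) lkH.
  have i1 : (l + k <= l + n + (k + k))%N by clear; lia.
  have i2 : (l + k + k <= l + n + (k + k))%N by clear; lia.
  have i3 : (l + n + k <= l + n + (k + k))%N by clear; lia.
  have i4 : (l + n + k + k <= l + n + (k + k))%N by clear; lia.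
  have h21 := H2 l (leqnn _) i1; have h22 := H2 (l + k)%N (leq_addr _ _) i2.
  have h23 := H2 (l + n)%N (leq_addr _ _) i3.
  have l4 : (l <= l + n + k)%N by clear; lia.
  have h24 := H2 (l + n + k)%N l4 i4.
  rewrite -[12 * a * M l]mulrA.
  have h1' : a * M l + 2 * started_overshoot J tau p l (l + (k + k)) k2
      <= a * M l + 2 * (a * M l + D l) by rewrite lerD2l ler_wpM2l.
  apply: le_trans (lerD (le_trans H1 h1') (lerD (lerD (lerD (lerD h21 h22) h23) h24) H3)) _.
  rewrite le_eqVlt; apply/orP; left; apply/eqP.
  by move: (a * M l) (D l) => y d; ring.
have hD : \sum_(l < Hl) D l <= a.
  apply: (@le_trans _ _ (A' x cs k2.+1)).
    apply: le_trans (sm x k2.+1 Hl); apply: ler_sum => l _.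
    rewrite -[leRHS]mulr1 -p1; apply: le_trans (tl p (k2.+1 + l)%N pC).
    rewrite le_eqVlt; apply/orP; left; apply/eqP; apply: eq_bigr => j _.
    by rewrite addSn addnC.
  by apply: leA => //; rewrite /c1; clear; lia.
have D0 l : 0 <= D l.
  by apply: sumr_ge0 => j _; rewrite mulr_ge0// (cone_ge0 pC).
apply: (@le_trans _ _ (T * (\sum_(l < Hl) (12 * a * M l + 6 * D l)))).
  by rewrite ler_wpM2l//; apply: ler_sum => l _; exact: main.
rewrite big_split/= -!mulr_sumr mulrDr.
have e1 : T * (12 * a * \sum_(l < Hl) M l) <= 12 * a.
  by rewrite mulrCA ler_piMr// mulr_ge0.
have e2 : T * (6 * \sum_(l < Hl) D l) <= 6 * a.
  rewrite mulrCA ler_wpM2l//; apply: le_trans hD; rewrite ler_piMl//.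
  by rewrite sumr_ge0.
apply: le_trans (lerD e1 e2) _; rewrite -mulrDl.
apply: le_trans (hc3 x n); apply: le_trans (hc2 x k2).
by rewrite -natrD.
Qed.

End tower_estimate.

(** * Regularity of the invariant density *)

Section expanding_distortion.
Context {R : realType} {d : measure_display} {X : measurableType d}.
Variables (F : X -> X) (D : set nat) (a : nat -> set X) (m : probability X R).
Variables (zeta : X -> R) (dist : X -> X -> R) (theta K : R).
Hypothesis ue : uniformly_expanding F D a m zeta dist theta^-1 K.
Hypothesis theta01 : 0 < theta < 1.
Hypothesis K_ge0 : 0 <= K.

Definition mass (B : set X) : R := fine (m B).

Lemma massE B : measurable B -> (mass B)%:E = m B.
Proof. by move=> mB; rewrite /mass fineK// fin_num_measure. Qed.

Lemma mass_ge0 B : 0 <= mass B.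
Proof. by rewrite fine_ge0. Qed.

Lemma measurable_preimage B : measurable B -> measurable (F @^-1` B).
Proof. by move=> mB; rewrite -[X in measurable X]setTI; exact: (ue_measurable ue). Qed.

Lemma branch_image_mass A E B : measure_bijection_on F m A E -> measurable B ->
  m (F @` ((A `&` F @^-1` B) `&` E)) = m B.
Proof.
case=> mE EA _ Einj [FE FE0] mB.
have mFE : measurable (F @` E) by apply: FE.
have -> : F @` ((A `&` F @^-1` B) `&` E) = B `&` F @` E.
  apply/seteqP; split=> [_ [x [[_ Bx] Ex] <-]|y [By [x Ex xE]]].
    by split=> //; exists x.
  by exists x => //; split=> //; split; [exact: EA|rewrite /= xE].
apply/esym; apply: (etrans (measureDI m mB mFE)).
rewrite -[RHS]add0e; congr (_ + _)%E.
apply: (subset_measure0 _ _ (@subIsetr _ _ _) FE0); last exact: measurableC.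
by apply: measurableD.
Qed.

(** The mass on the branch over B is an integral of zeta against a measure giving it mass m B.
    Distortion replaces zeta there by its value at any one point over B', up to exp (K D0);
    integrating over that point concludes. *)
Lemma branch_distortion j B B' (D0 : R) : D j -> measurable B -> measurable B' ->
  (forall x y, B x -> B' y -> dist x y <= D0) ->
  mass (a j `&` F @^-1` B) * mass B'
    <= expR (K * D0) * (mass (a j `&` F @^-1` B') * mass B).
Proof.
move=> Dj mB mB' hD.
have [E [bE [mF [mFE mFd]]]] := ue_branch ue Dj.
have ma := ue_measurable_cell ue Dj.
have mA C : measurable C -> measurable (a j `&` F @^-1` C).
  by move=> mC; apply: measurableI => //; exact: measurable_preimage.
have mFA C : measurable C -> mF (a j `&` F @^-1` C) = m C.
  by move=> mC; rewrite mFE ?branch_image_mass//; exact: mA.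
have mz (C : set X) : measurable_fun C (EFin \o zeta).
  by apply: measurable_funTS; apply/measurable_EFinP; exact: (ue_measurable_density ue).
(* The lower bound c for zeta divides by the mass of B; a null B has a null preimage by
   nonsingularity. *)
have [b0|bN] := eqVneq (mass B) 0.
  have -> : mass (a j `&` F @^-1` B) = 0.
    have : m (F @^-1` B) = 0%E by apply: (ue_nonsingular ue) => //; rewrite -massE// b0.
    move=> h; rewrite /mass (subset_measure0 _ _ (@subIsetr _ _ _) h)//; first exact: mA.
    exact: measurable_preimage.
  by rewrite mul0r b0 !mulr0.
have bp : 0 < mass B by rewrite lt0r bN mass_ge0.
have e0 := expR_gt0 (K * D0).
pose c := mass (a j `&` F @^-1` B) / (expR (K * D0) * mass B).
have cz y : (a j `&` F @^-1` B') y -> c <= zeta y.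
  move=> [ay By]; rewrite ler_pdivrMr ?mulr_gt0//.
  rewrite -lee_fin massE; last exact: mA.
  rewrite (mFd _ (mA _ mB)); last exact: subIsetl.
  apply: (@le_trans _ _ (\int[mF]_(x in a j `&` F @^-1` B)
      (cst (zeta y * expR (K * D0))%:E x))%E).
    apply: ge0_le_integral => //; [exact: mA| |].
    - by move=> x _; rewrite lee_fin ltW// (ue_density_gt0 ue).
    - move=> x [ax Bx]; rewrite lee_fin.
      have z0 := ue_density_gt0 ue.
      rewrite -[X in X <= _](lnK (z0 x)) -[X in X * _](lnK (z0 y)) -expRD ler_expR.
      rewrite -lerBlDl; apply: (le_trans (ler_norm _)).
      apply: (le_trans (ue_distortion ue Dj ax ay)).
      by rewrite ler_wpM2l//; exact: hD.
  by rewrite integral_cst ?mFA//; [rewrite -massE// -EFinM lee_fin mulrA|exact: mA].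
have : (c%:E * m B' <= m (a j `&` F @^-1` B'))%E.
  rewrite [leRHS](mFd _ (mA _ mB')); last exact: subIsetl.
  rewrite -(mFA _ mB') -integral_cst; last exact: mA.
  apply: ge0_le_integral.
  - exact: mA.
  - by move=> x _; rewrite lee_fin divr_ge0 ?mass_ge0// mulr_ge0 ?mass_ge0// ltW.
  - exact: measurable_cst.
  - exact: mz.
  - by move=> x hx; rewrite lee_fin; exact: cz.
rewrite -!massE//; last exact: mA.
rewrite -EFinM lee_fin /c mulrAC ler_pdivrMr ?mulr_gt0//.
by rewrite mulrCA.
Qed.

Fixpoint pullback (v : seq nat) (B : set X) : set X :=
  if v is j :: w then a j `&` F @^-1` (pullback w B) else B.

Definition cell_word (v : seq nat) : Prop := forall j, j \in v -> D j.

Lemma measurable_pullback v B : cell_word v -> measurable B ->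
  measurable (pullback v B).
Proof.
elim: v => //= j v IH Dv mB; apply: measurableI.
  by apply: (ue_measurable_cell ue); apply: Dv; rewrite inE eqxx.
by apply: measurable_preimage; apply: IH => // i iv; apply: Dv; rewrite inE iv orbT.
Qed.

(** Pulling back contracts distances by theta at each letter, so the distortions of the branches
    form a geometric series and the bound does not depend on the length of v. *)
Lemma pullback_distortion v B B' (D0 : R) : cell_word v ->
  measurable B -> measurable B' ->
  (forall x y, B x -> B' y -> dist x y <= D0) -> 0 <= D0 ->
  mass (pullback v B) * mass B'
    <= expR (K * D0 / (1 - theta)) * (mass (pullback v B') * mass B).
Proof.
move=> Dv mB mB' hD D00; case/andP: theta01 => t0 t1.
have t1' : 0 < 1 - theta by rewrite subr_gt0.
suff [hd hm] : (forall x y, pullback v B x -> pullback v B' y ->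
      dist x y <= theta ^+ size v * D0) /\
    mass (pullback v B) * mass B'
      <= expR (K * (D0 * (1 - theta ^+ size v) / (1 - theta)))
         * (mass (pullback v B') * mass B).
  apply: (le_trans hm); rewrite ler_wpM2r ?mulr_ge0 ?mass_ge0// ler_expR.
  rewrite -(mulrA K) ler_wpM2l// ler_wpM2r ?invr_ge0 ?(ltW t1')//.
  by rewrite ler_piMr// gerBl exprn_ge0// ltW.
elim: v Dv => [|j v IH] Dv.
  by rewrite /= expr0 mul1r subrr mulr0 mul0r mulr0 expR0 mul1r mulrC.
have [|hd hm] := IH; first by move=> i iv; apply: Dv; rewrite inE iv orbT.
have Dj : D j by apply: Dv; rewrite inE eqxx.
have Dv' : cell_word v by move=> i iv; apply: Dv; rewrite inE iv orbT.
split=> [x y [ax Fx] [ay Fy]|].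
  have := ue_expansion ue Dj ax ay; have := hd _ _ Fx Fy.
  rewrite ler_pdivrMl//= exprS => h /le_trans; apply.
  by rewrite -mulrA ler_wpM2l// ltW.
have mP C : measurable C -> measurable (pullback v C) by exact: measurable_pullback.
have := branch_distortion Dj (mP _ mB) (mP _ mB') hd.
rewrite -[pullback (j :: v) B]/(a j `&` F @^-1` pullback v B).
rewrite -[pullback (j :: v) B']/(a j `&` F @^-1` pullback v B').
have zero : mass (pullback v B) = 0 -> mass (a j `&` F @^-1` pullback v B) = 0.
  move=> h; have : m (F @^-1` pullback v B) = 0%E.
    by apply: (ue_nonsingular ue); [exact: mP|rewrite -massE ?h//; exact: mP].
  move=> h'; rewrite /mass (subset_measure0 _ _ (@subIsetr _ _ _) h')//.
    apply: measurableI; first exact: (ue_measurable_cell ue Dj).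
    by apply: measurable_preimage; exact: mP.
  by apply: measurable_preimage; exact: mP.
have eE : expR (K * (D0 * (1 - theta ^+ (size v).+1) / (1 - theta)))
    = expR (K * (D0 * (1 - theta ^+ size v) / (1 - theta))) * expR (K * (theta ^+ size v * D0)).
  rewrite -expRD; congr expR; rewrite exprS; move: (theta ^+ size v) => z; field.
  by rewrite gt_eqF.
rewrite [size (j :: v)]/= eE.
move: (mass_ge0 (a j `&` F @^-1` pullback v B')) (mass_ge0 (pullback v B')) (mass_ge0 B)
  (mass_ge0 B') (mass_ge0 (pullback v B)) hm zero.
move: (mass (a j `&` F @^-1` pullback v B)) (mass (a j `&` F @^-1` pullback v B')).
move: (mass (pullback v B)) (mass (pullback v B')) (mass B) (mass B').
move: (expR_ge0 (K * (D0 * (1 - theta ^+ size v) / (1 - theta)))).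
move: (expR_ge0 (K * (theta ^+ size v * D0))).
move: (expR _) (expR _) => x y y0 x0.
move=> b1 b1' b b' b2 b2' b2'0 b1'0 b0 b'0 b10 hm zero hs.
have [z|nz] := eqVneq b1' 0.
  move: hm; rewrite z mul0r mulr0 => hm.
  have : b1 * b' = 0 by apply/eqP; rewrite eq_le hm mulr_ge0.
  move/eqP; rewrite mulf_eq0 => /orP[/eqP/zero ->|/eqP ->].
    by rewrite mul0r !mulr_ge0.
  by rewrite mulr0 !mulr_ge0.
have b1p : 0 < b1' by rewrite lt0r nz.
rewrite -(ler_pM2r b1p); apply: (@le_trans _ _ (y * (b2' * b1) * b')).
  by rewrite mulrAC ler_wpM2r.
apply: (@le_trans _ _ (y * b2' * (x * (b1' * b)))).
  by rewrite -!mulrA ler_wpM2l// ler_wpM2l.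
by rewrite le_eqVlt; apply/orP; left; apply/eqP; ring.
Qed.

End expanding_distortion.

(** * Itineraries and unions of cylinders *)

Section itineraries.
Context {R : realType} {d : measure_display} {X : measurableType d}.
Variables (F : X -> X) (D : set nat) (a : nat -> set X) (m : probability X R).
Hypothesis mF : measurable_fun setT F.
Hypothesis part : partition D a setT.
Hypothesis mcell : forall j, D j -> measurable (a j).

Definition code (x : X) : nat := xget 0%N [set j | D j /\ a j x].

Lemma codeP x : D (code x) /\ a (code x) x.
Proof.
have [cov _ _] := part.
have [j Dj ajx] : cover D a x by rewrite cov.
exact: (@xgetPex _ 0%N [set j | D j /\ a j x] (ex_intro _ j (conj Dj ajx))).
Qed.

Lemma code_uniq j x : D j -> a j x -> code x = j.
Proof.
move=> Dj ajx; have [Dc acx] := codeP x; have [_ triv _] := part.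
by apply: triv => //; exists x.
Qed.

Fixpoint itinerary (n : nat) (x : X) : seq nat :=
  if n is n'.+1 then code x :: itinerary n' (F x) else [::].

Lemma size_itinerary n x : size (itinerary n x) = n.
Proof. by elim: n x => //= n IH x; rewrite IH. Qed.

Lemma cell_word_itinerary n x : cell_word D (itinerary n x).
Proof.
elim: n x => //= n IH x j; rewrite inE => /predU1P[->|/IH//].
by have [] := codeP x.
Qed.

Lemma pullbackP v B x : cell_word D v ->
  pullback F a v B x <-> itinerary (size v) x = v /\ B (iter (size v) F x).
Proof.
elim: v x => [|j v IH] x Dv; first by split=> // -[].
have Dj : D j by apply: Dv; rewrite inE eqxx.
have Dv' : cell_word D v by move=> i iv; apply: Dv; rewrite inE iv orbT.
rewrite [size _]/= iterSr; split.
  move=> [ajx /(IH _ Dv')[vE Bx]]; split=> //=.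
  by rewrite vE (code_uniq Dj ajx).
move=> [/= [cE vE] Bx]; split; first by rewrite -cE; have [] := codeP x.
by apply/(IH _ Dv').
Qed.

Definition saturated (n : nat) (A : set X) : Prop :=
  forall x y, itinerary n x = itinerary n y -> A x -> A y.

Lemma itinerary_take n k x : (n <= k)%N -> itinerary n x = take n (itinerary k x).
Proof. by elim: n k x => [|n IH] [|k] x //= nk; rewrite (IH k). Qed.

Lemma saturated_le n k A : (n <= k)%N -> saturated n A -> saturated k A.
Proof.
move=> nk An x y xy; apply: An.
by rewrite (itinerary_take x nk) (itinerary_take y nk) xy.
Qed.

Lemma saturatedC n A : saturated n A -> saturated n (~` A).
Proof. by move=> An x y xy Ax Ay; apply: Ax; exact: An _ _ (esym xy) Ay. Qed.

Lemma saturatedU n A B : saturated n A -> saturated n B -> saturated n (A `|` B).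
Proof.
by move=> An Bn x y xy [Ax|Bx]; [left; exact: An xy Ax|right; exact: Bn xy Bx].
Qed.

Lemma itinerary_add n k x : itinerary (n + k) x = itinerary n x ++ itinerary k (iter n F x).
Proof. by elim: n x => //= n IH x; rewrite IH -iterSr. Qed.

Lemma saturated_iter n k A : saturated k A -> saturated (n + k) (iter n F @^-1` A).
Proof.
move=> Ak x y; rewrite !itinerary_add => /eqP.
rewrite eqseq_cat ?size_itinerary// => /andP[_ /eqP xy]; exact: Ak.
Qed.

Lemma measurable_iter n B : measurable B -> measurable (iter n F @^-1` B).
Proof.
move=> mB; elim: n => // n IH.
rewrite (_ : _ @^-1` B = F @^-1` (iter n F @^-1` B)).
  by rewrite -[X in measurable X]setTI; exact: mF.
by apply/funext => x; rewrite /preimage/= -iterS iterSr.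
Qed.

Lemma measurable_pull v B : cell_word D v -> measurable B -> measurable (pullback F a v B).
Proof.
elim: v => //= j v IH Dv mB; apply: measurableI.
  by apply: mcell; apply: Dv; rewrite inE eqxx.
rewrite -[X in measurable X]setTI; apply: mF => //.
by apply: IH => // i iv; apply: Dv; rewrite inE iv orbT.
Qed.

(** The cylinders of length n are countably many; [pickle] numbers them so that countable additivity
    applies, and numbers that code no cylinder of A give the empty set. *)
Definition piece (n : nat) (A B : set X) (i : nat) : set X :=
  if (pickle_inv i : option (seq nat)) is Some v then
    if `[< exists2 x, A x & itinerary n x = v >] then pullback F a v B else set0
  else set0.

Lemma pieceP n A B i x : piece n A B i x -> exists v,
  [/\ pickle_inv i = Some v, itinerary n x = v, B (iter n F x) &
      exists2 y, A y & itinerary n y = v].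
Proof.
rewrite /piece; case: pickle_inv => // v; case: asboolP => // -[y Ay yv] h.
have Dv : cell_word D v by rewrite -yv; exact: cell_word_itinerary.
have vn : size v = n by rewrite -yv size_itinerary.
by have [] := (pullbackP B x Dv).1 h; rewrite vn => xv Bx; exists v; split=> //; exists y.
Qed.

Lemma saturated_pieces n A B : saturated n A ->
  A `&` iter n F @^-1` B = \bigcup_i piece n A B i.
Proof.
move=> An; apply/seteqP; split=> [x [Ax Bx]|x [i _ /pieceP[v [_ xv Bx [y Ay yv]]]]].
  exists (pickle (itinerary n x)) => //; rewrite /piece pickleK_inv.
  case: asboolP => [_|]; last by case; exists x.
  apply/(pullbackP B x (@cell_word_itinerary n x)).
  by rewrite size_itinerary.
by split=> //; apply: An Ay; rewrite yv.
Qed.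

Lemma measurable_piece n A B i : measurable B -> measurable (piece n A B i).
Proof.
move=> mB; rewrite /piece; case: pickle_inv => // v; case: asboolP => // -[y _ yv].
by apply: measurable_pull => //; rewrite -yv; exact: cell_word_itinerary.
Qed.

Lemma trivIset_piece n A B : trivIset setT (piece n A B).
Proof.
move=> i j _ _ [x [/pieceP[v [iv xv _ _]] /pieceP[w [jw xw _ _]]]].
have vw : v = w by rewrite -xv -xw.
have := @pickle_invK (seq nat) i; have := @pickle_invK (seq nat) j.
by rewrite iv jw /= vw => <- <-.
Qed.

Lemma saturated_compare n A B B' (c1 c2 : R) : measurable A -> saturated n A ->
  measurable B -> measurable B' -> 0 <= c1 -> 0 <= c2 ->
  (forall v, cell_word D v ->
    c1 * mass m (pullback F a v B) <= c2 * mass m (pullback F a v B')) ->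
  c1 * mass m (A `&` iter n F @^-1` B) <= c2 * mass m (A `&` iter n F @^-1` B').
Proof.
move=> mA An mB mB' c10 c20 h.
have mI C : measurable C -> measurable (A `&` iter n F @^-1` C).
  by move=> mC; apply: measurableI => //; exact: measurable_iter.
rewrite -lee_fin !EFinM !(massE m); [|exact: mI..].
rewrite !(saturated_pieces _ An) !measure_bigcup//.
- rewrite -!nneseriesZl//; try by move=> *; rewrite ?lee_fin.
  apply: lee_nneseries => [i _ _|i _].
    by rewrite mule_ge0.
  have mE C : measurable (piece n A C i) -> m (piece n A C i) = (mass m (piece n A C i))%:E.
    by move=> mC; rewrite massE.
  rewrite [X in (_ * X <= _)%E]mE; last exact: measurable_piece.
  rewrite [X in (_ <= _ * X)%E]mE; last exact: measurable_piece.
  rewrite -!EFinM lee_fin /piece; case: pickle_inv => [v|]; last first.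
    by rewrite /mass measure0 /= !mulr0.
  case: asboolP => [[y _ yv]|_]; last by rewrite /mass measure0 /= !mulr0.
  by apply: h; rewrite -yv; exact: cell_word_itinerary.
- by move=> i _; exact: measurable_piece.
- by apply: (sub_trivIset (@subsetT _ _)); exact: trivIset_piece.
- by move=> i _; exact: measurable_piece.
- by apply: (sub_trivIset (@subsetT _ _)); exact: trivIset_piece.
Qed.

End itineraries.

Section mass_facts.
Context {R : realType} {d : measure_display} {X : measurableType d}.
Variable m : probability X R.

Lemma mass_le A B : measurable A -> measurable B -> A `<=` B -> mass m A <= mass m B.
Proof. by move=> mA mB AB; rewrite -lee_fin !massE// le_measure// inE. Qed.

Lemma massU_le A B : measurable A -> measurable B ->
  mass m (A `|` B) <= mass m A + mass m B.
Proof.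
move=> mA mB; rewrite -lee_fin EFinD !massE//; last exact: measurableU.
exact: measureU2.
Qed.

Lemma mass_setD A B : measurable A -> measurable B ->
  mass m A = mass m (A `\` B) + mass m (A `&` B).
Proof.
move=> mA mB; apply: EFin_inj; rewrite EFinD !massE//; last 2 first.
- exact: measurableI.
- exact: measurableD.
exact: measureDI.
Qed.

Lemma mass_exhaust (U : nat -> set X) e : (forall i, measurable (U i)) ->
  nondecreasing_seq U -> 0 < e ->
  exists N, forall n, (N <= n)%N -> mass m ((\bigcup_i U i) `\` U n) <= e.
Proof.
move=> mU ndU e0; have mUU := bigcup_measurable (fun i (_ : setT i) => mU i).
have h := nondecreasing_cvg_mu mU mUU ndU (mu := m).
have hf : (fun n => mass m (U n)) @ \oo --> mass m (\bigcup_i U i).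
  by apply: fine_cvg; rewrite massE//; exact: h.
have /cvgrPdist_le/(_ _ e0)[N _ hN] := hf.
exists N => n Nn; have := hN n Nn; rewrite /=.
rewrite (mass_setD mUU (mU n)) setIidr; last by apply: bigcup_sup.
by rewrite addrK => /(le_trans (ler_norm _)).
Qed.

End mass_facts.

Section approximation.
Context {R : realType} {d : measure_display} {X : measurableType d}.
Variables (F : X -> X) (D : set nat) (a : nat -> set X) (m : probability X R).
Hypothesis mF : measurable_fun setT F.
Hypothesis part : partition D a setT.
Hypothesis mcell : forall j, D j -> measurable (a j).
Local Notation saturated := (saturated F D a).

(** The measurable sets of X need not be generated by itineraries, so the approximation is confined
    to the sigma-algebra that these sets generate. *)
Definition itinerary_sets : set (set X) :=
  [set A | measurable A /\ exists n, saturated n A].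

Definition approximable (A : set X) := measurable A /\
  forall e : R, 0 < e -> exists n A', [/\ measurable A', saturated n A' &
    mass m (A `\` A') + mass m (A' `\` A) <= e].

Lemma approximable_itinerary : itinerary_sets `<=` approximable.
Proof.
move=> A [mA [n An]]; split=> // e e0; exists n, A; split=> //.
by rewrite setDv /mass measure0/= addr0 ltW.
Qed.

Lemma approximableU A B : approximable A -> approximable B -> approximable (A `|` B).
Proof.
move=> [mA hA] [mB hB]; split=> [|e e0]; first exact: measurableU.
have e2 : 0 < e / 2 by rewrite divr_gt0.
have [n [A' [mA' An' Ae]]] := hA _ e2.
have [k [B' [mB' Bk' Be]]] := hB _ e2.
exists (maxn n k), (A' `|` B'); split.
- exact: measurableU.
- by apply: saturatedU; [exact: saturated_le (leq_maxl _ _) An'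
    |exact: saturated_le (leq_maxr _ _) Bk'].
- have h (C C' E E' : set X) : measurable C -> measurable C' -> measurable E ->
      measurable E' ->
      mass m ((C `|` E) `\` (C' `|` E')) <= mass m (C `\` C') + mass m (E `\` E').
    move=> mC mC' mE mE'; apply: (@le_trans _ _ (mass m ((C `\` C') `|` (E `\` E')))).
      apply: mass_le; [by apply: measurableD; exact: measurableU
        |by apply: measurableU; exact: measurableD|].
      by move=> x [[Cx|Ex] /not_orP[C'x E'x]]; [left|right].
    by apply: massU_le; exact: measurableD.
  have := h _ _ _ _ mA mA' mB mB'; have := h _ _ _ _ mA' mA mB' mB.
  move: Ae Be; move: (mass _ _) (mass _ _) (mass _ _) (mass _ _) (mass _ _) (mass _ _).
  by move=> *; lra.
Qed.

(** A countable union is close in mass to a finite one by continuity from below, and finite unions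
    of saturated sets are saturated at the largest level involved. *)
Lemma approximable_sigma : sigma_algebra setT approximable.
Proof.
split=> [|A [mA hA]|A hA].
- by apply: approximable_itinerary; split=> //; exists 0%N => x y.
- rewrite setTD; split=> [|e /hA[n [A' [mA' An' h]]]]; first exact: measurableC.
  exists n, (~` A'); split; [exact: measurableC|exact: saturatedC|].
  have hC C E : ~` C `\` ~` E = E `\` C :> set X by rewrite !setDE setCK setIC.
  by rewrite !hC addrC.
- have mA i : measurable (A i) by have [] := hA i.
  split=> [|e e0]; first exact: bigcupT_measurable.
  pose U n := \big[setU/set0]_(i < n) A i.
  have hU n : approximable (U n).
    rewrite /U; elim/big_rec: _ => [|i B _ hB]; last exact: approximableU.
    by apply: approximable_itinerary; split=> //; exists 0%N => x y.
  have mU n : measurable (U n) by have [] := hU n.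
  have e2 : 0 < e / 2 by rewrite divr_gt0.
  have ndU : nondecreasing_seq U.
    move=> i j ij; apply/subsetPset; exact: subset_bigsetU.
  have UE : \bigcup_i U i = \bigcup_i A i.
    apply/seteqP; split=> x [i _]; rewrite /U.
      rewrite -bigcup_mkord => -[k _ Akx]; by exists k.
    by move=> Aix; exists i.+1 => //; rewrite /U -bigcup_mkord; exists i => //=.
  have [N hN] := mass_exhaust m mU ndU e2.
  have [n [A' [mA' An' h]]] := (hU N).2 _ e2.
  exists n, A'; split=> //.
  have mUA : measurable (\bigcup_i A i) by exact: bigcupT_measurable.
  have := hN N (leqnn _); rewrite UE => hN'.
  have h1 : mass m (\bigcup_i A i `\` A') <=
      mass m (\bigcup_i A i `\` U N) + mass m (U N `\` A').
    apply: (@le_trans _ _ (mass m ((\bigcup_i A i `\` U N) `|` (U N `\` A')))).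
      apply: mass_le; [exact: measurableD|by apply: measurableU; exact: measurableD|].
      by move=> x [Ax A'x]; have [Ux|Ux] := pselect (U N x); [right|left].
    by apply: massU_le; exact: measurableD.
  have h2 : mass m (A' `\` \bigcup_i A i) <= mass m (A' `\` U N).
    apply: mass_le; [exact: measurableD..|].
    by move=> x [A'x Ax]; split=> // Ux; apply: Ax; rewrite -UE; exists N.
  move: h h1 h2 hN'; move: (mass _ _) (mass _ _) (mass _ _) (mass _ _) (mass _ _).
  by move=> *; lra.
Qed.

Lemma generated_approximable : <<s itinerary_sets >> `<=` approximable.
Proof. exact: (smallest_sub approximable_sigma approximable_itinerary). Qed.

Variables (B B' : set X) (c1 c2 : R).
Hypotheses (mB : measurable B) (mB' : measurable B') (c1_ge0 : 0 <= c1) (c2_ge0 : 0 <= c2).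
Hypothesis compare : forall v, cell_word D v ->
  c1 * mass m (pullback F a v B) <= c2 * mass m (pullback F a v B').

(** A is close in mass to a set saturated at some level N. That set is saturated at every n >= N,
    hence a union of n-cylinders, on each of which [compare] applies. *)
Lemma generated_compare A e : <<s itinerary_sets >> A -> 0 < e ->
  exists N, forall n, (N <= n)%N ->
    c1 * mass m (A `&` iter n F @^-1` B) <= c2 * mass m (A `&` iter n F @^-1` B') + e.
Proof.
move=> /generated_approximable[mA hA] e0.
have c0 : 0 < c1 + c2 + 1 by rewrite ltr_wpDl// addr_ge0.
have [N [A' [mA' AN' h]]] := hA _ (divr_gt0 e0 c0).
exists N => n Nn.
have := saturated_compare mF part mcell mA' (saturated_le Nn AN') mB mB' c1_ge0 c2_ge0 compare.
have le1 (A1 A2 C : set X) : measurable A1 -> measurable A2 -> measurable C ->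
    mass m (A1 `&` iter n F @^-1` C) <= mass m (A2 `&` iter n F @^-1` C) + mass m (A1 `\` A2).
  move=> mA1 mA2 mC; have mP := measurable_iter mF n mC.
  have mI1 : measurable (A1 `&` iter n F @^-1` C) by exact: measurableI.
  have mI2 : measurable (A2 `&` iter n F @^-1` C) by exact: measurableI.
  have mD : measurable (A1 `\` A2) by exact: measurableD.
  apply: le_trans (massU_le m mI2 mD); apply: mass_le => //; first exact: measurableU.
  by move=> x [Ax Cx]; have [A2x|A2x] := pselect (A2 x); [left|right].
have h1 := ler_wpM2l c1_ge0 (le1 _ _ _ mA mA' mB).
have h2 := ler_wpM2l c2_ge0 (le1 _ _ _ mA' mA mB').
move: h1 h2 h; rewrite !mulrDr ler_pdivlMr// => h1 h2 h h0.
have d1 := mass_ge0 m (A `\` A'); have d2 := mass_ge0 m (A' `\` A).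
have h3 := mulr_ge0 c1_ge0 d2; have h4 := mulr_ge0 c2_ge0 d1.
lra.
Qed.

End approximation.

(** The density is rounded down to a multiple of e on finitely many level sets. The rounding costs
    one e, and the part of the space where the density is at least N e costs the other. *)
Lemma density_levels (R : realType) d (X : measurableType d) (m nu : probability X R) (e : R) :
  nu `<< m -> 0 < e -> exists N (A : nat -> set X),
  [/\ forall k, measurable (A k),
      forall E, measurable E ->
        \sum_(k < N) k%:R * e * mass m (A k `&` E) <= mass nu E &
      forall E, measurable E ->
        mass nu E <= \sum_(k < N) k%:R * e * mass m (A k `&` E) + (e + e)].
Proof.
move=> /radon_nikodym_finite[f [f0 fi fE]] e0.
have mf : measurable_fun setT f by case/integrableP: fi.
pose A (k : nat) := [set x | ((k%:R * e)%:E <= f x < (k.+1%:R * e)%:E)%E].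
pose U (k : nat) := [set x | (f x < (k%:R * e)%:E)%E].
have mU k : measurable (U k).
  rewrite -[U k]setTI; apply: emeasurable_fun_infty_o => //.
have mA k : measurable (A k).
  rewrite (_ : A k = U k.+1 `\` U k); first exact: measurableD.
  apply/seteqP; split=> x; rewrite /A /U /=.
    by move=> /andP[h ->]; split=> //; apply/negP; rewrite -leNgt.
  by move=> [-> /negP]; rewrite -leNgt => ->.
have ndU : nondecreasing_seq U.
  move=> i j ij; apply/subsetPset => x; rewrite /U /= => /lt_le_trans; apply.
  by rewrite lee_fin ler_wpM2r ?(ltW e0)// ler_nat.
have UT : mass nu (~` (\bigcup_k U k)) = 0.
  have mUU : measurable (\bigcup_k U k) by exact: bigcupT_measurable.
  have h : m (~` (\bigcup_k U k)) = 0%E.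
    have [Z [mZ Z0 hZ]] := integrable_ae measurableT fi.
    apply: (subset_measure0 _ mZ _ Z0); first exact: measurableC.
    move=> x Ux; apply: hZ => /= /(_ Logic.I) /fineK fx; apply: Ux.
    exists (Num.trunc (fine (f x) / e)).+1 => //; rewrite /U /= -fx lte_fin.
    by rewrite -ltr_pdivrMr// truncnS_gt.
  rewrite /mass fE; last exact: measurableC.
  by rewrite null_set_integral//; [exact: measurableC|exact: measurable_funTS].
have [N hN] := mass_exhaust nu mU ndU e0.
have level k E : measurable E ->
    k%:R * e * mass m (A k `&` E) <= mass nu (A k `&` E)
      <= k.+1%:R * e * mass m (A k `&` E).
  move=> mE; have mAE : measurable (A k `&` E) by exact: measurableI.
  have mfE : measurable_fun (A k `&` E) f by exact: measurable_funTS.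
  rewrite -!lee_fin [(mass nu _)%:E]massE// !EFinM !(massE m)// fE// -!integral_cst//.
  apply/andP; split; apply: ge0_le_integral => //.
  - by move=> x _; rewrite lee_fin mulr_ge0// ltW.
  - by move=> x [/andP[]].
  - by move=> x [/andP[_ /ltW]].
have split_level k E : measurable E ->
    mass nu (U k.+1 `&` E) = mass nu (A k `&` E) + mass nu (U k `&` E).
  move=> mE; rewrite (@mass_setD _ _ _ nu (U k.+1 `&` E) (U k)) //; last exact: measurableI.
  congr (_ + _); congr (mass nu _); apply/seteqP; split=> x; rewrite /A /U /=.
  - by move=> [[-> Ex]] /negP; rewrite -leNgt => ->.
  - by move=> [/andP[h ->] Ex]; split=> //; apply/negP; rewrite -leNgt.
  - by move=> [[_ Ex] ?].
  - move=> [h Ex]; split=> //; split=> //; apply: lt_le_trans h _.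
    by rewrite lee_fin ler_wpM2r ?(ltW e0)// ler_nat.
have sums n E : measurable E ->
    \sum_(k < n) k%:R * e * mass m (A k `&` E) <= mass nu (U n `&` E)
      <= \sum_(k < n) k%:R * e * mass m (A k `&` E) + e * mass m (U n `&` E).
  move=> mE; elim: n => [|n IH].
    rewrite !big_ord0 (_ : U 0%N = set0) ?set0I /mass ?measure0 /= ?mulr0 ?addr0 ?lexx//.
    by apply/seteqP; split=> x //; rewrite /U /= mul0r ltNge f0.
  have mUE : measurable (U n.+1 `&` E) by exact: measurableI.
  have := level n E mE.
  have -> : mass m (U n.+1 `&` E) = mass m (A n `&` E) + mass m (U n `&` E).
    rewrite (mass_setD m mUE (mU n)); congr (_ + _); congr (mass m _).
      apply/seteqP; split=> x; rewrite /A /U /=.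
        by move=> [[-> Ex]] /negP; rewrite -leNgt => ->.
      by move=> [/andP[h ->] Ex]; split=> //; apply/negP; rewrite -leNgt.
    apply/seteqP; split=> x; rewrite /U /=; first by move=> [[_ Ex] ?].
    move=> [h Ex]; split=> //; split=> //; apply: lt_le_trans h _.
    by rewrite lee_fin ler_wpM2r ?(ltW e0)// ler_nat.
  rewrite split_level// !big_ord_recr/= -natr1.
  move: IH; move: (\sum_(i < n) _) (mass nu _) (mass nu _) (mass m _) (mass m _).
  move=> s x1 x2 y1 y2 /andP[a1 a2] /andP[b1 b2]; apply/andP; split.
    by rewrite addrC lerD.
  by move: b2; rewrite !mulrDl !mulrDr mul1r => b2; lra.
exists N, A; split=> // E mE; have /andP[h1 h2] := sums N E mE.
  by apply: (le_trans h1); apply: mass_le => //; exact: measurableI.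
have mUE : measurable (U N `&` E) by exact: measurableI.
have mUU : measurable (\bigcup_k U k) by exact: bigcupT_measurable.
rewrite (mass_setD nu mE (mU N)) addrC [E `&` _]setIC addrA; apply: lerD.
  apply: (le_trans h2); rewrite lerD2l ler_piMr ?(ltW e0)//.
  by rewrite -lee_fin massE//; exact: probability_le1.
apply: le_trans (hN N (leqnn _)); rewrite -[leRHS]addr0 -UT.
apply: (@le_trans _ _ (mass nu ((\bigcup_k U k `\` U N) `|` ~` (\bigcup_k U k)))).
  apply: mass_le; first exact: measurableD.
    by apply: measurableU; [exact: measurableD|exact: measurableC].
  by move=> x [Ex Ux]; have [h|h] := pselect ((\bigcup_k U k) x); [left|right].
by apply: massU_le; [exact: measurableD|exact: measurableC].
Qed.

Section invariant_compare.
Context {R : realType} {d : measure_display} {X : measurableType d}.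
Variables (F : X -> X) (D : set nat) (a : nat -> set X) (m mu : probability X R).
Hypothesis mF : measurable_fun setT F.
Hypothesis part : partition D a setT.
Hypothesis mcell : forall j, D j -> measurable (a j).
Hypothesis mu_ac : forall B, measurable B -> m B = 0%E -> mu B = 0%E.
Hypothesis mu_inv : forall B, measurable B -> mu (F @^-1` B) = mu B.

Lemma invariant_iter n B : measurable B -> mass mu (iter n F @^-1` B) = mass mu B.
Proof.
move=> mB; elim: n => // n IH.
rewrite (_ : iter n.+1 F @^-1` B = F @^-1` (iter n F @^-1` B)).
  by rewrite -IH /mass mu_inv//; exact: measurable_iter.
by apply/seteqP; split=> x; rewrite /preimage/= -iterS iterSr.
Qed.

(* mu has a density with respect to m on the sigma-algebra generated by the
   itineraries; its level sets are almost unions of cylinders, so that pulling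
   B back far enough makes the comparison on cylinders applicable. *)
Lemma invariant_compare B B' (c1 c2 : R) :
  itinerary_sets F D a B -> itinerary_sets F D a B' -> 0 <= c1 -> 0 <= c2 ->
  (forall v, cell_word D v ->
    c1 * mass m (pullback F a v B) <= c2 * mass m (pullback F a v B')) ->
  c1 * mass mu B <= c2 * mass mu B'.
Proof.
move=> [mB [b Bb]] [mB' [b' Bb']] c10 c20 h.
pose G := itinerary_sets F D a.
have GX A : <<s G >> A -> measurable A.
  by apply: smallest_sub => [|A' []//]; exact: sigma_algebra_measurable.
(* Radon-Nikodym is applied to the images of mu and m under the identity onto the smaller
   sigma-algebra, so that the level sets of the density belong to it. *)
have mid : measurable_fun setT (id : X -> g_sigma_algebraType G).
  by move=> _ A mA; rewrite setTI; exact: GX.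
pose i : {mfun X >-> g_sigma_algebraType G} := mfun_Sub (mem_set mid).
have ac : distribution mu i `<< distribution m i.
  apply/null_content_dominatesP => A mA; exact: mu_ac (GX _ mA).
have GI n C k : measurable C -> saturated F D a k C -> G (iter n F @^-1` C).
  move=> mC Ck; split; first exact: measurable_iter.
  by exists (n + k)%N; exact: saturated_iter.
apply/ler_addgt0Pr => eps eps0.
have c11 : 0 < c1 + 1 by rewrite ltr_wpDl.
pose e := eps / (4 * (c1 + 1)).
have e0 : 0 < e by rewrite divr_gt0 ?mulr_gt0.
have [N [A [mA lo up]]] := density_levels ac e0.
pose S := \sum_(k < N) k%:R * e.
have S0 : 0 <= S by apply: sumr_ge0 => k _; rewrite mulr_ge0// ltW.
have S1 : 0 < S + 1 by rewrite ltr_wpDl.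
pose e' := eps / (2 * (S + 1)).
have e'0 : 0 < e' by rewrite divr_gt0 ?mulr_gt0.
(* Each level set needs its own depth; the maximum over the finitely many levels serves them all. *)
have [g hg] := choice (fun k =>
  generated_compare mF part mcell mB mB' c10 c20 h (mA k) e'0).
pose n := \max_(k < N) g k.
have hn (k : 'I_N) : (g k <= n)%N by exact: leq_bigmax.
have gB : <<s G >> (iter n F @^-1` B) by apply: sub_gen_smallest; exact: GI Bb.
have gB' : <<s G >> (iter n F @^-1` B') by apply: sub_gen_smallest; exact: GI Bb'.
have lo' : \sum_(k < N) k%:R * e * mass m (A k `&` iter n F @^-1` B') <= mass mu B'.
  by rewrite -(invariant_iter n mB'); exact: lo.
have up' : mass mu B <= \sum_(k < N) k%:R * e * mass m (A k `&` iter n F @^-1` B) + (e + e).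
  by rewrite -(invariant_iter n mB); exact: up.
apply: (le_trans (ler_wpM2l c10 up')); rewrite mulrDr mulr_sumr.
apply: (@le_trans _ _ (\sum_(k < N) (c2 * (k%:R * e * mass m (A k `&` iter n F @^-1` B'))
    + k%:R * e * e') + eps / 2)).
  apply: lerD.
    apply: ler_sum => k _; rewrite mulrCA -[X in _ <= _ + X]mulr1 !mulr1 [c2 * _]mulrCA -mulrDr.
    by apply: ler_wpM2l; [rewrite mulr_ge0// ltW|exact: hg].
  rewrite (_ : c1 * (e + e) = eps / 2 * (c1 / (c1 + 1))).
    by rewrite ler_piMr ?divr_ge0 ?(ltW eps0)// ler_pdivrMr// mul1r lerDl.
  by rewrite /e; field; rewrite gt_eqF.
rewrite big_split/= -mulr_sumr -mulr_suml -/S -addrA; apply: lerD.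
  by apply: ler_wpM2l => //; exact: lo'.
have : S * e' <= eps / 2.
  rewrite (_ : S * e' = eps / 2 * (S / (S + 1))).
    by rewrite ler_piMr ?divr_ge0 ?(ltW eps0)// ler_pdivrMr// mul1r lerDl.
  by rewrite /e'; field; rewrite gt_eqF.
by move=> h1; lra.
Qed.

End invariant_compare.

(** * Cylinders *)

Section weakening.
Context {R : realType}.
Variables (J : nat) (m nu : seq nat -> R) (theta theta' L L' : R).
Hypothesis th : 0 <= theta <= theta'.
Hypothesis LL : 0 <= L <= L'.

Let le_rate (w : seq nat) : expR (L * theta ^+ size w) <= expR (L' * theta' ^+ size w).
Proof.
case/andP: th => t0 tt; case/andP: LL => l0 ll.
by rewrite ler_expR ler_pM ?exprn_ge0// lerXn2r// nnegrE// (le_trans t0).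
Qed.

(** Lets one pair (theta', L') serve all systems in a range of parameters. *)
Lemma cone_weaken : (forall w, 0 <= m w) -> cone J m theta L nu -> cone J m theta' L' nu.
Proof.
move=> m0 [n0 nA nD]; split=> // w u u' gw; apply: (le_trans (nD w u u' gw)).
by rewrite ler_wpM2r ?mulr_ge0.
Qed.

Lemma reference_weaken : reference J m theta L -> reference J m theta' L'.
Proof.
move=> [n0 nA n1 nD]; split=> // j w u u' gw; apply: (le_trans (nD j w u u' gw)).
by rewrite ler_wpM2r ?mulr_ge0.
Qed.

End weakening.

Lemma mass_sum_values {R : realType} {d} {X : measurableType d} (m : probability X R)
    (f : X -> nat) (B : set X) n : measurable B ->
  (forall j, measurable [set x | f x = j]) ->
  mass m (B `&` [set x | (f x < n)%N]) = \sum_(j < n) mass m (B `&` [set x | f x = j]).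
Proof.
move=> mB mf.
have mlt k : measurable [set x | (f x < k)%N].
  rewrite (_ : [set _ | _] = \bigcup_(j in [set j | (j < k)%N]) [set x | f x = j]).
    by apply: bigcup_measurable.
  by apply/seteqP; split=> [x /= h|x [j /= jk ->]] //; exists (f x).
elim: n => [|n IH].
  rewrite big_ord0 (_ : _ `&` _ = set0) ?/mass ?measure0//.
  by apply/seteqP; split=> x // -[].
rewrite big_ord_recr /= -IH (@mass_setD _ _ _ m _ [set x | f x = n]); last 2 first.
- exact: measurableI.
- exact: mf.
congr (_ + _); congr (mass m _); apply/seteqP; split=> x /=.
- by move=> [[Bx fx] /eqP fn]; split=> //; rewrite ltn_neqAle fn -ltnS.
- by move=> [Bx fx]; split; [split=> //; exact: ltnW|move=> fn; rewrite fn ltnn in fx].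
- by move=> [[Bx _] ?].
- by move=> [Bx fx]; rewrite fx.
Qed.

Section cylinders.
Context {R : realType} {d : measure_display} {X : measurableType d}.
Variables (F : X -> X) (D : set nat) (a : nat -> set X).
Hypothesis mF : measurable_fun setT F.
Hypothesis part : partition D a setT.
Hypothesis mcell : forall j, D j -> measurable (a j).
Variable J : nat.

Definition letter (x : X) : nat := minn (code D a x) J.

Fixpoint cyl (w : seq nat) : set X :=
  if w is j :: u then [set x | letter x = j] `&` F @^-1` cyl u else setT.

Lemma cylP w x : cyl w x <->
  [seq minn j J | j <- itinerary F D a (size w) x] = w.
Proof.
elim: w x => [|j w IH] x //=; split; first by move=> [<- /IH ->].
by move=> [jE wE]; split=> //; apply/IH.
Qed.

Lemma letter_le x : (letter x <= J)%N.
Proof. exact: geq_minr. Qed.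

Lemma measurable_letter j : measurable [set x | letter x = j].
Proof.
rewrite (_ : [set _ | _] = \bigcup_(i in [set i | D i /\ minn i J = j]) a i).
  by apply: bigcup_measurable => i [Di _]; exact: mcell.
apply/seteqP; split=> [x /= xj|x [i [Di ij] ax]].
  by have [Dc ac] := codeP part x; exists (code D a x).
by rewrite /= /letter (code_uniq part Di ax).
Qed.

Lemma measurable_cyl w : measurable (cyl w).
Proof.
elim: w => //= j w IH; apply: measurableI; first exact: measurable_letter.
by rewrite -[X in measurable X]setTI; exact: mF.
Qed.

Lemma saturated_cyl w : itinerary_sets F D a (cyl w).
Proof.
split; first exact: measurable_cyl.
by exists (size w) => x y xy /cylP; rewrite xy => yw; apply/cylP.
Qed.

Lemma cyl_cat w u x : cyl (w ++ u) x <-> cyl w x /\ cyl u (iter (size w) F x).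
Proof.
elim: w x => [|j w IH] x; first by split=> // -[].
rewrite [size _]/= iterSr /=; split; first by move=> [jx /IH[wx ux]].
by move=> [[jx wx] ux]; split=> //; apply/IH.
Qed.

Lemma cyl_good j u : (j < J)%N -> cyl (j :: u) = if `[< D j >] then a j `&` F @^-1` cyl u else set0.
Proof.
move=> jJ; case: asboolP => Dj; last first.
  apply/seteqP; split=> x // -[/= xj _]; apply: Dj.
  have -> : j = code D a x by rewrite -xj in jJ *; move: jJ; rewrite /letter; lia.
  by have [] := codeP part x.
apply/seteqP; split=> x [/= jx Fx]; split=> //.
  have -> : j = code D a x by rewrite -jx in jJ *; move: jJ; rewrite /letter; lia.
  by have [] := codeP part x.
by rewrite /= /letter (code_uniq part Dj jx); apply/minn_idPl; exact: ltnW.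
Qed.

Lemma additive_cyl (m : probability X R) : additive_words J (fun w => mass m (cyl w)).
Proof.
move=> w; have mw := measurable_cyl w.
have mf j : measurable [set x | letter (iter (size w) F x) = j].
  exact: (measurable_iter mF (size w) (measurable_letter j)).
have := mass_sum_values m J.+1 mw mf; rewrite (_ : _ `&` _ = cyl w).
  move=> ->; apply: eq_bigr => j _; congr (mass m _); apply/seteqP.
  by split=> x; rewrite -cats1; [move=> /cyl_cat[wx [? _]]|move=> [wx ux]; apply/cyl_cat].
by apply/seteqP; split=> [x []//|x wx]; split=> //=; rewrite ltnS letter_le.
Qed.

Lemma cyl_same_element w x y n : good J w -> cyl w x -> cyl w y -> (n < size w)%N ->
  same_element D a (iter n F x) (iter n F y).
Proof.
elim: w x y n => //= j w IH x y [|n] /andP[jJ gw] [xj wx] [yj wy] nw; last first.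
  by rewrite !iterSr; exact: IH.
have cE z : letter z = j -> code D a z = j by move: jJ; rewrite /letter; lia.
have := codeP part x; have := codeP part y; rewrite !cE// => -[Dj yj'] [_ xj'].
by exists j.
Qed.

Lemma cyl_d_theta (theta : R) w x y : 0 < theta < 1 -> good J w -> cyl w x -> cyl w y ->
  d_theta theta F D a x y <= theta ^+ size w.
Proof.
move=> /andP[t0 t1] gw wx wy; rewrite /d_theta /separation_time.
case: pselect => [h|h] /=; last by rewrite exprn_ge0// ltW.
case: ex_minnP => n /asboolP sn _; rewrite subr0 -exprnP.
rewrite ler_wiXn2l ?ltW// leqNgt; apply/negP => nw; apply: sn.
exact: cyl_same_element nw.
Qed.

Variables (m mu : probability X R) (zeta : X -> R) (theta K : R).
Hypothesis theta01 : 0 < theta < 1.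
Hypothesis K_ge0 : 0 <= K.
Hypothesis ue : uniformly_expanding F D a m zeta (d_theta theta F D a) theta^-1 K.
Hypothesis mu_ac : forall B, measurable B -> m B = 0%E -> mu B = 0%E.
Hypothesis mu_inv : forall B, measurable B -> mu (F @^-1` B) = mu B.

Lemma reference_cyl : reference J (fun w => mass m (cyl w)) theta K.
Proof.
split=> [w||/=|j w u u' /andP[jJ gw]]; first exact: mass_ge0.
- exact: additive_cyl.
- by rewrite /mass probability_setT.
have h v v' x y : cyl (w ++ v) x -> cyl (w ++ v') y ->
    d_theta theta F D a x y <= theta ^+ size w.
  by move=> /cyl_cat[wx _] /cyl_cat[wy _]; exact: cyl_d_theta.
rewrite !(cyl_good _ jJ); case: asboolP => Dj; last first.
  by rewrite /mass measure0 /= !mul0r mulr0.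
exact: (branch_distortion ue K_ge0 Dj (measurable_cyl _) (measurable_cyl _) (h u u')).
Qed.

(** [invariant_compare] is used with coefficients made of the m-masses of the two cylinders. Its
    hypothesis is [pullback_distortion]: both sets lie in [cyl w], where distances are at most
    [theta ^+ size w]. *)
Lemma cone_cyl : cone J (fun w => mass m (cyl w)) theta (K / (1 - theta))
  (fun w => mass mu (cyl w)).
Proof.
split=> [w||w u u' gw]; [exact: mass_ge0|exact: additive_cyl|].
rewrite mulrC [X in _ <= _ * X]mulrC mulrA.
have [_ t1] := andP theta01; have t0 : 0 <= theta by case/andP: theta01 => /ltW.
apply: (invariant_compare mF part mcell mu_ac mu_inv (saturated_cyl _) (saturated_cyl _)).
- exact: mass_ge0.
- by rewrite mulr_ge0 ?expR_ge0 ?mass_ge0.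
move=> v Dv; rewrite mulrC -[leRHS]mulrA [X in _ <= _ * X]mulrC.
rewrite [K / _ * _]mulrAC.
apply: (pullback_distortion ue theta01 K_ge0 Dv); [exact: measurable_cyl..| |].
  by move=> x y /cyl_cat[wx _] /cyl_cat[wy _]; exact: cyl_d_theta.
by rewrite exprn_ge0.
Qed.

End cylinders.

Section cone_comparison.
Context {R : realType}.
Variables (J : nat) (m p nu : seq nat -> R) (theta L : R).
Hypothesis m_mass : m [::] = 1.
Hypothesis p_mass : p [::] = 1.
Hypothesis pC : cone J m theta L p.
Hypothesis nuC : cone J m theta L nu.

(** Both p and nu are within exp L of their total mass times m. With p the invariant measure, this
    carries its known masses over to every state, at the price of exp (2 L). *)
Lemma cone_upper u : nu u <= expR (L + L) * (nu [::] * p u).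
Proof.
have := cone_distortion nuC u [::] (isT : good J [::]).
have := cone_distortion pC [::] u (isT : good J [::]).
rewrite /= expr0 !mulr1 m_mass p_mass !mulr1 mul1r expRD => h1 h2.
apply: (le_trans h2); rewrite -mulrA ler_wpM2l ?expR_ge0//.
by rewrite mulrCA ler_wpM2l// (cone_ge0 nuC).
Qed.

Lemma cone_lower u : nu [::] * p u <= expR (L + L) * nu u.
Proof.
have := cone_distortion pC u [::] (isT : good J [::]).
have := cone_distortion nuC [::] u (isT : good J [::]).
rewrite /= expr0 !mulr1 m_mass p_mass !mulr1 mul1r expRD => h1 h2.
apply: (@le_trans _ _ (expR L * (nu [::] * m u))).
  by rewrite mulrCA ler_wpM2l// (cone_ge0 nuC).
by rewrite -mulrA ler_wpM2l ?expR_ge0.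
Qed.

End cone_comparison.

(** * From the expanding map to a chain on words *)

Section expanding_chain.
Context {R : realType} {d : measure_display} {X : measurableType d}.
Variables (F : X -> X) (D : set nat) (a : nat -> set X).
Variables (m mu : probability X R) (zeta : X -> R) (theta K : R).
Hypothesis theta01 : 0 < theta < 1.
Hypothesis K_ge0 : 0 <= K.
Hypothesis ue : uniformly_expanding F D a m zeta (d_theta theta F D a) theta^-1 K.
Hypothesis mu_ac : forall B, measurable B -> m B = 0%E -> mu B = 0%E.
Hypothesis mu_inv : forall B, measurable B -> mu (F @^-1` B) = mu B.
Variables (tb : X -> nat) (tc : nat -> nat).
Hypothesis tbE : forall j x, D j -> a j x -> tb x = tc j.
Hypothesis tc_gt0 : forall j, D j -> (0 < tc j)%N.

(** The [maxn] guards numbers outside D, where [tc] is arbitrary; [H.+1] makes the letter J outlast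
    the horizon. *)
Definition cell_return (J H j : nat) : nat := if (j < J)%N then maxn (tc j) 1 else H.+1.

Let mF := ue_measurable ue.
Let part := ue_partition ue.
Let mcell := ue_measurable_cell ue.
Local Notation p J := (fun w => mass mu (cyl F D a J w)).

Lemma measurable_return (P : pred nat) : measurable [set x | P (tb x)].
Proof.
rewrite (_ : [set _ | _] = \bigcup_(i in [set i | D i /\ P (tc i)]) a i).
  by apply: bigcup_measurable => i [Di _]; exact: mcell.
apply/seteqP; split=> [x /= xj|x [i [Di ij] ax]]; last by rewrite /= (tbE Di ax).
have [Dc ac] := codeP part x; exists (code D a x) => //=.
by rewrite -(tbE Dc ac).
Qed.

Lemma return_letter J H x : (letter D a J x < J)%N ->
  cell_return J H (letter D a J x) = tb x.
Proof.
move=> h; rewrite /cell_return h; have [Dc ac] := codeP part x.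
have -> : letter D a J x = code D a x by move: h; rewrite /letter; lia.
by rewrite (tbE Dc ac); apply/maxn_idPl; exact: tc_gt0.
Qed.

(** The letter J mixes cells of different return times; it is left out of the lower bound and
    charged in full in the upper one. *)
Lemma return_mass (P : pred nat) J H :
  \sum_(j < J.+1) (P (cell_return J H j) && (j < J)%N)%:R * p J [:: val j]
    <= mass mu [set x | P (tb x)]
  <= \sum_(j < J.+1) (P (cell_return J H j) && (j < J)%N)%:R * p J [:: val j]
       + p J [:: J].
Proof.
have mP := measurable_return P.
have ml := @measurable_letter _ _ D a part mcell J.
have := mass_sum_values mu J.+1 mP ml.
rewrite (_ : _ `&` _ = [set x | P (tb x)]); last first.
  by apply/seteqP; split=> [x []//|x Px]; split=> //=; rewrite ltnS letter_le.
move=> ->; rewrite !big_ord_recr /= ltnn andbF mul0r addr0.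
have -> : \sum_(i < J) mass mu ([set x | P (tb x)] `&` [set x | letter D a J x = i])
    = \sum_(i < J) (P (cell_return J H i) && (i < J)%N)%:R * p J [:: val i].
  apply: eq_bigr => i _; rewrite ltn_ord andbT.
  case Pi: (P (cell_return J H i)); rewrite ?mul1r ?mul0r /=.
    congr (mass mu _); apply/seteqP; split=> x [].
      by move=> _ h; split.
    move=> /= h _; split=> //=; rewrite -(@return_letter J H) h ?ltn_ord//.
  rewrite (_ : _ `&` _ = set0) ?/mass ?measure0//.
  apply/seteqP; split=> x // -[/= Px h]; move: Px.
  by rewrite -(@return_letter J H) h ?ltn_ord// Pi.
rewrite lerDl mass_ge0 lerD2l; apply: mass_le; last 2 first.
- exact: (measurable_cyl mF part mcell J [:: J]).
- by move=> x [_ h].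
exact: measurableI.
Qed.

Variables (Y : Type) (A : Y -> nat -> nat -> R) (theta' K' L' delta : R) (c0 Nmax : nat).
Hypothesis theta_le : theta <= theta'.
Hypothesis K_le : K <= K'.
Hypothesis L_le : K / (1 - theta) <= L'.
Variables (y : Y) (J H : nat).
Hypothesis tail_head : forall i, (i <= H.+1)%N ->
  mass mu [set x | (i <= tb x)%N] + p J [:: J] <= expR (- (L' + L')) * A y c0 i.
Hypothesis tail_all : forall i,
  mass mu [set x | (i <= tb x)%N] <= expR (- (L' + L')) * A y c0 i.
Variable I : seq nat.
Hypothesis I_range : forall i, i \in I -> (0 < i <= Nmax)%N.
Hypothesis I_gcd : \big[gcdn/0%N]_(i <- I) i = 1%N.
Hypothesis I_mass : forall i, i \in I ->
  expR (L' + L') * delta + p J [:: J] <= mass mu [set x | tb x = i].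

Let mw := fun w => mass m (cyl F D a J w).

Lemma expanding_reference : reference J mw theta' K'.
Proof.
have := reference_cyl mF part mcell J theta01 K_ge0 ue.
apply: reference_weaken; first by rewrite theta_le ltW//; case/andP: theta01.
by rewrite K_ge0.
Qed.

Lemma expanding_cone : cone J mw theta' L' (p J).
Proof.
have := cone_cyl mF part mcell J theta01 K_ge0 ue mu_ac mu_inv.
case/andP: theta01 => t0 t1.
apply: cone_weaken => [||w]; first by rewrite theta_le ltW.
  by rewrite L_le divr_ge0// subr_ge0 ltW.
exact: mass_ge0.
Qed.

Let p1 : p J [::] = 1.
Proof. by rewrite /= /mass probability_setT. Qed.

Let m1 : mw [::] = 1.
Proof. by rewrite /mw /= /mass probability_setT. Qed.

Lemma expanding_last nu : cone J mw theta' L' nu ->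
  nu [:: J] <= expR (L' + L') * p J [:: J] * nu [::].
Proof.
by move=> nuC; rewrite -mulrA [X in _ * X]mulrC; exact: cone_upper m1 p1 expanding_cone nuC _.
Qed.

Lemma expanding_chain : chain A theta' K' L' c0 Nmax delta y J H (cell_return J H) mw.
Proof.
split.
- by move=> j; rewrite /cell_return; case: ifP => // _; rewrite leq_max orbT.
- by rewrite /cell_return ltnn.
- exact: expanding_reference.
- move=> nu i nuC; have n0 := cone_ge0 nuC [::].
  apply: (@le_trans _ _ (expR (L' + L') * nu [::] *
     (\sum_(j < J.+1) (i <= cell_return J H j)%:R * p J [:: val j]))).
    rewrite mulr_sumr; apply: ler_sum => j _; rewrite mulrCA ler_wpM2l// -mulrA.
    exact: cone_upper m1 p1 expanding_cone nuC _.
  rewrite mulrAC; apply: ler_wpM2r => //.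
  rewrite -ler_pdivlMl ?expR_gt0// -expRN.
  have -> : \sum_(j < J.+1) (i <= cell_return J H j)%:R * p J [:: val j] =
     \sum_(j < J.+1) ((i <= cell_return J H j)%N && (j < J)%N)%:R * p J [:: val j]
       + (i <= H.+1)%:R * p J [:: J].
    rewrite !big_ord_recr /= ltnn andbF mul0r addr0.
    rewrite (_ : cell_return J H J = H.+1); last by rewrite /cell_return ltnn.
    by congr (_ + _); apply: eq_bigr => j _; rewrite ltn_ord andbT.
  have /andP[h _] := return_mass (leq i) J H.
  (* The letter J has return time [H.+1] and enters the tail only up to that time. *)
  have [iH|iH] := leqP i H.+1.
    by rewrite mul1r; apply: le_trans (tail_head iH); rewrite lerD2r.
  by rewrite mul0r addr0; apply: le_trans (tail_all i).
- exists I; split=> // nu i nuC iI; have n0 := cone_ge0 nuC [::].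
  have /andP[_ h] := return_mass (pred1 i) J H.
  rewrite -(ler_pM2l (expR_gt0 (L' + L'))) mulr_sumr.
  apply: (@le_trans _ _ (nu [::] * (mass mu [set x | tb x = i] - p J [:: J]))).
    rewrite mulrA [leRHS]mulrC; apply: ler_wpM2r => //.
    by rewrite lerBrDr; exact: I_mass.
  apply: (@le_trans _ _ (\sum_(j < J.+1)
      nu [::] * (((cell_return J H j == i) && (j < J)%N)%:R * p J [:: val j]))).
    rewrite -mulr_sumr ler_wpM2l// lerBlDr; apply: le_trans h.
    apply: mass_le; [|exact: measurable_return|by move=> x /= ->; rewrite eqxx].
    rewrite (_ : [set _ | _] = [set x | pred1 i (tb x)]); first exact: measurable_return.
    by apply/seteqP; split=> x /= /eqP.
  apply: ler_sum => j _; rewrite mulrCA [leRHS]mulrCA ler_wpM2l//.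
  exact: cone_lower m1 p1 expanding_cone nuC _.
Qed.

End expanding_chain.

(** * Product structure and approximation by words *)

Section geometry.
Context {R : realType} (S : nuh_data R) (theta K K0 rho0 : R).
Hypothesis nuh : nonuniformly_hyperbolic S theta K K0 rho0.

Lemma disk_atE (W : set (set (M S))) V y : trivIset W id -> W V -> V y -> disk_at W y = V.
Proof.
move=> tW WV Vy; apply/seteqP; split=> [x [V' [WV' V'y] V'x]|x Vx]; last by exists V.
by rewrite -(tW _ _ WV' WV (ex_intro _ y (conj V'y Vy))).
Qed.

Lemma cell_sub j y : idx S j -> cell S j y -> Y S y.
Proof. by move=> Dj yj; have [<- _ _] := nuh_partition nuh; exists j. Qed.

Lemma exists_cell y : Y S y -> exists2 j, idx S j & cell S j y.
Proof. by have [<- _ _] := nuh_partition nuh => -[j Dj yj]; exists j. Qed.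

Lemma stable_pibar y z : Y S y -> disk_at (stable S) y z -> Y S z /\ pibar S z = pibar S y.
Proof.
move=> Yy yz; have [j Dj yj] := exists_cell Yy.
have Yz : Y S z by apply: (cell_sub Dj); exact: (nuh_cell_saturated nuh Dj yj).
by split=> //; apply/(nuh_quotient_eq nuh Yz Yy).
Qed.

Lemma product_point y z : Y S y -> Y S z ->
  exists x, [/\ Y S x, pibar S x = pibar S y, disk_at (stable S) y x &
                disk_at (unstable S) z x].
Proof.
move=> Yy Yz; have [V sV Vy] := nuh_stable_cover nuh Yy.
have [V' sV' V'z] := nuh_unstable_cover nuh Yz.
have [x Vx] := nuh_product nuh sV sV'.
have [xV xV'] : (V `&` V') x by rewrite Vx.
have yx : disk_at (stable S) y x by rewrite (disk_atE (nuh_stable_disjoint nuh) sV Vy).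
exists x; have [] := stable_pibar Yy yx; split=> //.
by rewrite (disk_atE (nuh_unstable_disjoint nuh) sV' V'z).
Qed.

Lemma cellbar_cell j y : idx S j -> Y S y -> @cellbar R S j (pibar S y) -> cell S j y.
Proof.
move=> Dj Yy [z zj zy]; apply: (nuh_cell_saturated nuh Dj zj).
by apply/(nuh_quotient_eq nuh Yy (cell_sub Dj zj)).
Qed.

Lemma induced_iter n y : Y S y -> Y S (iter n (Defs.induced S) y).
Proof. by move=> Yy; elim: n => //= n; exact: (nuh_induced nuh). Qed.

Lemma pibar_iter n y : Y S y -> pibar S (iter n (Defs.induced S) y) = iter n (Fbar S) (pibar S y).
Proof.
move=> Yy; elim: n => //= n <-; rewrite (nuh_Fbar nuh)//; exact: induced_iter.
Qed.

Variables J H : nat.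

Definition ycyl (w : seq nat) : set (M S) :=
  [set y | Y S y /\ cyl (Fbar S) (idx S) (@cellbar R S) J w (pibar S y)].

Let part := ue_partition (nuh_uniformly_expanding nuh).

Let ret := cell_return (tau_cell S) J H.

Lemma ycyl_cons j w y : (j < J)%N -> ycyl (j :: w) y ->
  [/\ idx S j, cell S j y, tau S y = ret j & ycyl w (Defs.induced S y)].
Proof.
move=> jJ [Yy]; rewrite (cyl_good _ part _ jJ); case: asboolP => // Dj [yj wy].
have cy := cellbar_cell Dj Yy yj; split=> //.
  rewrite (nuh_tau nuh Dj cy) /ret /cell_return jJ; apply/esym/maxn_idPl.
  exact: (nuh_tau_ge1 nuh Dj).
split; first exact: (nuh_induced nuh).
by rewrite -(nuh_Fbar nuh).
Qed.

Lemma ycyl_cat w u y : ycyl (w ++ u) y <-> ycyl w y /\ ycyl u (iter (size w) (Defs.induced S) y).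
Proof.
split=> [[Yy /cyl_cat[wy uy]]|[[Yy wy] [_ uy]]].
  by split=> //; split; [exact: induced_iter|rewrite pibar_iter].
by split=> //; apply/cyl_cat; rewrite -pibar_iter.
Qed.

Lemma ycyl_cell w y z n : good J w -> ycyl w y -> ycyl w z -> (n < size w)%N ->
  same_element (idx S) (cell S) (iter n (Defs.induced S) y) (iter n (Defs.induced S) z).
Proof.
elim: w y z n => // j w IH y z [|n] /andP[jJ gw] /(ycyl_cons jJ)[Dj yj _ yw]
  /(ycyl_cons jJ)[_ zj _ zw] nw; last by rewrite !iterSr; exact: IH.
by exists j.
Qed.

(** The point x on the stable disk of y and the unstable disk of z follows y, at distance of order
    rho0^n. It has the quotient itinerary of y, so it does not separate from z before [size w], and
    expansion read backwards bounds its distance to z. *)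
Lemma ycyl_close w y z n : good J w -> ycyl w y -> ycyl w z -> (n <= size w)%N ->
  mdist (iter n (Defs.induced S) y) (iter n (Defs.induced S) z) <= K0 * (rho0 ^+ n + rho0 ^+ (size w - n)).
Proof.
move=> gw yw zw nw; have [Yy wy] := yw; have [Yz wz] := zw.
have [x [Yx xy ys zu]] := product_point Yy Yz.
have xw : ycyl w x by split=> //; rewrite xy.
have := nuh_contraction nuh n Yy Yx ys; have := nuh_expansion nuh n Yz Yx zu.
have K00 : 0 <= K0 by apply: le_trans (nuh_K0 nuh).
have /andP[r0 r1] := nuh_rho0 nuh.
have h : pow_sub rho0 (sep_time S z x) n <= rho0 ^+ (size w - n).
  rewrite /sep_time /separation_time; case: pselect => [e|e] /=; last first.
    by rewrite exprn_ge0// ltW.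
  case: ex_minnP => s /asboolP ss _.
  have ws : (size w <= s)%N.
    by rewrite leqNgt; apply/negP => sw; apply: ss; exact: ycyl_cell zw xw sw.
  rewrite subzn ?(leq_trans nw)// -exprnP.
  by rewrite ler_wiXn2l ?(ltW r0) ?(ltW r1)// leq_sub2r.
move=> h1 h2; apply: (le_trans (metric_triangle _ (iter n (Defs.induced S) x) _)).
rewrite mulrDr; apply: lerD => //; rewrite metric_sym.
by apply: (le_trans h1); rewrite ler_wpM2l.
Qed.

End geometry.

Section laps.
Variable tau : nat -> nat.

Lemma returns_between_count t k u :
  returns_between tau t k u = (count_returns tau (t + k) u - count_returns tau t u)%N.
Proof.
elim: u t => //= j u IH t; have [jt|jt] := leqP (tau j) t.
  by rewrite (leq_trans jt (leq_addr k t)) IH subSS addnBAC.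
by case: ifP => _; rewrite subn0.
Qed.

Lemma count_returns_cut s h u : (s <= h)%N ->
  count_returns tau s (cut tau h u) = count_returns tau s u.
Proof.
elim: u s h => //= j u IH s h sh; have [jh|jh] := leqP (tau j) h => /=.
  by case: ifP => // js; rewrite IH ?leq_sub2r.
by rewrite leqNgt (leq_ltn_trans sh jh).
Qed.

Lemma size_cut h u : (h < duration tau u)%N ->
  size (cut tau h u) = (count_returns tau h u).+1.
Proof.
elim: u h => //= j u IH h; rewrite /duration /= => hu; case: ifP => //= jh.
by rewrite IH// /duration ltn_subLR.
Qed.

Lemma cut_prefix h u : exists r, u = cut tau h u ++ r.
Proof.
elim: u h => [|j u IH] h /=; first by exists [::].
by case: ifP => _; [have [r {1}->] := IH (h - tau j)%N; exists r|exists u].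
Qed.

Lemma duration_cut h u : (h < duration tau u)%N -> (h < duration tau (cut tau h u))%N.
Proof.
elim: u h => //= j u IH h; rewrite /duration /= => hu; have [jh|jh] := leqP (tau j) h => /=.
  have := IH (h - tau j)%N; rewrite /duration ltn_subLR// => /(_ hu).
  by rewrite ltn_subLR.
by rewrite addn0.
Qed.

End laps.

Section approximants.
Context {R : realType} (S : nuh_data R) (theta K K0 rho0 : R).
Hypothesis nuh : nonuniformly_hyperbolic S theta K K0 rho0.
Variables J H : nat.

Local Notation ind := (Defs.induced S).
Local Notation ret := (cell_return (tau_cell S) J H).
Local Notation ycyl := (@ycyl _ S J).

(** Points of one cylinder share their return times, hence the number of returns up to t and the
    time s since the last one. That s stays below the next return time is what [nuh_intermediate]
    asks. *)
Lemma tower_time t u : good J u -> (t < duration ret u)%N ->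
  exists s, forall y, ycyl u y -> iter t (T S) y = iter s (T S) (iter (count_returns ret t u) ind y)
     /\ (s < tau S (iter (count_returns ret t u) ind y))%N.
Proof.
elim: u t => // j u IH t /andP[jJ gu]; rewrite /duration /= => tu.
have [jt|jt] := leqP (ret j) t; last first.
  by exists t => y /(ycyl_cons nuh H jJ)[_ _ -> _].
have [|s hs] := IH (t - ret j)%N gu; first by rewrite /duration ltn_subLR.
rewrite ?jt.
exists s => y /(ycyl_cons nuh H jJ)[_ _ tj /hs[h hs']].
rewrite iterSr; split=> //; rewrite -h.
by rewrite /Defs.induced tj -iterD subnK.
Qed.

Lemma dist_time t u y z : good J u -> (t < duration ret u)%N -> ycyl u y -> ycyl u z ->
  mdist (iter t (T S) y) (iter t (T S) z)
    <= 2 * K0 ^+ 2 * (rho0 ^+ count_returns ret t u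
         + rho0 ^+ (size u - (count_returns ret t u).+1)).
Proof.
move=> gu tu yu zu; have [s hs] := tower_time gu tu.
have nu : (count_returns ret t u < size u)%N.
  by rewrite -size_cut//; have [r {2}->] := cut_prefix ret t u; rewrite size_cat leq_addr.
have [-> sy] := hs _ yu; have [-> sz] := hs _ zu.
move: nu sy sz; set n := count_returns ret t u => nu sy sz.
have /andP[r0 r1] := nuh_rho0 nuh; have K01 := nuh_K0 nuh.
apply: (le_trans (nuh_intermediate nuh _ _ _)).
- by apply: induced_iter nuh _ _ _; have [] := yu.
- by apply: induced_iter nuh _ _ _; have [] := zu.
- by rewrite leq_min sy sz.
have h1 := ycyl_close nuh H gu yu zu (ltnW nu); have h2 := ycyl_close nuh H gu yu zu nu.
have -> : 2 * K0 ^+ 2 * (rho0 ^+ n + rho0 ^+ (size u - n.+1)) =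
  K0 * (K0 * (rho0 ^+ n + rho0 ^+ (size u - n.+1))
        + K0 * (rho0 ^+ n + rho0 ^+ (size u - n.+1))) by ring.
have K00 : 0 <= K0 by apply: le_trans K01.
rewrite ler_wpM2l//; apply: lerD.
  apply: (le_trans h1); rewrite ler_wpM2l// lerD2l.
  by rewrite ler_wiXn2l ?(ltW r0) ?(ltW r1)// leq_sub2l.
apply: (le_trans h2); rewrite ler_wpM2l// lerD2r.
by rewrite ler_wiXn2l ?(ltW r0) ?(ltW r1).
Qed.

Definition representative (c : seq nat) : M S := xget point (ycyl c).

(** Letters completed by time t are dropped, which makes the value compatible with restarting at a
    return. Evaluating phi at t + k leaves the returns in ]t, t + k] as past and those in ]t + k, t
    + 2k] as future. *)
Fixpoint approximant (phi : M S -> R) (k t : nat) (u : seq nat) : R :=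
  if u is j :: v then
    if (ret j <= t)%N then approximant phi k (t - ret j) v
    else phi (iter (t + k) (T S) (representative (cut ret (t + (k + k)) u)))
  else 0.

Lemma approximant_le phi k t u : (forall x, `|phi x| <= 1) -> `|approximant phi k t u| <= 1.
Proof. by move=> h; elim: u t => /= [|j u IH] t; [rewrite normr0|case: ifP]. Qed.

Lemma approximant_prefix phi k t u v : (t + (k + k) < duration ret u)%N ->
  approximant phi k t (u ++ v) = approximant phi k t u.
Proof.
elim: u t => // j u IH t hu; rewrite [_ ++ _]/=.
rewrite [approximant _ _ _ (j :: u)]/= [LHS]/=; have [jt|jt] := leqP (ret j) t.
  by apply: IH; move: hu; rewrite /duration /=; clear -jt; move: (ret j) jt => r; lia.
congr (phi (iter _ _ (representative _))).
exact: (cut_cat v hu).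
Qed.

Variables (eta rho : R) (phi : M S -> R).
Hypothesis eta01 : 0 < eta <= 1.
Hypothesis rho_ge : rho0 `^ eta <= rho.
Hypothesis phi_holder : forall x y, `|phi x - phi y| <= mdist x y `^ eta.

(** Replace x + y by twice the larger one; then (4 K0^2)^eta <= 4 K0^2, because the base is at least
    1 and eta <= 1. *)
Lemma powR_le_max (x y : R) : 0 <= x -> 0 <= y -> 1 <= K0 ->
  (2 * K0 ^+ 2 * (x + y)) `^ eta <= 4 * K0 ^+ 2 * (x `^ eta + y `^ eta).
Proof.
move=> x0 y0 K01; case/andP: eta01 => e0 e1.
wlog xy : x y x0 y0 / x <= y.
  move=> h; have [|/ltW] := leP x y; first exact: h.
  by move/h => /(_ y0 x0); rewrite (addrC y) (addrC (y `^ _)).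
have K1 : 1 <= 4 * K0 ^+ 2.
  by apply: (@le_trans _ _ 4); [rewrite (ler_nat _ 1 4)|rewrite ler_peMr// exprn_ege1].
have h2 : 0 <= 2 * K0 ^+ 2 by apply: mulr_ge0 => //; exact: sqr_ge0.
apply: (@le_trans _ _ ((4 * K0 ^+ 2 * y) `^ eta)).
  apply: ge0_ler_powR; rewrite ?nnegrE ?(ltW e0)//.
  - by apply: mulr_ge0 h2 _; exact: addr_ge0.
  - exact: mulr_ge0 (le_trans ler01 K1) _.
  - rewrite (_ : 4 * K0 ^+ 2 * y = 2 * K0 ^+ 2 * (y + y)); last by ring.
    by rewrite ler_wpM2l ?lerD2r.
rewrite powRM//; last by apply: le_trans K1.
apply: ler_pM; rewrite ?powR_ge0//; last by rewrite lerDr powR_ge0.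
by rewrite -[leRHS]powRr1 ?(le_trans ler01)// ler_powR.
Qed.

Lemma approximant_error k t u y : good J u -> (t + (k + k) < duration ret u)%N -> ycyl u y ->
  `|phi (iter (t + k) (T S) y) - approximant phi k t u|
    <= 4 * K0 ^+ 2 * (rho ^+ returns_between ret t k u + rho ^+ returns_between ret (t + k) k u).
Proof.
elim: u t y => // j u IH t y /andP[jJ gu] hu yu; rewrite [approximant _ _ _ _]/=.
have [Dj yj tj yu'] := ycyl_cons nuh H jJ yu.
have [jt|jt] := leqP (ret j) t.
  have hu' : (t - ret j + (k + k) < duration ret u)%N.
    by move: hu; rewrite /duration /=; clear -jt; move: (ret j) jt => r; lia.
  have := IH _ _ gu hu' yu'.
  rewrite /Defs.induced tj -iterD.
  rewrite (_ : (t - ret j + k + ret j = t + k)%N); last by rewrite addnAC subnK.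
  rewrite [returns_between _ t _ _]/= jt [returns_between _ (t + k) _ _]/= (leq_trans jt) ?leq_addr//.
  by rewrite (addnBAC _ jt).
rewrite -/(cut ret (t + (k + k)) (j :: u)).
have [r er] := cut_prefix ret (t + (k + k)) (j :: u).
set c := cut ret (t + (k + k)) (j :: u) in er *.
have gc : good J c.
  have : good J (j :: u) by rewrite /good /= jJ.
  by rewrite er /good all_cat => /andP[].
have yc : ycyl c y by move: yu; rewrite er => /(ycyl_cat nuh)[].
have zc : ycyl c (representative c) by exact: (@xgetPex _ point _ (ex_intro _ y yc)).
have dc := duration_cut hu; rewrite -/c in dc.
have tc : (t + k < duration ret c)%N.
  by apply: leq_ltn_trans dc; rewrite leq_add2l leq_addr.
apply: (le_trans (phi_holder _ _)).
have /andP[r0 r1] := nuh_rho0 nuh; have /andP[e0 e1] := eta01.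
have hX n : (rho0 ^+ n) `^ eta <= rho ^+ n.
  rewrite -powR_mulrn ?(ltW r0)// -powRrM mulrC powRrM powR_mulrn ?powR_ge0//.
  by rewrite lerXn2r ?nnegrE ?powR_ge0// (le_trans _ rho_ge) ?powR_ge0.
apply: (@le_trans _ _ ((2 * K0 ^+ 2 * (rho0 ^+ count_returns ret (t + k) c
         + rho0 ^+ (size c - (count_returns ret (t + k) c).+1))) `^ eta)).
  apply: ge0_ler_powR; rewrite ?nnegrE ?(ltW e0) ?mdist_ge0//.
    apply: mulr_ge0; first by apply: mulr_ge0 => //; exact: sqr_ge0.
    by rewrite addr_ge0 ?exprn_ge0// ltW.
  exact: dist_time.
apply: (le_trans (powR_le_max _ _ (nuh_K0 nuh))); rewrite ?exprn_ge0 ?(ltW r0)//.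
have sc : size c = (count_returns ret (t + (k + k)) (j :: u)).+1 by rewrite size_cut.
have cc : count_returns ret (t + k) c = count_returns ret (t + k) (j :: u).
  by rewrite count_returns_cut// leq_add2l leq_addr.
apply: ler_wpM2l; first by apply: mulr_ge0 => //; exact: sqr_ge0.
have -> : returns_between ret t k (j :: u) = count_returns ret (t + k) c.
  by rewrite returns_between_count cc /= [in X in (_ - X)%N]leqNgt jt subn0.
have -> : returns_between ret (t + k) k (j :: u)
    = (size c - (count_returns ret (t + k) c).+1)%N.
  by rewrite returns_between_count sc subSS cc addnA.
by apply: lerD; exact: hX.
Qed.

End approximants.

(** * The tower and its measure *)

Section tower_measure.
Context {R : realType} (S : nuh_data R) (theta K K0 rho0 : R).
Hypothesis nuh : nonuniformly_hyperbolic S theta K K0 rho0.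

Local Notation ind := (Defs.induced S).
Local Notation BM := (Borel (M S)).

Let ue := nuh_uniformly_expanding nuh.
Let mF := ue_measurable ue.
Let part := ue_partition ue.
Let mcell := ue_measurable_cell ue.

Lemma measurable_pibar B : measurable B -> measurable (Y S `&` pibar S @^-1` B : set BM).
Proof. exact: (nuh_quotient_measurable nuh (nuh_measurable_Y nuh)). Qed.

Lemma taubar_cell j x : idx S j -> @cellbar _ S j x -> taubar S x = tau_cell S j.
Proof.
move=> Dj [y yj <-]; rewrite (nuh_taubar nuh); last exact: (cell_sub nuh Dj).
exact: (nuh_tau nuh Dj).
Qed.

Lemma measurable_ycyl J u : measurable (ycyl J u : set BM).
Proof. by apply: measurable_pibar; exact: (measurable_cyl mF part mcell). Qed.

Lemma mass_ycyl J u :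
  mass (muY S) (ycyl J u : set BM) = mass (mubar S) (cyl (Fbar S) (idx S) (@cellbar _ S) J u).
Proof.
by rewrite /mass (nuh_muY_proj nuh)//; exact: (measurable_cyl mF part mcell).
Qed.

Lemma measurable_above l : measurable ([set y | Y S y /\ (l < tau S y)%N] : set BM).
Proof.
rewrite (_ : [set _ | _] = Y S `&` pibar S @^-1` [set x | (l < taubar S x)%N]).
  by apply: measurable_pibar; exact: (measurable_return ue taubar_cell (leq l.+1)).
by apply/seteqP; split=> y [Yy]; rewrite /= (nuh_taubar nuh).
Qed.

Lemma measurable_slice (A : set BM) (l : nat) : measurable A ->
  measurable (A `*` [set l] : set (BM * nat)).
Proof. by move=> mA; apply: measurableX. Qed.

Lemma measurable_tower : measurable (tower (S := S) : set (BM * nat)).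
Proof.
rewrite (_ : tower (S := S) = \bigcup_l ([set y | Y S y /\ (l < tau S y)%N] `*` [set l])).
  by apply: bigcupT_measurable => l; apply: measurable_slice; exact: measurable_above.
apply/seteqP; split=> [[y l] [/= Yy ly]|[y l] [l' _ [/= [Yy ly] ->]]]; last by split.
by exists l.
Qed.

Lemma tau_gt0 y : Y S y -> (0 < tau S y)%N.
Proof.
move=> Yy; have [j Dj yj] := exists_cell nuh Yy; rewrite (nuh_tau nuh Dj yj).
exact: (nuh_tau_ge1 nuh Dj).
Qed.

Lemma mass_slice (A : set BM) (l : nat) : measurable A ->
  (forall y, A y -> Y S y /\ (l < tau S y)%N) ->
  mass (muDelta S) (A `*` [set l] : set (BM * nat))
    = (mean_return_time S)^-1 * mass (muY S) A.
Proof.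
move=> mA hA; apply: EFin_inj; rewrite EFinM !massE//; last exact: measurable_slice.
exact: (nuh_muDelta nuh).
Qed.

Lemma mean_return_time_inv : 0 <= (mean_return_time S)^-1 <= 1.
Proof.
have := @mass_slice (Y S) 0%N (nuh_measurable_Y nuh) (fun y Yy => conj Yy (tau_gt0 Yy)).
rewrite {2}/mass (nuh_muY_full nuh) /= mulr1 => <-; rewrite mass_ge0 /=.
have mY0 := measurable_slice 0%N (nuh_measurable_Y nuh).
by rewrite -lee_fin massE//; exact: probability_le1.
Qed.

Lemma tower_null (B : set (BM * nat)) : measurable B ->
  mass (muDelta S) (B `\` tower (S := S)) = 0.
Proof.
move=> mB; have mt := measurable_tower.
apply/eqP; rewrite eq_le mass_ge0 andbT.
have : mass (muDelta S) (~` tower (S := S)) = 0.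
  apply: EFin_inj; rewrite massE; last exact: measurableC.
  rewrite probability_setC//; first by rewrite (nuh_muDelta_full nuh) subee.
move=> <-; apply: mass_le; [exact: measurableD|exact: measurableC|by move=> x []].
Qed.

Lemma tower_proj_map p : tower (S := S) p -> tower_proj (tower_map p) = T S (tower_proj p).
Proof.
case: p => y l [/= Yy ly]; rewrite /tower_map /tower_proj /=.
case: ifP => //= lt; rewrite /Defs.induced -iterS.
by congr iter; apply/eqP; rewrite eqn_leq ly leqNgt lt.
Qed.

(** The projection intertwines [tower_map] and T on the tower, whose complement is null. *)
Lemma mu_invariant (B : set BM) : measurable B -> mu S (T S @^-1` B) = mu S B.
Proof.
move=> mB; have mT : measurable (T S @^-1` B : set BM).
  by rewrite -[X in measurable X]setTI; exact: measurable_funP.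
have mP C : measurable C -> measurable (tower_proj (S := S) @^-1` C).
  by move=> mC; rewrite -[X in measurable X]setTI; exact: measurable_tower_proj.
have mt := measurable_tower.
rewrite -[LHS]/(muDelta S (tower_proj (S := S) @^-1` (T S @^-1` B))).
rewrite -[RHS]/(muDelta S (tower_proj (S := S) @^-1` B)).
rewrite -[RHS](nuh_muDelta_invariant nuh (mP _ mB)).
rewrite -[LHS]massE ?(mass_setD _ (mP _ mT) mt) ?tower_null ?add0r; [|exact: mP..].
rewrite massE; last by apply: measurableI => //; exact: mP.
congr (muDelta S _); apply/seteqP; split=> p; rewrite /preimage /=.
  by move=> [h tp]; split=> //; rewrite tower_proj_map.
by move=> [tp]; rewrite tower_proj_map.
Qed.

End tower_measure.

Lemma bounded_integrable {R : realType} {d} {X : measurableType d} (P : probability X R)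
    (f : X -> R) (c : R) A : measurable_fun setT f -> (forall x, `|f x| <= c) ->
  measurable A -> P.-integrable A (EFin \o f).
Proof.
move=> mf f_le mA; apply: measurable_bounded_integrable => //.
- by apply: le_lt_trans (probability_le1 P mA) _; rewrite ltry.
- exact: measurable_funTS.
- exists c; split=> [|M cM x _ /=]; first exact: num_real.
  exact: le_trans (f_le x) (ltW cM).
Qed.

Section bounded_integrals.
Context {R : realType} {d : measure_display} {X : measurableType d}.
Variables (P : probability X R) (f : X -> R) (c : R).
Hypothesis mf : measurable_fun setT f.
Hypothesis f_le : forall x, `|f x| <= c.

Lemma Rintegral_bounded A : measurable A -> `|\int[P]_(x in A) f x| <= c * mass P A.
Proof.
move=> mA; apply: (le_trans (le_normr_Rintegral mA (bounded_integrable P mf f_le mA))).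
rewrite -Rintegral_cst//; apply: le_Rintegral => //.
- apply: (@bounded_integrable _ _ _ _ _ c) => //; first exact: measurableT_comp.
  by move=> x; rewrite normr_id.
- apply: (@bounded_integrable _ _ _ _ (cst c) `|c|) => //.
Qed.

Lemma Rintegral_values (v : X -> nat) n A : measurable A ->
  (forall j, measurable (A `&` [set x | v x = j])) -> (forall x, A x -> (v x < n)%N) ->
  \int[P]_(x in A) f x = \sum_(j < n) \int[P]_(x in A `&` [set x | v x = j]) f x.
Proof.
elim: n A => [|n IH] A mA mv vn.
  rewrite big_ord0 (_ : A = set0) ?Rintegral_set0//.
  by apply/seteqP; split=> x // /vn.
have mn := mv n; rewrite big_ord_recr/=.
have mD : measurable (A `\` [set x | v x = n]).
  rewrite (_ : _ `\` _ = A `\` (A `&` [set x | v x = n])); first exact: measurableD.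
  by apply/seteqP; split=> x [Ax h]; split=> // h'; apply: h; [case: h'|split].
have {1}-> : A = (A `\` [set x | v x = n]) `|` (A `&` [set x | v x = n]).
  by apply/seteqP; split=> x; [have [] := pselect (v x = n); [right|left]|move=> [[]|[]]].
rewrite Rintegral_setU//; last 2 first.
- by apply: bounded_integrable f_le _ => //; exact: measurableU.
- by apply/disj_setPS => x [[Ax vx] [_ ?]].
have setI_ne j : (j < n)%N ->
    (A `\` [set x | v x = n]) `&` [set x | v x = j] = A `&` [set x | v x = j].
  move=> jn; apply/seteqP; split=> x; first by move=> [[Ax _] ?].
  by move=> [Ax vx]; split=> //; split=> //= e; move: jn; rewrite -vx e ltnn.
congr (_ + _); rewrite IH//.
- by apply: eq_bigr => j _; rewrite setI_ne.
- move=> j; have [jn|jn|->] := ltngtP j n; first by rewrite setI_ne.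
    rewrite (_ : _ `&` _ = set0)//; apply/seteqP; split=> x // [[/vn vx _] /= e].
    by move: vx; rewrite e ltnS leqNgt jn.
  by rewrite (_ : _ `&` _ = set0)//; apply/seteqP; split=> x // [[_ ?] ?].
- by move=> x [/vn + /eqP h]; rewrite ltnS leq_eqVlt (negbTE h).
Qed.

End bounded_integrals.

Lemma Rintegral_near {R : realType} {d} {X : measurableType d} (P : probability X R)
    (f : X -> R) (c g e : R) A : measurable_fun setT f -> (forall x, `|f x| <= c) ->
  measurable A -> (forall x, A x -> `|f x - g| <= e) -> 0 <= e ->
  `|\int[P]_(x in A) f x - g * mass P A| <= e * mass P A.
Proof.
move=> mf fc mA fg e0.
(* [Rintegral_bounded] asks for a bound everywhere, while f is close to g on A only; off A it is
   replaced by g. *)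
pose F x := f x * \1_A x + g * (1 - \1_A x).
have mi : measurable_fun setT (\1_A : X -> R) by exact: measurable_indic.
have mF : measurable_fun setT (fun x => F x - g).
  apply: measurable_funB => //; apply: measurable_funD; apply: measurable_funM => //.
  exact: measurable_funB.
have Fe x : `|F x - g| <= e.
  rewrite /F indicE; have [xA|xA] := boolP (x \in A).
    by rewrite subrr mulr0 addr0 mulr1; apply: fg; rewrite -in_setE.
  by rewrite subr0 mulr0 mulr1 add0r subrr normr0.
have := Rintegral_bounded P mF Fe mA.
have -> : \int[P]_(x in A) (F x - g) = \int[P]_(x in A) (f x - g).
  by apply: eq_Rintegral => x xA; rewrite /F indicE xA subrr mulr0 addr0 mulr1.
rewrite RintegralB ?Rintegral_cst//; first exact: bounded_integrable fc mA.
by apply: (@bounded_integrable _ _ _ _ (cst g) `|g|).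
Qed.

Section tower_integral.
Context {R : realType} (S : nuh_data R) (theta K K0 rho0 : R).
Hypothesis nuh : nonuniformly_hyperbolic S theta K K0 rho0.
Variables J H : nat.

Local Notation ind := (Defs.induced S).
Local Notation BM := (Borel (M S)).
Local Notation ret := (cell_return (tau_cell S) J H).
Local Notation head := (letter (idx S) (@cellbar _ S) J).

Definition word_mass (u : seq nat) : R :=
  mass (mubar S) (cyl (Fbar S) (idx S) (@cellbar _ S) J u).

Definition floor_mass : R := (mean_return_time S)^-1.

Definition floor_base (l : nat) : set BM :=
  [set y | (Y S y /\ (l < tau S y)%N) /\ (head (pibar S y) < J)%N].

Definition low_floors (N : nat) : set (BM * nat) :=
  [set p | (p.2 < N)%N /\ floor_base p.2 p.1].

Let ue := nuh_uniformly_expanding nuh.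
Let mF := ue_measurable ue.
Let part := ue_partition ue.
Let mcell := ue_measurable_cell ue.

Lemma measurable_floor_base l : measurable (floor_base l).
Proof.
rewrite (_ : floor_base l = [set y | Y S y /\ (l < tau S y)%N] `&`
   (Y S `&` pibar S @^-1` [set x | (head x < J)%N])); last first.
  by apply/seteqP; split=> y; [move=> [[Yy ly] h]|move=> [[Yy ly] [_ h]]].
apply: measurableI; first exact: (measurable_above nuh).
apply: (measurable_pibar nuh).
rewrite (_ : [set _ | _] = \bigcup_(j in [set j | (j < J)%N]) [set x | head x = j]).
  by apply: bigcup_measurable => j _; exact: measurable_letter.
by apply/seteqP; split=> [x /= h|x [j /= jk ->]] //; exists (head x).
Qed.

Lemma measurable_low_floors N : measurable (low_floors N).
Proof.
rewrite (_ : low_floors N = \bigcup_(l in [set l | (l < N)%N]) (floor_base l `*` [set l])).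
  apply: bigcup_measurable => l _.
  by apply: measurable_slice; exact: measurable_floor_base.
apply/seteqP; split=> [[y l] [/= lN h]|[y l] [l' /= l'N [/= h ->]]]; last by split.
by exists l.
Qed.

Lemma floor_base_ycyl l u : u != [::] ->
  floor_base l `&` ycyl J u = if starts_above J ret l u then ycyl J u else set0.
Proof.
case: u => // j u _; rewrite /starts_above.
have [jJ|jJ] := ltnP j J; last first.
  rewrite andbF; apply/seteqP; split=> y // -[[_ hy] [Yy [/= hj _]]].
  by rewrite hj ltnNge jJ in hy.
rewrite andbT; case: ifP => lj; apply/seteqP; split=> y //.
- by move=> [].
- move=> yu; split=> //; have [Dj yj tj _] := ycyl_cons nuh H jJ yu.
  have [Yy [/= hj _]] := yu; split; last by rewrite hj.
  by split=> //; rewrite tj.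
- move=> [[[_ ly] _] yu]; have [Dj yj tj _] := ycyl_cons nuh H jJ yu.
  by rewrite tj lj in ly.
Qed.

Hypothesis tauJ : forall j, (0 < ret j)%N.
Variables (f : BM * nat -> R) (c : R).
Hypothesis mf : measurable_fun setT f.
Hypothesis f_le : forall p, `|f p| <= c.

Let piece l u : set (BM * nat) := (floor_base l `&` ycyl J u) `*` [set l].

Let measurable_piece l u : measurable (piece l u).
Proof.
apply: measurable_slice; apply: measurableI; first exact: measurable_floor_base.
exact: (measurable_ycyl nuh).
Qed.

(** The integrals over cylinders are an additive function of the word, so the identity for masses
    over stopped words applies to them as well. *)
Lemma floor_integral l h : \int[muDelta S]_(p in floor_base l `*` [set l]) f p
  = \sum_(u <- stop J ret h) \int[muDelta S]_(p in piece l u) f p.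
Proof.
have addp : additive_words J (fun u => \int[muDelta S]_(p in piece l u) f p).
  move=> u; pose v (p : BM * nat) := head (pibar S (iter (size u) ind p.1)).
  have vE j : piece l u `&` [set p | v p = j] = piece l (rcons u j).
    apply/seteqP; split=> [[y l'] [[/= [h1 h2] ->] vy]|[y l'] [/= [h1]]].
      split=> //=; split=> //; rewrite -cats1; apply/(ycyl_cat nuh).
      by split=> //; split; [apply: (induced_iter nuh); case: h2|split].
    rewrite -cats1 => /(ycyl_cat nuh)[h2 [_ [h3 _]]] ->.
    by split.
  rewrite (@Rintegral_values _ _ _ (muDelta S) f c mf f_le v J.+1 (piece l u)) //.
  - by apply: eq_bigr => j _; rewrite vE.
  - by move=> j; rewrite vE.
  - by move=> p _; rewrite ltnS letter_le.
rewrite (sum_stop_mass h tauJ addp) /piece; congr Rintegral; rewrite [X in _ = X `*` _]setIidl//.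
by move=> y [[Yy _] _].
Qed.

Lemma piece_integral l u g e : u != [::] -> 0 <= e ->
  (starts_above J ret l u -> forall y, ycyl J u y -> `|f (y, l) - g| <= e) ->
  `|\int[muDelta S]_(p in piece l u) f p - floor_mass * (g * started J ret word_mass l u)|
    <= floor_mass * (e * started J ret word_mass l u).
Proof.
move=> u0 e0 fg; rewrite /piece (floor_base_ycyl l u0) /started; case: ifP => lu.
  rewrite !mul1r.
  have mE : mass (muDelta S) (ycyl J u `*` [set l] : set (BM * nat))
      = floor_mass * word_mass u.
    rewrite (mass_slice nuh); [by rewrite (mass_ycyl nuh)|exact: (measurable_ycyl nuh)|].
    move=> y yu; have := floor_base_ycyl l u0; rewrite lu => /seteqP[_ /(_ _ yu)].
    by move=> [[]].
  have -> : floor_mass * (g * word_mass u) = g * (floor_mass * word_mass u) by ring.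
  have -> : floor_mass * (e * word_mass u) = e * (floor_mass * word_mass u) by ring.
  rewrite -mE; apply: (@Rintegral_near _ _ _ (muDelta S) f c g e (ycyl J u `*` [set l])) => //.
    by apply: measurable_slice; exact: (measurable_ycyl nuh).
  by move=> [y l'] [/= yu ->]; exact: fg.
by rewrite set0X Rintegral_set0 !mul0r !mulr0 subrr normr0.
Qed.

Lemma low_floors_integral N : \int[muDelta S]_(p in low_floors N) f p
  = \sum_(l < N) \int[muDelta S]_(p in floor_base l `*` [set (l : nat)]) f p.
Proof.
have lE j : (j < N)%N -> low_floors N `&` [set p | p.2 = j] = floor_base j `*` [set j].
  by move=> jN; apply/seteqP; split=> [[y l] [[/= _ h] <-]|[y l] [/= h ->]].
rewrite (@Rintegral_values _ _ _ (muDelta S) f c mf f_le (fun p => p.2) N).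
- by apply: eq_bigr => j _; rewrite lE.
- exact: measurable_low_floors.
- move=> j; have [jN|jN] := ltnP j N.
    by rewrite lE//; apply: measurable_slice; exact: measurable_floor_base.
  rewrite (_ : _ `&` _ = set0)//; apply/seteqP; split=> [[y l] [[/= lN _] e]|//].
  by move: lN; rewrite e ltnNge jN.
- by move=> p [].
Qed.

Lemma low_floors_estimate N (h : nat -> nat) (g err : nat -> seq nat -> R) :
  (forall l u, 0 <= err l u) ->
  (forall l u y, (l < N)%N -> u \in stop J ret (h l) -> starts_above J ret l u ->
     ycyl J u y -> `|f (y, l) - g l u| <= err l u) ->
  `|\int[muDelta S]_p f p| <= floor_mass * (\sum_(l < N)
      (`|\sum_(u <- stop J ret (h l)) g l u * started J ret word_mass l u|
       + \sum_(u <- stop J ret (h l)) err l u * started J ret word_mass l u))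
    + c * mass (muDelta S) (~` low_floors N).
Proof.
move=> err0 fg; have mL := measurable_low_floors N.
have T0 : 0 <= floor_mass by case/andP: (mean_return_time_inv nuh).
have -> : \int[muDelta S]_p f p = \int[muDelta S]_(p in low_floors N) f p
    + \int[muDelta S]_(p in ~` low_floors N) f p.
  rewrite -Rintegral_setU ?setUv//; [exact: measurableC| |].
    by apply: bounded_integrable f_le _.
  by apply/disj_setPS => p [].
apply: (le_trans (ler_normD _ _)); apply: lerD; last first.
  by apply: Rintegral_bounded f_le _ _ => //; exact: measurableC.
rewrite low_floors_integral; apply: (le_trans (ler_norm_sum _ _ _)).
rewrite mulr_sumr; apply: ler_sum => l _; rewrite (floor_integral l (h l)).
rewrite -[X in `|X|](subrK (floor_mass *
  \sum_(u <- stop J ret (h l)) g l u * started J ret word_mass l u)).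
apply: (le_trans (ler_normD _ _)); rewrite mulrDr addrC; apply: lerD.
  by rewrite normrM (ger0_norm T0).
rewrite !mulr_sumr -sumrB; apply: (le_trans (ler_norm_sum _ _ _)).
rewrite !big_seq; apply: ler_sum => u us; have [_ u0 _] := stopP tauJ us.
by apply: piece_integral => // su y; exact: fg.
Qed.

End tower_integral.

Section floor_masses.
Context {R : realType} (S : nuh_data R) (theta K K0 rho0 : R).
Hypothesis nuh : nonuniformly_hyperbolic S theta K K0 rho0.
Variables J H : nat.
Local Notation ret := (cell_return (tau_cell S) J H).
Hypothesis tauJ : forall j, (0 < ret j)%N.

Lemma started_floor_mass N :
  floor_mass S * (\sum_(l < N) started_mass J ret (word_mass S J) l) <= 1.
Proof.
pose f (_ : Borel (M S) * nat) : R := 1.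
have mf : measurable_fun setT f by exact: measurable_cst.
have f1 p : `|f p| <= 1 by rewrite normr1.
have mL := measurable_low_floors nuh J N.
have e : mass (muDelta S) (low_floors J N) = \int[muDelta S]_(p in low_floors J N) f p.
  by rewrite /f Rintegral_cst// mul1r.
have : mass (muDelta S) (low_floors J N) <= 1.
  by rewrite -lee_fin massE//; exact: probability_le1.
rewrite e (low_floors_integral nuh J mf f1 N); apply: le_trans; rewrite mulr_sumr; apply: ler_sum => l _.
rewrite (@floor_integral _ _ _ _ _ _ nuh J H tauJ f 1 mf f1 l 0) (sum_stop J tauJ) /started_mass mulr_sumr.
apply: ler_sum => j _; rewrite leqNgt tauJ /=.
have := @piece_integral _ _ _ _ _ _ nuh J H _ _ mf f1 l [:: val j] 1 0 isT (lexx _).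
rewrite !mul0r mulr0 mul1r normr_le0 subr_eq0 => /(_ _)/eqP ->//.
by move=> _ y _; rewrite subrr normr0.
Qed.

End floor_masses.

Section exhaustion.
Context {R : realType} (S : nuh_data R) (theta K K0 rho0 : R).
Hypothesis nuh : nonuniformly_hyperbolic S theta K K0 rho0.
Local Notation BM := (Borel (M S)).
Local Notation head J := (letter (idx S) (@cellbar _ S) J).

Let ue := nuh_uniformly_expanding nuh.
Let mF := ue_measurable ue.
Let part := ue_partition ue.
Let mcell := ue_measurable_cell ue.

Let low J : set (Ybar S) := [set x | (code (idx S) (@cellbar _ S) x < J)%N].

Let head_low J x : (head J x < J)%N = (code (idx S) (@cellbar _ S) x < J)%N.
Proof. by rewrite /letter; lia. Qed.

Let measurable_low J : measurable (low J).
Proof.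
rewrite (_ : low J = \bigcup_(j in [set j | (j < J)%N]) [set x | head J x = j]).
  by apply: bigcup_measurable => j _; exact: measurable_letter.
apply/seteqP; split=> [x /= h|x [j /= jJ xj]].
  by exists (head J x) => //=; rewrite head_low.
by rewrite /low /= -head_low xj.
Qed.

Let low_mono : nondecreasing_seq low.
Proof. by move=> i j ij; apply/subsetPset => x; rewrite /low /= => /leq_trans; apply. Qed.

Let low_cover : \bigcup_J low J = setT.
Proof.
apply/seteqP; split=> [x //|x _]; exists (code (idx S) (@cellbar _ S) x).+1 => //.
by rewrite /low /=.
Qed.

Lemma last_letter_small e : 0 < e -> exists J0, forall J, (J0 <= J)%N ->
  word_mass S J [:: J] <= e.
Proof.
move=> e0; have [J0 hJ0] := mass_exhaust (mubar S) measurable_low low_mono e0.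
exists J0 => J /hJ0; apply: le_trans; rewrite low_cover; apply: mass_le.
- exact: (measurable_cyl mF part mcell J [:: J]).
- exact: measurableD.
- move=> x [/= xJ _]; split=> //; rewrite /low /= => h.
  by have := head_low J x; rewrite h xJ ltnn.
Qed.

(** The number N of floors is found before J and stays valid for all larger J: the horizon is
    computed from N, and J is chosen only then. *)
Lemma high_floors_small e : 0 < e -> exists N J0, forall J, (J0 <= J)%N ->
  mass (muDelta S) (~` low_floors J N) <= e.
Proof.
move=> e0; have e2 : 0 < e / 2 by rewrite divr_gt0.
pose V n : set (BM * nat) := [set p | (p.2 < n)%N].
have mV n : measurable (V n).
  rewrite (_ : V n = setT `*` [set l | (l < n)%N]); first exact: measurableX.
  by apply/seteqP; split=> [[y l]|[y l] []].
have ndV : nondecreasing_seq V.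
  by move=> i j ij; apply/subsetPset => x; rewrite /V /= => /leq_trans; apply.
have [N hN] := mass_exhaust (muDelta S) mV ndV e2.
pose U J : set (BM * nat) := (Y S `&` pibar S @^-1` low J) `*` setT.
have mU J : measurable (U J).
  by apply: measurableX => //; exact: (measurable_pibar nuh).
have ndU : nondecreasing_seq U.
  move=> i j ij; apply/subsetPset => -[y l] [/= [Yy yi] _]; split=> //; split=> //.
  by have /subsetPset := low_mono ij; exact.
have [J0 hJ] := mass_exhaust (muDelta S) mU ndU e2.
exists N, J0 => J JJ; have mt := measurable_tower nuh.
have mL := measurable_low_floors nuh J N.
have mVV : measurable (\bigcup_n V n) by exact: bigcupT_measurable.
have mUU : measurable (\bigcup_n U n) by exact: bigcupT_measurable.
rewrite (mass_setD _ (measurableC mL) mt) (tower_null nuh (measurableC mL)) add0r.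
apply: (@le_trans _ _ (mass (muDelta S)
    ((\bigcup_n V n `\` V N) `|` (\bigcup_J U J `\` U J)))).
  apply: mass_le.
  - by apply: measurableI => //; exact: measurableC.
  - by apply: measurableU; exact: measurableD.
  move=> [y l] [/= nL [/= Yy ly]]; have [lN|lN] := ltnP l N; last first.
    by left; split; [exists l.+1 => //; rewrite /V /=|rewrite /V /= ltnNge lN].
  right; split.
    exists (code (idx S) (@cellbar _ S) (pibar S y)).+1 => //.
    by split=> //; split=> //; rewrite /preimage /low /=.
  move=> [/= [_ yJ] _]; apply: nL; split=> //=; split=> //=.
  by rewrite head_low.
apply: (le_trans (massU_le _ _ _)); [exact: measurableD..|].
by rewrite (splitr e); apply: lerD; [exact: hN|exact: hJ].
Qed.

End exhaustion.

(** * Integrals of observables and their transfer to the tower *)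

Section observables.
Context {R : realType} (S : nuh_data R) (theta K K0 rho0 : R).
Hypothesis nuh : nonuniformly_hyperbolic S theta K K0 rho0.
Local Notation BM := (Borel (M S)).

Lemma measurable_orbit n : measurable_fun setT (fun y : BM => iter n (T S) y).
Proof.
elim: n => [|n IH] /=; first exact: measurable_id.
exact: (measurableT_comp (@measurable_funPT _ _ _ _ (T S)) IH).
Qed.

Lemma Rintegral_tower (f : BM -> R) (c : R) : measurable_fun setT f -> (forall x, `|f x| <= c) ->
  \int[mu S]_x f x = \int[muDelta S]_p f (tower_proj p).
Proof.
move=> mf fc; rewrite /Rintegral integral_distribution//.
  by apply/measurable_EFinP.
apply: (@bounded_integrable _ _ _ _ (f \o tower_proj (S := S)) c) => //; last by move=> p; exact: fc.
by apply: measurableT_comp => //; exact: measurable_tower_proj.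
Qed.

Lemma Rintegral_invariant (f : BM -> R) (c : R) k : measurable_fun setT f ->
  (forall x, `|f x| <= c) -> \int[mu S]_x f (iter k (T S) x) = \int[mu S]_x f x.
Proof.
move=> mf fc; elim: k => // k <-.
pose g (x : BM) := f (iter k (T S) x).
have mg : measurable_fun setT g.
  by apply: measurableT_comp => //; exact: measurable_orbit.
transitivity (\int[mu S]_x g (T S x)).
  by apply: eq_Rintegral => x _; rewrite /g -iterSr.
rewrite /Rintegral; congr fine.
have gi : (distribution (mu S) (T S)).-integrable setT (EFin \o g).
  by apply: (@bounded_integrable _ _ _ _ g c) => // x; exact: fc.
have -> : (\int[mu S]_x (g (T S x))%:E = \int[distribution (mu S) (T S)]_x (g x)%:E)%E.
  rewrite integral_distribution//; first exact/measurable_EFinP.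
  apply: (@bounded_integrable _ _ _ _ (g \o T S) c) => //; last by move=> p; exact: fc.
  exact: measurableT_comp.
apply: eq_measure_integral => A mA _; exact: (mu_invariant nuh mA).
Qed.

Lemma measurable_holder (eta : R) (f : BM -> R) : 0 < eta ->
  (forall x y : M S, `|f x - f y| <= mdist x y `^ eta) -> measurable_fun setT f.
Proof.
move=> e0 h; have cf : continuous (f : M S -> R).
  move=> x; apply/cvgrPdist_le => e ep.
  have : ball x (e `^ eta^-1) `<=` [set y | `|f x - f y| <= e].
    move=> y; rewrite ballEmdist /= => xy; apply: (le_trans (h x y)).
    have -> : e = (e `^ eta^-1) `^ eta by rewrite -powRrM mulVf ?gt_eqF// powRr1// ltW.
    by apply: ge0_ler_powR; rewrite ?nnegrE ?(ltW e0) ?mdist_ge0 ?powR_ge0// ltW.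
  by move=> hb; apply: filterS hb _; apply: nbhsx_ballx; exact: powR_gt0.
apply: (measurability _ (RGenOpens.measurableE R)) => _ [_ [a [b ->] <-]].
rewrite setTI; apply: sub_gen_smallest.
by apply: open_comp => // y _; exact: cf.
Qed.

End observables.

(** * Decay for normalized observables *)

Lemma uniform_lower_bound (R : realType) (f : nat -> R) n : (forall i, 0 < f i) ->
  exists2 b, 0 < b & forall i, (i <= n)%N -> b <= f i.
Proof.
move=> f0; elim: n => [|n [b b0 hb]]; first by exists (f 0%N) => // i; rewrite leqn0 => /eqP ->.
exists (Num.min b (f n.+1)); first by rewrite lt_min b0 f0.
move=> i; rewrite leq_eqVlt ltnS ge_min => /predU1P[->|/hb ->//].
by rewrite lexx orbT.
Qed.

Section uniform_bound.
Context {R : realType} (X : Type) (A A' : X -> nat -> nat -> R).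
Hypothesis AA' : decay_rates A A'.
Hypothesis A_gt0 : forall x c n, 0 < A x c n.
Variables (theta1 K1 rho1 Kc delta1 : R) (c0 Nmax : nat).
Hypothesis theta01 : 0 < theta1 < 1.
Hypothesis K1_ge0 : 0 <= K1.
Hypothesis rho01 : 0 <= rho1 < 1.
Hypothesis Kc_ge1 : 1 <= Kc.
Hypothesis delta01 : 0 < delta1 <= 1.

(* The cone aperture L1 satisfies K1 + theta1 L1 = L1 - 1, so that returns map
   the cone of aperture L1 well inside itself. *)
Definition aperture : R := (K1 + 1) / (1 - theta1).

Let t1_gt0 : 0 < 1 - theta1.
Proof. by rewrite subr_gt0; case/andP: theta01. Qed.

Let KL : K1 + theta1 * aperture <= aperture - 1.
Proof. by rewrite /aperture le_eqVlt; apply/orP; left; apply/eqP; field; rewrite gt_eqF. Qed.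

Let L_ge0 : 0 <= aperture - 1.
Proof.
have th0 : 0 <= theta1 by case/andP: theta01 => /ltW.
have a0 : 0 <= aperture by rewrite /aperture; apply: divr_ge0; [exact: addr_ge0|exact: ltW].
by apply: le_trans KL; rewrite addr_ge0// mulr_ge0.
Qed.

Let LL' : aperture - 1 < aperture.
Proof. by rewrite gtrBl. Qed.

Local Notation eL := (expR (aperture + aperture)).

(** All parameters are replaced by bounds. The tail is halved and the masses of the I_k doubled to
    leave room for the letter J; the exponential of twice the aperture is the price of passing from
    the invariant measure to any state. *)
Definition admissible (x : X) (S : nuh_data R) (eta : R) : Prop :=
  exists theta K K0 rho0, nonuniformly_hyperbolic S theta K K0 rho0 /\
  [/\ theta <= theta1, K <= K1, K0 <= Kc & 0 < eta <= 1] /\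
  [/\ rho0 `^ eta <= rho1,
      forall i, mass (mubar S) [set y | (i <= taubar S y)%N] <= (expR (- (aperture + aperture))) * A x c0 i / 2 &
      exists I : seq nat, [/\ forall i, i \in I -> (0 < i <= Nmax)%N,
        \big[gcdn/0%N]_(i <- I) i = 1%N &
        forall i, i \in I -> 2 * (eL * delta1) <= mass (mubar S) [set y | taubar S y = i]]].

Definition unit_holder (S : nuh_data R) (eta : R) (v : M S -> R) : Prop :=
  (forall x, `|v x| <= 1) /\ forall x y, `|v x - v y| <= mdist x y `^ eta.

Lemma product_error (a a' b b' : R) (x y : R) : `|a'| <= 1 -> `|b| <= 2 ->
  `|a - a'| <= x -> `|b - b'| <= y -> `|a * b - a' * b'| <= 2 * x + y.
Proof.
move=> a1 b2 ax bY; rewrite (_ : a * b - a' * b' = (a - a') * b + a' * (b - b')); last by ring.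
apply: (le_trans (ler_normD _ _)); rewrite !normrM; apply: lerD.
  by rewrite mulrC ler_pM.
by rewrite -[y]mul1r ler_pM.
Qed.

Let error_constant (Cg : R) : 4 <= Cg -> [/\ 2 + 2 <= 2 * Cg * 1, 0 <= 2 * Cg & 1 <= 2 * Cg].
Proof. by move=> h; split; lra. Qed.

Let error_sum (Cg a1 a2 a3 a4 : R) : 0 <= Cg -> 0 <= a3 -> 0 <= a4 ->
  2 * (Cg * (a1 + a2)) + Cg * (a3 + a4) <= 2 * Cg * (a1 + a2 + a3 + a4).
Proof.
move=> g0 h3 h4; have := mulr_ge0 g0 h3; have := mulr_ge0 g0 h4.
by rewrite !mulrDr -!mulrA; lra.
Qed.

(** E is quantified before v, so that v = 1 can be inserted later with the same E. The choices are
    made in the order N, H, the mass e1 allowed to the letter J, and J. The shift by n / 8 gives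
    both observables a past in which to contract. *)
Lemma centered_bound : exists c, forall x S eta, admissible x S eta ->
  forall w, unit_holder eta w -> forall n, exists2 E, `|E| <= 1 &
  forall v, unit_holder eta v ->
  `|\int[mu S]_y (v (iter (n %/ 8) (T S) y) * (w (iter (n + n %/ 8) (T S) y) - E))|
    <= A' x c n.
Proof.
have [c hc] := tower_estimate AA' theta01 L_ge0 LL' KL c0 Nmax delta01 rho01.
pose Cg := 4 * Kc ^+ 2.
have Cg4 : 4 <= Cg by rewrite ler_peMr// exprn_ege1.
have [Cg2 Cg0 Cg1] := error_constant Cg4.
have [c1 hc1] := rate_scale AA' c (Num.trunc (2 * Cg)).+3.
exists c1 => x S eta [theta [K [K0 [rho0 [nuh [[thle Kle K0le eta01] [rhole tail [I [Ir Ig Im]]]]]]]]].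
move=> w [w1 wh] n.
set k := (n %/ 8)%N.
have e0 := rate_gt0 AA' x 0 n.
have [N [J0 hJ0]] := high_floors_small nuh e0.
pose H := (N + n + (k + k))%N.
have [b b0 hb] := uniform_lower_bound H.+1 (A_gt0 x c0).
have eL0 : 0 < eL by exact: expR_gt0.
have eN0 : 0 < expR (- (aperture + aperture)) by exact: expR_gt0.
(* Three demands on the mass of J: it fits in the spare half of the tail bound up to [H.+1], in the
   spare half of the masses of the I_k, and the chance of meeting J before the horizon is at most
   [A' x 0 n]. *)
pose e1 := Num.min (expR (- (aperture + aperture)) * b / 2)
  (Num.min (eL * delta1) (A' x 0 n / (H.+1%:R * eL))).
have d0 : 0 < delta1 by case/andP: delta01.
have e10 : 0 < e1.
  by rewrite !lt_min !divr_gt0 ?mulr_gt0.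
have [J1 hJ1] := last_letter_small nuh e10.
pose J := maxn J0 J1.
have /hJ0 hrest : (J0 <= J)%N by rewrite leq_maxl.
have /hJ1 : (J1 <= J)%N by rewrite leq_maxr.
rewrite !le_min => /andP[pJ1 /andP[pJ2 pJ3]].
have tcell := taubar_cell nuh.
have tge1 := nuh_tau_ge1 nuh.
have ue := nuh_uniformly_expanding nuh.
have th01 := nuh_theta nuh.
have K0' : 0 <= K by apply: ltW; exact: nuh_K nuh.
have Lle : K / (1 - theta) <= aperture.
  have t0 : 0 < 1 - theta by rewrite subr_gt0; case/andP: th01.
  rewrite /aperture ler_pM ?invr_ge0 ?(ltW t0)//.
    by apply: le_trans Kle _; rewrite lerDl.
  by rewrite lef_pV2 ?posrE// lerB.
pose m := fun u => mass (mbar S) (cyl (Fbar S) (idx S) (@cellbar _ S) J u).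
pose ret := cell_return (tau_cell S) J H.
have pC : cone J m theta1 aperture (word_mass S J).
  exact: (expanding_cone th01 K0' ue (nuh_mubar_ac nuh) (nuh_mubar_invariant nuh) thle Lle J).
have ch : chain A theta1 K1 aperture c0 Nmax delta1 x J H ret m.
  apply: (expanding_chain th01 K0' ue (nuh_mubar_ac nuh) (nuh_mubar_invariant nuh)
    tcell tge1 thle Kle Lle _ _ Ir Ig _).
  - move=> i iH; rewrite (splitr (_ * A x c0 i)); apply: lerD; first exact: tail.
    apply: (le_trans pJ1); rewrite ler_wpM2r// ler_wpM2l ?(ltW eN0)//; exact: hb.
  - move=> i; apply: (le_trans (tail i)).
    by rewrite ler_pdivrMr// ler_peMr ?mulr_ge0 ?(ltW eN0) ?(ltW (A_gt0 _ _ _))// ler1n.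
  - by move=> i iI; apply: le_trans (Im i iI); rewrite mulr_natl mulr2n lerD2l.
have tau0 := chain_tau ch.
pose gw := approximant (S := S) J H w k.
pose eta' := eL * word_mass S J [:: J].
have hEta nu : cone J m theta1 aperture nu -> nu [:: J] <= eta' * nu [::].
  exact: (expanding_last th01 K0' ue (nuh_mubar_ac nuh) (nuh_mubar_invariant nuh) thle Lle).
pose E := expectation J ret gw (k + k) k m.
have est v : unit_holder eta v -> `|E| <= 1 /\ floor_mass S * \sum_(l < N)
    (`|\sum_(u <- stop J ret (l + n + (k + k)))
         approximant (S := S) J H v k l u * (gw (l + n)%N u - E) * started J ret (word_mass S J) l u|
     + \sum_(u <- stop J ret (l + n + (k + k)))
         word_error rho1 ret J l n k u * started J ret (word_mass S J) l u) <= A' x c n.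
  move=> [v1 vh]; apply: (hc x J H ret m ch (word_mass S J) pC _ n N (floor_mass S) eta'
    (approximant (S := S) J H v k) gw).
  - by rewrite /word_mass /= /mass probability_setT.
  - exact: (mean_return_time_inv nuh).
  - exact: (started_floor_mass nuh tau0).
  - by rewrite /H leqnn.
  - by rewrite mulr_ge0 ?(ltW eL0)// mass_ge0.
  - exact: hEta.
  - by rewrite /eta' mulrA mulrC -ler_pdivlMr ?mulr_gt0.
  - by move=> s u; exact: approximant_le.
  - by move=> s u; exact: approximant_le.
  - by move=> s j u js; rewrite /gw /= js.
  - by move=> l u u' hu; exact: approximant_prefix.
exists E; first by have [] := est w (conj w1 wh).
move=> v [v1 vh]; have [E1 hE] := est v (conj v1 vh).
have mv := measurable_holder (andP eta01).1 vh.
have mw := measurable_holder (andP eta01).1 wh.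
pose F (y : Borel (M S)) := v (iter k (T S) y) * (w (iter (n + k) (T S) y) - E).
have mF : measurable_fun setT F.
  apply: measurable_funM; first by apply: measurableT_comp => //; exact: measurable_orbit.
  by apply: measurable_funB => //; apply: measurableT_comp => //; exact: measurable_orbit.
have wE y : `|w y - E| <= 2.
  by apply: (le_trans (ler_normB _ _)); rewrite (_ : 2 = 1 + 1)// lerD.
have F2 y : `|F y| <= 2.
  by rewrite normrM -[leRHS]mul1r ler_pM.
rewrite (Rintegral_tower mF F2).
have mFt : measurable_fun setT (F \o tower_proj (S := S)).
  by apply: measurableT_comp => //; exact: measurable_tower_proj.
have Ft2 p : `|(F \o tower_proj (S := S)) p| <= 2 by exact: F2.
have low := low_floors_estimate nuh tau0 mFt Ft2 (N := N)
  (h := fun l => (l + n + (k + k))%N)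
  (g := fun l u => approximant (S := S) J H v k l u * (gw (l + n)%N u - E))
  (err := fun l u => 2 * Cg * word_error rho1 ret J l n k u).
have we0 l u : 0 <= word_error rho1 ret J l n k u.
  by rewrite /word_error !addr_ge0 ?exprn_ge0//; case/andP: rho01.
apply: le_trans (low _ _) _.
- by move=> l u; rewrite mulr_ge0.
- move=> l u y lN us su yu; rewrite /F /=.
  have [dur u0 uJ] := stopP tau0 us.
  rewrite /tower_proj /= -!iterD.
  have g1 := approximant_le (S := S) J H k l u v1.
  have g2 := approximant_le (S := S) J H k (l + n) u w1.
  (* On words through J the trivial bound 4 is used; it is below [2 * Cg] since Cg >= 4. *)
  have [Ju|Ju] := boolP (J \in u).
    apply: (@le_trans _ _ (2 * Cg * 1)).
      apply: (le_trans (ler_normB _ _)); apply: le_trans Cg2.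
      apply: lerD; rewrite normrM -[leRHS]mul1r ler_pM//.
      by apply: (le_trans (ler_normB _ _)); rewrite (_ : 2 = 1 + 1)// lerD.
    apply: ler_wpM2l => //.
    rewrite /word_error Ju lerDr !addr_ge0 ?exprn_ge0//; case/andP: rho01 => //.
  have gu : good J u.
    apply/allP => j ju; have := allP uJ j ju; rewrite leq_eqVlt => /predU1P[jJ|//].
    by rewrite -jJ ju in Ju.
  have Cgle : 4 * K0 ^+ 2 <= Cg.
    have K00 : 0 <= K0 by apply: (le_trans _ (nuh_K0 nuh)).
    by rewrite ler_wpM2l// lerXn2r ?nnegrE// (le_trans K00).
  have err phi t : unit_holder eta phi -> (t + (k + k) < duration ret u)%N ->
      `|phi (iter (t + k) (T S) y) - approximant (S := S) J H phi k t u|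
        <= Cg * (rho1 ^+ returns_between ret t k u + rho1 ^+ returns_between ret (t + k) k u).
    move=> [_ ph] td; apply: (le_trans (approximant_error nuh eta01 rhole ph gu td yu)).
    rewrite ler_wpM2r// addr_ge0// exprn_ge0//; case/andP: rho01 => //.
  have e2 := err w (l + n)%N (conj w1 wh) dur.
  have e3 : (l + (k + k) < duration ret u)%N.
    by apply: leq_ltn_trans dur; rewrite leq_add2r leq_addr.
  have e4 := err v l (conj v1 vh) e3.
  rewrite (addnC k l) (addnC (n + k)%N l) addnA.
  have e5 : `|w (iter (l + n + k) (T S) y) - E - (gw (l + n)%N u - E)|
      <= Cg * (rho1 ^+ returns_between ret (l + n) k u + rho1 ^+ returns_between ret (l + n + k) k u).
    by rewrite opprB addrA subrK.
  apply: (le_trans (product_error g1 (wE _) e4 e5)).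
  rewrite /word_error (negbTE Ju) addr0.
  have r0 : 0 <= rho1 by case/andP: rho01.
  by apply: error_sum; rewrite ?exprn_ge0// (le_trans _ Cg4).
have hq : 2 * Cg + 2 <= (Num.trunc (2 * Cg)).+3%:R.
  move: (2 * Cg) => q; have -> : (Num.trunc q).+3%:R = (Num.trunc q).+1%:R + 2 :> R.
    by rewrite -addn2 natrD.
  by rewrite lerD2r ltW// truncnS_gt.
have c2 : (2 * Cg) * A' x c n + 2 * A' x 0 n <= A' x c1 n.
  apply: le_trans (hc1 x n); apply: le_trans (ler_wpM2r (ltW (rate_gt0 AA' x c n)) hq).
  by rewrite [leRHS]mulrDl lerD2l ler_wpM2l// (rate_mono AA').
apply: le_trans c2; apply: lerD; last by rewrite ler_wpM2l.
apply: le_trans (ler_wpM2l Cg0 hE).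
rewrite [leRHS]mulrCA; apply: ler_wpM2l; first by case/andP: (mean_return_time_inv nuh).
rewrite mulr_sumr; apply: ler_sum => l _; rewrite mulrDr; apply: lerD.
  by rewrite ler_peMl.
by rewrite [leRHS]mulr_sumr; apply: ler_sum => u _; rewrite [leRHS]mulrA.
Qed.

End uniform_bound.

Section holder_bounds.
Context {R : realType} (M : pointedMetricType R) (eta : R) (v : M -> R).
Hypothesis eta0 : 0 < eta.
Hypothesis hv : holder_space eta v.

Let sup_ge x : (`|v x|%:E <= sup_norm v)%E.
Proof. by apply: ereal_sup_ubound; exists x. Qed.

Let semi_ge x y : ((`|v x - v y| / mdist x y `^ eta)%:E <= holder_seminorm eta v)%E.
Proof. by apply: ereal_sup_ubound; exists (x, y). Qed.

Let sup0 : (0 <= sup_norm v)%E.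
Proof. exact: le_trans (sup_ge point). Qed.

Let semi0 : (0 <= holder_seminorm eta v)%E.
Proof. by apply: le_trans (semi_ge point point); rewrite lee_fin divr_ge0 ?powR_ge0. Qed.

Lemma holder_normE : (fine (holder_norm eta v))%:E = holder_norm eta v.
Proof. by rewrite fineK// ge0_fin_numE// adde_ge0. Qed.

Lemma holder_norm_ge0 : 0 <= fine (holder_norm eta v).
Proof. by rewrite fine_ge0// adde_ge0. Qed.

Lemma holder_norm_sup x : `|v x| <= fine (holder_norm eta v).
Proof. by rewrite -lee_fin holder_normE (le_trans (sup_ge x))// leeDl. Qed.

Lemma holder_norm_dist x y : `|v x - v y| <= fine (holder_norm eta v) * mdist x y `^ eta.
Proof.
have [->|xy] := eqVneq x y.
  by rewrite subrr normr0 mulr_ge0 ?powR_ge0 ?holder_norm_ge0.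
rewrite -ler_pdivrMr ?powR_gt0 ?mdist_gt0//.
by rewrite -lee_fin holder_normE (le_trans (semi_ge x y))// leeDr.
Qed.

End holder_bounds.

Section correlations.
Context {R : realType} (X : Type) (A A' : X -> nat -> nat -> R).
Hypothesis AA' : decay_rates A A'.
Hypothesis A_gt0 : forall x c n, 0 < A x c n.
Variables (theta1 K1 rho1 Kc delta1 : R) (c0 Nmax : nat).
Hypothesis theta01 : 0 < theta1 < 1.
Hypothesis K1_ge0 : 0 <= K1.
Hypothesis rho01 : 0 <= rho1 < 1.
Hypothesis Kc_ge1 : 1 <= Kc.
Hypothesis delta01 : 0 < delta1 <= 1.
Local Notation admissible := (admissible A theta1 K1 rho1 Kc delta1 c0 Nmax).

(** I1 - I2 I3 = (I1 - E I2) - I2 (I3 - E): after shifting by invariance, [centered_bound] gives the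
    first difference with v itself and the second with v = 1. *)
Lemma unit_correlation_bound : exists c, forall x S eta, admissible x S eta ->
  forall v w, unit_holder eta v -> unit_holder eta w -> forall n,
  `|correlation S v w n| <= A' x c n.
Proof.
have [c hc] := centered_bound AA' A_gt0 c0 Nmax theta01 K1_ge0 rho01 Kc_ge1 delta01.
have [c1 hc1] := rate_scale AA' c 2.
exists c1 => x S eta adm v w vu wu n; apply: le_trans (hc1 x n).
have [E E1 hE] := hc x S eta adm w wu n.
have [theta [K [K0 [rho0 [nuh [[_ _ _ /andP[e0 _]] _]]]]]] := adm.
have [v1 vh] := vu; have [w1 wh] := wu.
pose k := (n %/ 8)%N; rewrite -/k in hE.
have mv := measurable_holder e0 vh; have mw := measurable_holder e0 wh.
have mT (u : Borel (M S) -> R) j : measurable_fun setT u ->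
    measurable_fun setT (fun y : Borel (M S) => u (iter j (T S) y)).
  by move=> mu; apply: measurableT_comp => //; exact: measurable_orbit.
have one : unit_holder eta (fun _ : M S => 1).
  by split=> [_|a b]; rewrite ?normr1// subrr normr0 powR_ge0.
have int (u : Borel (M S) -> R) (b : R) : measurable_fun setT u -> (forall y, `|u y| <= b) ->
    (mu S).-integrable setT (EFin \o u).
  by move=> mu ub; exact: bounded_integrable mu ub measurableT.
have V1 : `|\int[mu S]_y v y| <= 1.
  have := Rintegral_bounded (mu S) mv v1 measurableT.
  by rewrite mul1r /mass probability_setT.
have h1 := hE v vu; have h2 := hE _ one.
have e1 : \int[mu S]_y (v (iter k (T S) y) * (w (iter (n + k) (T S) y) - E))
    = \int[mu S]_y (v y * w (iter n (T S) y)) - E * \int[mu S]_y v y.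
  have mvw : measurable_fun setT (fun y : Borel (M S) => v y * w (iter n (T S) y)).
    by apply: measurable_funM => //; exact: mT.
  have vw1 y : `|v y * w (iter n (T S) y)| <= 1.
    by rewrite normrM -[leRHS]mul1r ler_pM.
  have vE1 y : `|E * v y| <= 1 by rewrite normrM -[leRHS]mul1r ler_pM.
  have mEv : measurable_fun setT (fun y : Borel (M S) => E * v y).
    by apply: measurable_funM.
  rewrite -RintegralZl//; last exact: int mv v1.
  rewrite -RintegralB//; [|exact: int mvw vw1|exact: int mEv vE1].
  rewrite -[RHS](@Rintegral_invariant _ _ _ _ _ _ nuh _ (1 + 1) k).
  - apply: eq_Rintegral => y _; rewrite -iterD; ring.
  - exact: measurable_funB.
  - by move=> y; apply: (le_trans (ler_normB _ _)); exact: lerD.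
have e2 : \int[mu S]_y (1 * (w (iter (n + k) (T S) y) - E)) = \int[mu S]_y w y - E.
  have mE : measurable_fun setT (fun y : Borel (M S) => E) by exact: measurable_cst.
  have -> : \int[mu S]_y w y - E = \int[mu S]_y (w y - E).
    rewrite RintegralB//; [|exact: int mw w1|exact: int mE (fun=> E1)].
    have mT1 : fine (mu S setT) = 1 by rewrite probability_setT.
    by rewrite Rintegral_cst// [fine _]mT1 mulr1.
  rewrite -[RHS](@Rintegral_invariant _ _ _ _ _ _ nuh _ (1 + 1) (n + k)).
  - by apply: eq_Rintegral => y _; rewrite mul1r.
  - exact: measurable_funB.
  - by move=> y; apply: (le_trans (ler_normB _ _)); exact: lerD.
rewrite e1 in h1; rewrite e2 in h2; rewrite /correlation.
move: h1 h2 V1; move: (\int[mu S]_y (v y * w _)) (\int[mu S]_y v y) (\int[mu S]_y w y).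
move=> I1 I2 I3 h1 h2 V1.
rewrite (_ : I1 - I2 * I3 = (I1 - E * I2) - I2 * (I3 - E)); last by ring.
apply: (le_trans (ler_normB _ _)); rewrite normrM mulr2n mulrDl mul1r; apply: lerD => //.
by rewrite -[leRHS]mul1r ler_pM.
Qed.

Lemma correlation_bound : exists c, forall x S eta, admissible x S eta ->
  forall v w, holder_space eta v -> holder_space eta w -> forall n,
  `|correlation S v w n|
    <= A' x c n * fine (holder_norm eta v) * fine (holder_norm eta w).
Proof.
have [c hc] := unit_correlation_bound; exists c => x S eta adm v w hv hw n.
have [theta [K [K0 [rho0 [nuh [[_ _ _ /andP[e0 _]] _]]]]]] := adm.
have Nv0 := holder_norm_ge0 eta v; have Nw0 := holder_norm_ge0 eta w.
have A0 := ltW (rate_gt0 AA' x c n).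
have normalize (u : M S -> R) : holder_space eta u -> fine (holder_norm eta u) != 0 ->
    unit_holder eta (fun y => (fine (holder_norm eta u))^-1 * u y) /\
    measurable_fun setT (fun y : Borel (M S) => (fine (holder_norm eta u))^-1 * u y).
  move=> hu N0; have Np : 0 < fine (holder_norm eta u) by rewrite lt0r N0 holder_norm_ge0.
  have uh : unit_holder eta (fun y => (fine (holder_norm eta u))^-1 * u y).
    split=> [y|y z].
      by rewrite normrM gtr0_norm ?invr_gt0// ler_pdivrMl// mulr1 holder_norm_sup.
    by rewrite -mulrBr normrM gtr0_norm ?invr_gt0// ler_pdivrMl// holder_norm_dist.
  by split=> //; case: uh => _; exact: measurable_holder.
have [v0|vN] := eqVneq (fine (holder_norm eta v)) 0.
  have z y : v y = 0 by apply/eqP; rewrite -normr_le0 -v0 holder_norm_sup.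
  rewrite /correlation v0 mulr0 mul0r.
  have -> : \int[mu S]_y (v y * w (iter n (T S) y)) = 0.
    rewrite (@eq_Rintegral _ _ _ _ _ (cst 0)) ?Rintegral_cst ?mul0r//.
    by move=> y _; rewrite z mul0r.
  have -> : \int[mu S]_y v y = 0.
    by rewrite (@eq_Rintegral _ _ _ _ _ (cst 0)) ?Rintegral_cst ?mul0r.
  by rewrite mul0r subrr normr0.
have [w0|wN] := eqVneq (fine (holder_norm eta w)) 0.
  have z y : w y = 0 by apply/eqP; rewrite -normr_le0 -w0 holder_norm_sup.
  rewrite /correlation w0 mulr0.
  have -> : \int[mu S]_y (v y * w (iter n (T S) y)) = 0.
    rewrite (@eq_Rintegral _ _ _ _ _ (cst 0)) ?Rintegral_cst ?mul0r//.
    by move=> y _; rewrite z mulr0.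
  have -> : \int[mu S]_y w y = 0.
    by rewrite (@eq_Rintegral _ _ _ _ _ (cst 0)) ?Rintegral_cst ?mul0r.
  by rewrite mulr0 subrr normr0.
have [vu mv] := normalize v hv vN; have [wu mw] := normalize w hw wN.
set a := fine (holder_norm eta v) in Nv0 vN vu mv *.
set b := fine (holder_norm eta w) in Nw0 wN wu mw *.
have := hc x S eta adm _ _ vu wu n.
have -> : correlation S v w n
    = a * b * correlation S (fun y => a^-1 * v y) (fun y => b^-1 * w y) n.
  have int (u : Borel (M S) -> R) (r : R) : measurable_fun setT u -> (forall y, `|u y| <= r) ->
      (mu S).-integrable setT (EFin \o u).
    by move=> mu ub; exact: bounded_integrable mu ub measurableT.
  have [v1 _] := vu; have [w1 _] := wu.
  rewrite /correlation mulrBr; congr (_ - _).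
    rewrite -RintegralZl//; first by apply: eq_Rintegral => y _; field; rewrite vN wN.
    apply: (int _ 1).
      apply: measurable_funM => //.
      by apply: (measurableT_comp mw); exact: measurable_orbit.
    by move=> y; rewrite normrM -[leRHS]mul1r ler_pM.
  rewrite mulrACA; congr (_ * _); rewrite -RintegralZl//; [|exact: int mv v1| |exact: int mw w1];
    by apply: eq_Rintegral => y _; field.
move=> h; rewrite normrM ger0_norm ?mulr_ge0// -[leRHS]mulrA [leRHS]mulrC.
by rewrite ler_wpM2l ?mulr_ge0.
Qed.

End correlations.

(** * Dependence of the constants on the parameters *)

Section parameter_bounds.
Context {R : realType}.
Variable N : nat.

(** (theta^-1 - 1)^-1 = theta / (1 - theta) <= N means theta <= N / (N + 1); the next such fraction
    lies in ]0, 1[ even for N = 0. *)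
Definition theta_bound : R := N.+1%:R / N.+2%:R.
Definition rho_bound : R := (N.+1%:R / N.+2%:R) `^ N.+1%:R^-1.
Definition cone_aperture : R := aperture theta_bound N%:R.
(** Solves 2 exp (2 aperture) [mass_bound] = 1 / (N + 1), which is at most delta when 1 / delta <=
    N. *)
Definition mass_bound : R := expR (- (cone_aperture + cone_aperture)) / (2 * N.+1%:R).

Let ratio01 : 0 < (N.+1%:R / N.+2%:R : R) < 1.
Proof. by rewrite divr_gt0//= ltr_pdivrMr// mul1r ltr_nat. Qed.

Lemma theta_bound01 : 0 < theta_bound < 1.
Proof. exact: ratio01. Qed.

Lemma rho_bound01 : 0 <= rho_bound < 1.
Proof.
case/andP: ratio01 => r0 r1; rewrite powR_ge0/= /rho_bound.
have i0 : 0 < N.+1%:R^-1 :> R by rewrite invr_gt0.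
have := gt0_ltr_powR i0 (_ : _ \in Num.nneg) (_ : _ \in Num.nneg) r1.
by rewrite powR1; apply; rewrite nnegrE// ltW.
Qed.

Lemma cone_aperture_ge0 : 0 <= cone_aperture.
Proof.
rewrite /cone_aperture /aperture; apply: divr_ge0; first by rewrite addr_ge0.
by rewrite subr_ge0 ltW//; case/andP: theta_bound01.
Qed.

Lemma mass_bound01 : 0 < mass_bound <= 1.
Proof.
rewrite /mass_bound divr_gt0 ?expR_gt0//= ler_pdivrMr// mul1r.
apply: (@le_trans _ _ 1); last by rewrite -natrM ler1n muln_gt0.
by rewrite -expR0 ler_expR oppr_le0 addr_ge0// cone_aperture_ge0.
Qed.

Lemma le_theta_bound (theta : R) : 0 < theta < 1 -> (theta^-1 - 1)^-1 <= N%:R ->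
  theta <= theta_bound.
Proof.
case/andP=> t0 t1; have t2 : 0 < 1 - theta by rewrite subr_gt0.
have -> : (theta^-1 - 1)^-1 = theta / (1 - theta).
  by rewrite -[1 in LHS](mulfV (lt0r_neq0 t0)) -{1}[theta^-1]mul1r -mulrBl invfM invrK mulrC.
rewrite ler_pdivrMr// /theta_bound ler_pdivlMr// -(natr1 N.+1) -(natr1 N).
by move: (N%:R : R) => z h; lra.
Qed.

Lemma le_rho_bound (rho eta : R) : 0 < rho < 1 -> (1 - rho)^-1 <= N%:R ->
  0 < eta -> eta^-1 <= N%:R -> rho `^ eta <= rho_bound.
Proof.
case/andP=> r0 r1 h e0 he; have t2 : 0 < 1 - rho by rewrite subr_gt0.
have [q0 q1] := andP ratio01.
apply: (@le_trans _ _ ((N.+1%:R / N.+2%:R) `^ eta)).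
  apply: ge0_ler_powR; rewrite ?nnegrE ?(ltW e0) ?(ltW r0) ?(ltW q0)//.
  move: h; rewrite -[_^-1]mul1r ler_pdivrMr// ler_pdivlMr// -(natr1 N.+1) -(natr1 N).
  by move: (N%:R : R) => z h; lra.
apply: ger_powR; first by rewrite q0 ltW.
by rewrite invf_ple ?posrE// (le_trans he)// ler_nat.
Qed.

Lemma bounded_admissible (X : Type) (A : X -> nat -> nat -> R) c0 x S
    (theta K K0 rho0 delta eta : R) (I : seq nat) :
  nonuniformly_hyperbolic S theta K K0 rho0 -> return_time_data S I delta ->
  [/\ (theta^-1 - 1)^-1 <= N%:R, K <= N%:R, (\max_(i <- I) i <= N)%N & delta^-1 <= N%:R] ->
  [/\ 0 < eta <= 1, eta^-1 <= N%:R, (1 - rho0)^-1 <= N%:R & K0 <= N%:R] ->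
  (forall i, mass (mubar S) [set y | (i <= taubar S y)%N]
     <= expR (- (cone_aperture + cone_aperture)) * A x c0 i / 2) ->
  admissible A theta_bound N%:R rho_bound N.+1%:R mass_bound c0 N x S eta.
Proof.
move=> nuh rtd [hth hK hI hd] [eta01 he hr hK0] tail.
have [e0 e1] := andP eta01.
exists theta, K, K0, rho0; split=> //; split.
  split=> //; first exact: le_theta_bound (nuh_theta nuh) hth.
  by apply: (le_trans hK0); rewrite ler_nat.
split=> //; first exact: le_rho_bound (nuh_rho0 nuh) hr e0 he.
exists I; split.
- move=> i iI; rewrite (rtd_pos rtd iI) /=; apply: leq_trans hI.
  exact: leq_bigmax_seq.
- exact: (rtd_gcd rtd).
move=> i iI.
have mi : measurable [set y : Ybar S | taubar S y = i].
  rewrite (_ : [set _ | _] = [set x | pred1 i (taubar S x)]).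
    exact: (measurable_return (nuh_uniformly_expanding nuh) (taubar_cell nuh)).
  by apply/seteqP; split=> y /= /eqP.
apply: (@le_trans _ _ delta); last by rewrite -lee_fin massE//; exact: (rtd_mass rtd).
have d0 := rtd_delta rtd.
rewrite -/cone_aperture /mass_bound expRN.
have a0 := expR_gt0 (cone_aperture + cone_aperture).
have -> : 2 * (expR (cone_aperture + cone_aperture) *
    ((expR (cone_aperture + cone_aperture))^-1 / (2 * N.+1%:R))) = N.+1%:R^-1.
  by move: (expR _) a0 => z z0; field; rewrite !gt_eqF.
by rewrite invf_ple ?posrE// (le_trans hd)// ler_nat.
Qed.

End parameter_bounds.

(** * The two tail hypotheses as levels of decay rates *)

Section tails.
Context {R : realType}.
Variable N : nat.
Local Notation L := (@cone_aperture R N).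

Lemma correlation_constant (X : Type) (A A' : X -> nat -> nat -> R) c0 :
  decay_rates A A' -> (forall x c n, 0 < A x c n) ->
  exists c, forall x S eta,
  admissible A (theta_bound N) N%:R (rho_bound N) N.+1%:R (mass_bound N) c0 N x S eta ->
  forall v w, holder_space eta v -> holder_space eta w -> forall n,
  `|correlation S v w n|
    <= A' x c n * fine (holder_norm eta v) * fine (holder_norm eta w).
Proof.
move=> AA' A0; apply: (correlation_bound AA' A0).
- exact: theta_bound01.
- by [].
- exact: rho_bound01.
- by rewrite ler1n.
- exact: mass_bound01.
Qed.

Lemma mass_return_le1 (S : nuh_data R) theta K K0 rho0 i :
  nonuniformly_hyperbolic S theta K K0 rho0 ->
  (mass (mubar S) [set y | (i <= taubar S y)%N])%:E = mubar S [set y | (i <= taubar S y)%N]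
  /\ mass (mubar S) [set y | (i <= taubar S y)%N] <= 1.
Proof.
move=> nuh; have mi : measurable [set y : Ybar S | (i <= taubar S y)%N].
  exact: (measurable_return (nuh_uniformly_expanding nuh) (taubar_cell nuh) (leq i)).
by rewrite massE//; split=> //; rewrite -lee_fin massE//; exact: probability_le1.
Qed.

Lemma polynomial_constant : exists c : nat, forall (S : nuh_data R)
    (theta K K0 rho0 delta Ctau beta eta : R) (I : seq nat),
  nonuniformly_hyperbolic S theta K K0 rho0 -> return_time_data S I delta ->
  1 < beta ->
  (forall n : nat, (1 <= n)%N -> (mubar S [set y | (n <= taubar S y)%N]
     <= (Ctau * n%:R `^ (- beta))%:E)%E) ->
  [/\ (theta^-1 - 1)^-1 <= N%:R, K <= N%:R, (\max_(i <- I) i <= N)%N & delta^-1 <= N%:R] ->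
  [/\ 0 < eta <= 1, eta^-1 <= N%:R, (1 - rho0)^-1 <= N%:R & K0 <= N%:R] ->
  [/\ Ctau <= N%:R, beta <= N%:R & (beta - 1)^-1 <= N%:R] ->
  forall (v w : M S -> R) (n : nat), holder_space eta v -> holder_space eta w -> (1 <= n)%N ->
  `|correlation S v w n| <= c.+1%:R * n%:R `^ (- (beta - 1))
    * fine (holder_norm eta v) * fine (holder_norm eta w).
Proof.
(* The first factors undo those in [admissible], [N.+1] bounds Ctau, and [2 ^+ N.+1] bounds ((i + 1)
   / i)^beta, since the rate uses i + 1 where the tail uses i. *)
pose q : R := 2 * expR (L + L) * (N.+1%:R * 2 ^+ N.+1).
pose c0 := Num.trunc q.
have tail0 (x : power_range N) k n : 0 < @power_tail R N x k n.
  by rewrite mulr_gt0// powR_gt0.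
have [c hc] := correlation_constant c0 (power_decay_rates N) tail0.
exists c => S theta K K0 rho0 delta Ctau beta eta I nuh rtd beta1 tail b1 b2 [bC bb bi].
move=> v w n hv hw n1.
have bp : 0 < beta - 1 by rewrite subr_gt0.
have hx : N.+1%:R^-1 <= beta - 1 <= N.+1%:R.
  apply/andP; split; first by rewrite invf_ple ?posrE// (le_trans bi)// ler_nat.
  by rewrite lerBlDr (le_trans bb)// ler_wpDr// ler_nat.
pose x : power_range N := exist _ (beta - 1) hx.
have adm : admissible (@power_tail R N) (theta_bound N) N%:R (rho_bound N) N.+1%:R
    (mass_bound N) c0 N x S eta.
  apply: (bounded_admissible nuh rtd b1 b2) => i.
  have [mE m1] := mass_return_le1 i nuh.
  have hm : mass (mubar S) [set y | (i <= taubar S y)%N]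
      <= (N.+1%:R * 2 ^+ N.+1) * i.+1%:R `^ (- beta).
    have two : 1 <= 2 ^+ N.+1 :> R by rewrite exprn_ege1// ler1n.
    case: i mE m1 => [|i] mE m1.
      by rewrite powR1 mulr1 (le_trans m1)// mulr_ege1// ler1n.
    have := tail i.+1 isT; rewrite -mE lee_fin => /le_trans; apply.
    apply: (@le_trans _ _ (N.+1%:R * i.+1%:R `^ (- beta))).
      by rewrite ler_wpM2r ?powR_ge0// (le_trans bC)// ler_nat.
    rewrite -mulrA ler_wpM2l// !powRN.
    have y0 : 0 < i.+1%:R `^ beta :> R by rewrite powR_gt0.
    have z0 : 0 < i.+2%:R `^ beta :> R by rewrite powR_gt0.
    rewrite ler_pdivlMr// ler_pdivrMl//.
    apply: (@le_trans _ _ ((2 * i.+1%:R) `^ beta)).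
      apply: ge0_ler_powR; rewrite ?nnegrE//; first by rewrite (le_trans ler01)// ltW.
      by rewrite -natrM ler_nat; clear; lia.
    rewrite powRM// mulrC ler_wpM2l ?(ltW y0)// -powR_mulrn//.
    by rewrite ler_powR ?ler1n// (le_trans bb)// ler_nat.
  rewrite expRN /power_tail /= subrK ler_pdivlMr// ler_pdivlMl ?expR_gt0//.
  apply: (@le_trans _ _ (q * i.+1%:R `^ (- beta))).
    rewrite (_ : q * _ = expR (L + L) * (N.+1%:R * 2 ^+ N.+1 * i.+1%:R `^ (- beta) * 2)).
      by rewrite ler_wpM2l ?expR_ge0// ler_wpM2r.
    by rewrite /q; ring.
  by rewrite ler_wpM2r ?powR_ge0// ltW// truncnS_gt.
have := hc x S eta adm v w hv hw n; move/le_trans; apply.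
rewrite ler_wpM2r ?holder_norm_ge0// ler_wpM2r ?holder_norm_ge0//.
rewrite /power_rate /= ler_wpM2l// !powRN lef_pV2 ?posrE ?powR_gt0//; last by rewrite ltr0n.
by apply: ge0_ler_powR; rewrite ?nnegrE ?(ltW bp)// ler_nat.
Qed.

Lemma stretched_constant : exists c : nat, forall (S : nuh_data R)
    (theta K K0 rho0 delta Ctau a gamma eta : R) (I : seq nat),
  nonuniformly_hyperbolic S theta K K0 rho0 -> return_time_data S I delta ->
  0 < a -> 0 < gamma <= 1 ->
  (forall n : nat, (1 <= n)%N -> (mubar S [set y | (n <= taubar S y)%N]
     <= (Ctau * expR (- a * n%:R `^ gamma))%:E)%E) ->
  [/\ (theta^-1 - 1)^-1 <= N%:R, K <= N%:R, (\max_(i <- I) i <= N)%N & delta^-1 <= N%:R] ->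
  [/\ 0 < eta <= 1, eta^-1 <= N%:R, (1 - rho0)^-1 <= N%:R & K0 <= N%:R] ->
  [/\ Ctau <= N%:R, a^-1 <= N%:R & gamma^-1 <= N%:R] ->
  forall (v w : M S -> R) (n : nat), holder_space eta v -> holder_space eta w -> (1 <= n)%N ->
  `|correlation S v w n| <= c.+1%:R * expR (- c.+1%:R^-1 * n%:R `^ gamma)
    * fine (holder_norm eta v) * fine (holder_norm eta w).
Proof.
pose q : R := 2 * expR (L + L) * N.+1%:R.
(* The level must dominate the prefactor q and also 1 / a <= N, being an inverse rate too. *)
pose c0 := (Num.trunc q + N)%N.
have tail0 (x : stretched_range N) k n : 0 < @stretched_rate R N x k n.
  by rewrite mulr_gt0// expR_gt0.
have [c hc] := correlation_constant c0 (stretched_decay_rates N) tail0.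
exists c => S theta K K0 rho0 delta Ctau a gamma eta I nuh rtd a0 g01 tail b1 b2 [bC ba bg].
move=> v w n hv hw n1; have [g0 g1] := andP g01.
have hx : N.+1%:R^-1 <= gamma <= 1.
  by rewrite g1 andbT invf_ple ?posrE// (le_trans bg)// ler_nat.
pose x : stretched_range N := exist _ gamma hx.
have adm : admissible (@stretched_rate R N) (theta_bound N) N%:R (rho_bound N) N.+1%:R
    (mass_bound N) c0 N x S eta.
  apply: (bounded_admissible nuh rtd b1 b2) => i.
  have [mE m1] := mass_return_le1 i nuh.
  have hm : mass (mubar S) [set y | (i <= taubar S y)%N]
      <= N.+1%:R * expR (- (i%:R `^ gamma / c0.+1%:R)).
    case: i mE m1 => [|i] mE m1.
      rewrite powR0 ?gt_eqF// mul0r oppr0 expR0 mulr1 (le_trans m1)//.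
      by rewrite ler1n.
    have := tail i.+1 isT; rewrite -mE lee_fin => /le_trans; apply.
    apply: (@le_trans _ _ (N.+1%:R * expR (- a * i.+1%:R `^ gamma))).
      by rewrite ler_wpM2r ?expR_ge0// (le_trans bC)// ler_nat.
    rewrite ler_wpM2l// ler_expR mulNr lerN2 mulrC ler_wpM2r ?powR_ge0//.
    rewrite invf_ple ?posrE// (le_trans ba)// ler_nat.
    by rewrite /c0; clear; lia.
  rewrite expRN /stretched_rate /= ler_pdivlMr// ler_pdivlMl ?expR_gt0//.
  apply: (@le_trans _ _ (q * expR (- (i%:R `^ gamma / c0.+1%:R)))).
    rewrite (_ : q * _ = expR (L + L) * (N.+1%:R * expR (- (i%:R `^ gamma / c0.+1%:R)) * 2)).
      by rewrite ler_wpM2l ?expR_ge0// ler_wpM2r.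
    by rewrite /q; ring.
  rewrite ler_wpM2r ?expR_ge0// (le_trans (ltW (truncnS_gt _)))// ler_nat.
  by rewrite /c0 ltnS leq_addr.
have := hc x S eta adm v w hv hw n; move/le_trans; apply.
rewrite ler_wpM2r ?holder_norm_ge0// ler_wpM2r ?holder_norm_ge0//.
by rewrite /stretched_rate /= mulNr [_^-1 * _]mulrC.
Qed.

End tails.

(** * Continuous majorants of constants indexed by integers *)

Section majorant.
Context {R : realType}.
Variable a : nat -> R.
Hypothesis a_gt0 : forall i, 0 < a i.

(** The levels found for each N come from a choice and carry no monotonicity. Summand i is the hinge
    2 a_i max(0, x + 1 - i): zero up to i - 1 and at least a_i from i on. The infinite sum is thus
    locally finite, continuous, and above a at the integer part. *)
Definition hinge_sum (m : nat) (x : R) : R :=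
  \sum_(i < m) a i * (x + 1 - i%:R + `|x + 1 - i%:R|).

Definition majorant (x : R) : R := hinge_sum (Num.trunc x).+2 x.

Lemma hinge_sum_stable m m' x : x + 1 <= m%:R -> (m <= m')%N ->
  hinge_sum m' x = hinge_sum m x.
Proof.
move=> xm mm'; rewrite -(subnKC mm') /hinge_sum big_split_ord /= [X in _ + X]big1 ?addr0//.
move=> i _; rewrite ler0_norm ?subrr ?mulr0// subr_le0 (le_trans xm)// ler_nat.
exact: leq_addr.
Qed.

Lemma majorantE m x : x + 1 <= m%:R -> majorant x = hinge_sum m x.
Proof.
move=> xm; rewrite /majorant; set k := (Num.trunc x).+2.
have xk : x + 1 <= k%:R by rewrite /k -natr1 lerD2r ltW// truncnS_gt.
by rewrite -(hinge_sum_stable xk (leq_maxl k m)) -(hinge_sum_stable xm (leq_maxr k m)).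
Qed.

Lemma hinge_sum_continuous m : continuous (hinge_sum m).
Proof.
elim: m => [|m IH] x.
  rewrite (_ : hinge_sum 0 = cst 0); first exact: cvg_cst.
  by apply/funext => y; rewrite /hinge_sum big_ord0.
rewrite (_ : hinge_sum m.+1 = fun y => hinge_sum m y + a m * (y + 1 - m%:R + `|y + 1 - m%:R|)).
  have h : (fun y : R => y + 1 - m%:R) @ x --> x + 1 - m%:R.
    by apply: cvgB; [apply: cvgD; [exact: cvg_id|exact: cvg_cst]|exact: cvg_cst].
  apply: cvgD; first exact: IH.
  apply: cvgM; first exact: cvg_cst.
  by apply: cvgD => //; exact: cvg_norm.
by apply/funext => y; rewrite /hinge_sum big_ord_recr.
Qed.

Lemma majorant_continuous : continuous majorant.
Proof.
move=> x; set m := (Num.trunc x).+3.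
have near_eq : {near x, hinge_sum m =1 majorant}.
  near=> y; rewrite (@majorantE m)// /m -natr1 lerD2r -natr1.
  apply: (@le_trans _ _ (x + 1)); last by rewrite lerD2r ltW// truncnS_gt.
  by apply: ltW; near: y; apply: lt_nbhsl; rewrite ltrDl.
rewrite /continuous_at -(nbhs_singleton near_eq).
by apply: cvg_trans (near_eq_cvg near_eq) _; exact: hinge_sum_continuous.
Unshelve. all: by end_near. Qed.

Lemma majorant_ge x : 0 <= x -> a (Num.trunc x) <= majorant x.
Proof.
move=> x0; have /andP[t _] := truncn_itv x0.
have pos (i : nat) : 0 <= a i * (x + 1 - i%:R + `|x + 1 - i%:R|).
  by rewrite mulr_ge0 ?(ltW (a_gt0 i))// -[X in X + _]opprK addrC subr_ge0 -normrN ler_norm.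
have tlt : (Num.trunc x < (Num.trunc x).+2)%N by [].
rewrite /majorant /hinge_sum (bigD1 (Ordinal tlt))//= -[leLHS]addr0.
apply: lerD; last by apply: sumr_ge0.
rewrite ler_peMr ?(ltW (a_gt0 _))//.
have h : 1 <= x + 1 - (Num.trunc x)%:R by rewrite -addrA addrCA lerDl subr_ge0.
by apply: (le_trans h); rewrite lerDl.
Qed.

Lemma majorant_gt0 x : 0 <= x -> 0 < majorant x.
Proof. by move=> x0; apply: lt_le_trans (majorant_ge x0). Qed.

End majorant.

Section coordinates.
Context {R : realType} {T : topologicalType}.

Lemma cvg_fst_comp (A B : topologicalType) (f : T -> A * B) p :
  f @ p --> f p -> (fun q => (f q).1) @ p --> (f p).1.
Proof. by move=> h; apply: (cvg_comp _ _ h); case: (f p) => x y; exact: cvg_fst. Qed.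

Lemma cvg_snd_comp (A B : topologicalType) (f : T -> A * B) p :
  f @ p --> f p -> (fun q => (f q).2) @ p --> (f p).2.
Proof. by move=> h; apply: (cvg_comp _ _ h); case: (f p) => x y; exact: cvg_snd. Qed.

Lemma cvg_natr_comp (f : T -> nat) p : f @ p --> f p -> (fun q => (f q)%:R : R) @ p --> ((f p)%:R : R).
Proof.
move=> h; apply: (cvg_comp _ _ h) => A /nbhs_singleton /= Af.
by rewrite nbhs_principalE => _ ->.
Qed.

End coordinates.

Section parameter_size.
Context {R : realType}.

(** A parameter enters directly where it must be bounded above and through an inverse where it must
    stay away from an end of its domain. The terms are nonnegative on the domain, so a bound on the
    sum bounds each of them. *)
Definition poly_size (p : poly_params R) : R :=
  (p.1.1.1.1.1.1.1.1 - 1)^-1 + p.1.1.1.1.1.1.1.2 + (p.1.1.1.1.1.1.2)%:R + (p.1.1.1.1.1.2)^-1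
  + p.1.1.1.1.2 + p.1.1.1.2 + (p.1.1.1.2 - 1)^-1 + (p.1.1.2)^-1 + (1 - p.1.2)^-1 + p.2.

Definition exp_size (p : exp_params R) : R :=
  (p.1.1.1.1.1.1.1.1.1 - 1)^-1 + p.1.1.1.1.1.1.1.1.2 + (p.1.1.1.1.1.1.1.2)%:R
  + (p.1.1.1.1.1.1.2)^-1 + p.1.1.1.1.1.2 + (p.1.1.1.1.2)^-1 + (p.1.1.1.2)^-1
  + (p.1.1.2)^-1 + (1 - p.1.2)^-1 + p.2.

Lemma poly_size_continuous : {in @poly_domain R, continuous poly_size}.
Proof.
move=> p; rewrite inE => dp.
have c0 : (fun q : poly_params R => q) @ p --> p by exact: cvg_id.
have [[l1 Kp Np d0] C0 b1 /andP[e0 _] [/andP[r0 r1] K01]] :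
    [/\ [/\ 1 < p.1.1.1.1.1.1.1.1, 0 < p.1.1.1.1.1.1.1.2, (0 < p.1.1.1.1.1.1.2)%N & 0 < p.1.1.1.1.1.2],
      0 < p.1.1.1.1.2, 1 < p.1.1.1.2, 0 < p.1.1.2 <= 1 & 0 < p.1.2 < 1 /\ 1 <= p.2].
  by case: p dp c0 => [[[[[[[[l K] n] dl] C] b] e] r] K0] /=.
have x1 : p.1.1.1.1.1.1.1.1 - 1 != 0 by rewrite gt_eqF// subr_gt0.
have x2 : p.1.1.1.2 - 1 != 0 by rewrite gt_eqF// subr_gt0.
have x3 : 1 - p.1.2 != 0 by rewrite gt_eqF// subr_gt0.
rewrite /poly_size.
repeat apply: cvgD;
  repeat first [exact: c0 | exact: cvg_cst | apply: cvg_natr_comp | apply: cvg_fst_comp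
    | apply: cvg_snd_comp | apply: cvgV => //; rewrite ?gt_eqF// | apply: cvgB].
Qed.

Lemma exp_size_continuous : {in @exp_domain R, continuous exp_size}.
Proof.
move=> p; rewrite inE => dp.
have c0 : (fun q : exp_params R => q) @ p --> p by exact: cvg_id.
have [[l1 Kp Np d0] C0 A0 /andP[g0 _] [/andP[e0 _] /andP[r0 r1] K01]] :
    [/\ [/\ 1 < p.1.1.1.1.1.1.1.1.1, 0 < p.1.1.1.1.1.1.1.1.2, (0 < p.1.1.1.1.1.1.1.2)%N
        & 0 < p.1.1.1.1.1.1.2],
      0 < p.1.1.1.1.1.2, 0 < p.1.1.1.1.2, 0 < p.1.1.1.2 <= 1 &
      [/\ 0 < p.1.1.2 <= 1, 0 < p.1.2 < 1 & 1 <= p.2]].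
  by case: p dp c0 => [[[[[[[[[l K] n] dl] C] a] g] e] r] K0] /=.
have x1 : p.1.1.1.1.1.1.1.1.1 - 1 != 0 by rewrite gt_eqF// subr_gt0.
have x3 : 1 - p.1.2 != 0 by rewrite gt_eqF// subr_gt0.
rewrite /exp_size.
repeat apply: cvgD;
  repeat first [exact: c0 | exact: cvg_cst | apply: cvg_natr_comp | apply: cvg_fst_comp
    | apply: cvg_snd_comp | apply: cvgV => //; rewrite ?gt_eqF// | apply: cvgB].
Qed.

End parameter_size.

Lemma system_domain (R : realType) (S : nuh_data R) (theta K K0 rho0 delta : R) (I : seq nat) :
  nonuniformly_hyperbolic S theta K K0 rho0 -> return_time_data S I delta ->
  [/\ 1 < theta^-1, 0 < K, (0 < \max_(i <- I) i)%N & 0 < delta].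
Proof.
move=> nuh rtd; have /andP[t0 t1] := nuh_theta nuh.
split; [by rewrite invf_gt1|exact: (nuh_K nuh)| |exact: (rtd_delta rtd)].
have := rtd_gcd rtd; have := rtd_pos rtd; case: I {rtd} => [|i I] pos; first by rewrite big_nil.
by move=> _; rewrite big_cons leq_max pos// inE eqxx.
Qed.

Section sums.
Context {R : realType}.

Lemma summands_le (x1 x2 x3 x4 x5 x6 x7 x8 x9 x10 : R) :
  [/\ 0 <= x1, 0 <= x2, 0 <= x3, 0 <= x4 & 0 <= x5] ->
  [/\ 0 <= x6, 0 <= x7, 0 <= x8, 0 <= x9 & 0 <= x10] ->
  let s := x1 + x2 + x3 + x4 + x5 + x6 + x7 + x8 + x9 + x10 in
  [/\ 0 <= s, [/\ x1 <= s, x2 <= s, x3 <= s & x4 <= s],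
    [/\ x5 <= s, x6 <= s & x7 <= s] & [/\ x8 <= s, x9 <= s & x10 <= s]].
Proof.
move=> [h1 h2 h3 h4 h5] [h6 h7 h8 h9 h10] s.
by rewrite /s; split; [lra|split; lra|split; lra|split; lra].
Qed.

End sums.

Lemma polynomial_decay (R : realType) : exists C : poly_params R -> R,
    {within @poly_domain R, continuous C} /\
    (forall p, poly_domain p -> 0 < C p) /\
    forall (S : nuh_data R) (theta K K0 rho0 delta Ctau beta eta : R)
      (I : seq nat),
      nonuniformly_hyperbolic S theta K K0 rho0 ->
      return_time_data S I delta ->
      1 < beta -> 0 < Ctau ->
      (forall n : nat, (1 <= n)%N ->
        (mubar S [set y | (n <= taubar S y)%N]
           <= (Ctau * n%:R `^ (- beta))%:E)%E) ->
      0 < eta <= 1 ->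
      forall (v w : M S -> R) (n : nat),
        holder_space eta v -> holder_space eta w -> (1 <= n)%N ->
        `|correlation S v w n|
          <= C (theta^-1, K, (\max_(i <- I) i)%N, delta, Ctau, beta, eta,
                rho0, K0)
             * n%:R `^ (- (beta - 1))
             * fine (holder_norm eta v) * fine (holder_norm eta w).
Proof.
have [c hc] := choice (fun N => polynomial_constant (R := R) N).
(* The index is shifted because the integer bounding a size s is [(Num.trunc s).+1]. *)
pose a i : R := (c i.+1).+1%:R.
have a0 i : 0 < a i by rewrite ltr0n.
have size_le (p : poly_params R) : poly_domain p ->
    let: (l, K, N, d, C, b, e, r, K0) := p in
    [/\ 0 <= poly_size p, [/\ (l - 1)^-1 <= poly_size p, K <= poly_size p,
        N%:R <= poly_size p & d^-1 <= poly_size p],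
      [/\ C <= poly_size p, b <= poly_size p & (b - 1)^-1 <= poly_size p] &
      [/\ e^-1 <= poly_size p, (1 - r)^-1 <= poly_size p & K0 <= poly_size p]].
  case: p => [[[[[[[[l K] N] d] C] b] e] r] K0] /=
    [[l1 Kp Np d0] C0 b1 /andP[e0 _] [/andP[r0 r1] K01]].
  have bp := lt_trans ltr01 b1; have K0p := lt_le_trans ltr01 K01.
  by apply: summands_le; split; rewrite ?invr_ge0 ?subr_ge0 ?ltW ?ltr0n//.
exists (fun p => majorant a (poly_size p)); split; [|split].
- apply: continuous_in_subspaceT => p dp.
  have h : (fun q => majorant a (poly_size q)) @ p --> majorant a (poly_size p).
    apply: cvg_comp; [exact: (poly_size_continuous dp)|exact: majorant_continuous].
  exact: h.
- move=> p dp; apply: majorant_gt0 => //; move: (size_le p dp).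
  by case: p {dp} => [[[[[[[[l K] N] d] C] b] e] r] K0] [].
move=> S theta K K0 rho0 delta Ctau beta eta I nuh rtd b1 C0 tail eta01 v w n hv hw n1.
have dom : poly_domain (theta^-1, K, (\max_(i <- I) i)%N, delta, Ctau, beta, eta, rho0, K0).
  by split=> //; [exact: system_domain nuh rtd|split; [exact: (nuh_rho0 nuh)|exact: (nuh_K0 nuh)]].
have := size_le _ dom; set s := poly_size _ => -[s0 [s1 s2 s3 s4] [s5 s6 s7] [s8 s9 s10]].
have sN x : x <= s -> x <= (Num.trunc s).+1%:R.
  by move=> xs; apply: (le_trans xs); rewrite ltW// truncnS_gt.
have NI : (\max_(i <- I) i <= (Num.trunc s).+1)%N by rewrite -(ler_nat R); exact: sN.
have := hc _ S theta K K0 rho0 delta Ctau beta eta I nuh rtd b1 tail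
  (And4 (sN _ s1) (sN _ s2) NI (sN _ s4)) (And4 eta01 (sN _ s8) (sN _ s9) (sN _ s10))
  (And3 (sN _ s5) (sN _ s6) (sN _ s7)) v w n hv hw n1.
move/le_trans; apply; rewrite ler_wpM2r ?holder_norm_ge0// ler_wpM2r ?holder_norm_ge0//.
rewrite ler_wpM2r ?powR_ge0//.
exact: (majorant_ge a0 s0).
Qed.

Lemma stretched_decay (R : realType) : exists C B : exp_params R -> R,
    {within @exp_domain R, continuous C} /\
    {within @exp_domain R, continuous B} /\
    (forall p, exp_domain p -> 0 < C p /\ 0 < B p) /\
    forall (S : nuh_data R) (theta K K0 rho0 delta Ctau A gamma eta : R)
      (I : seq nat),
      nonuniformly_hyperbolic S theta K K0 rho0 ->
      return_time_data S I delta ->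
      0 < A -> 0 < gamma <= 1 -> 0 < Ctau ->
      (forall n : nat, (1 <= n)%N ->
        (mubar S [set y | (n <= taubar S y)%N]
           <= (Ctau * expR (- A * n%:R `^ gamma))%:E)%E) ->
      0 < eta <= 1 ->
      let p := (theta^-1, K, (\max_(i <- I) i)%N, delta, Ctau, A, gamma, eta,
                rho0, K0) in
      forall (v w : M S -> R) (n : nat),
        holder_space eta v -> holder_space eta w -> (1 <= n)%N ->
        `|correlation S v w n|
          <= C p * expR (- B p * n%:R `^ gamma)
             * fine (holder_norm eta v) * fine (holder_norm eta w).
Proof.
have [c hc] := choice (fun N => stretched_constant (R := R) N).
pose a i : R := (c i.+1).+1%:R.
have a0 i : 0 < a i by rewrite ltr0n.
have size_le (p : exp_params R) : exp_domain p ->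
    let: (l, K, N, d, C, A, g, e, r, K0) := p in
    [/\ 0 <= exp_size p, [/\ (l - 1)^-1 <= exp_size p, K <= exp_size p,
        N%:R <= exp_size p & d^-1 <= exp_size p],
      [/\ C <= exp_size p, A^-1 <= exp_size p & g^-1 <= exp_size p] &
      [/\ e^-1 <= exp_size p, (1 - r)^-1 <= exp_size p & K0 <= exp_size p]].
  case: p => [[[[[[[[[l K] N] d] C] A] g] e] r] K0] /=
    [[l1 Kp Np d0] C0 A0 /andP[g0 _] [/andP[e0 _] /andP[r0 r1] K01]].
  have K0p := lt_le_trans ltr01 K01.
  by apply: summands_le; split; rewrite ?invr_ge0 ?subr_ge0 ?ltW ?ltr0n//.
have size_ge0 (p : exp_params R) : exp_domain p -> 0 <= exp_size p.
  by move=> dp; move: (size_le p dp); case: p {dp} => [[[[[[[[[l K] N] d] C] A] g] e] r] K0] [].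
have cG (p : exp_params R) : p \in @exp_domain R ->
    (fun q => majorant a (exp_size q)) @ p --> majorant a (exp_size p).
  move=> dp; apply: cvg_comp; [exact: (exp_size_continuous dp)|exact: majorant_continuous].
(* One level bounds the prefactor by c + 1 and the rate below by 1 / (c + 1), so B is the inverse of
   C. *)
exists (fun p => majorant a (exp_size p)), (fun p => (majorant a (exp_size p))^-1).
split; [|split; [|split]].
- by apply: continuous_in_subspaceT => p dp; exact: cG.
- apply: continuous_in_subspaceT => p dp; apply: cvgV; last exact: cG.
  by rewrite gt_eqF// majorant_gt0// size_ge0// -in_setE.
- by move=> p dp; rewrite invr_gt0 majorant_gt0// size_ge0.
move=> S theta K K0 rho0 delta Ctau A gamma eta I nuh rtd A0 g01 C0 tail eta01 p v w n hv hw n1.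
have dom : exp_domain p.
  split=> //; [exact: system_domain nuh rtd|split=> //; [exact: (nuh_rho0 nuh)|exact: (nuh_K0 nuh)]].
have := size_le _ dom; rewrite /p; set s := exp_size _ => -[s0 [s1 s2 s3 s4] [s5 s6 s7] [s8 s9 s10]].
have sN x : x <= s -> x <= (Num.trunc s).+1%:R.
  by move=> xs; apply: (le_trans xs); rewrite ltW// truncnS_gt.
have NI : (\max_(i <- I) i <= (Num.trunc s).+1)%N by rewrite -(ler_nat R); exact: sN.
have := hc _ S theta K K0 rho0 delta Ctau A gamma eta I nuh rtd A0 g01 tail
  (And4 (sN _ s1) (sN _ s2) NI (sN _ s4)) (And4 eta01 (sN _ s8) (sN _ s9) (sN _ s10))
  (And3 (sN _ s5) (sN _ s6) (sN _ s7)) v w n hv hw n1.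
have ms : a (Num.trunc s) <= majorant a s by exact: majorant_ge.
move/le_trans; apply; rewrite ler_wpM2r ?holder_norm_ge0// ler_wpM2r ?holder_norm_ge0//.
apply: ler_pM; rewrite ?expR_ge0// ler_expR !mulNr lerN2 ler_wpM2r ?powR_ge0//.
by rewrite lef_pV2 ?posrE ?majorant_gt0// a0.
Qed.

Theorem theorem2p10 (R : realType) :
  (exists C : poly_params R -> R,
    {within @poly_domain R, continuous C} /\
    (forall p, poly_domain p -> 0 < C p) /\
    forall (S : nuh_data R) (theta K K0 rho0 delta Ctau beta eta : R)
      (I : seq nat),
      nonuniformly_hyperbolic S theta K K0 rho0 ->
      return_time_data S I delta ->
      1 < beta -> 0 < Ctau ->
      (forall n : nat, (1 <= n)%N ->
        (mubar S [set y | (n <= taubar S y)%N]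
           <= (Ctau * n%:R `^ (- beta))%:E)%E) ->
      0 < eta <= 1 ->
      forall (v w : M S -> R) (n : nat),
        holder_space eta v -> holder_space eta w -> (1 <= n)%N ->
        `|correlation S v w n|
          <= C (theta^-1, K, (\max_(i <- I) i)%N, delta, Ctau, beta, eta,
                rho0, K0)
             * n%:R `^ (- (beta - 1))
             * fine (holder_norm eta v) * fine (holder_norm eta w)) /\
  (exists C B : exp_params R -> R,
    {within @exp_domain R, continuous C} /\
    {within @exp_domain R, continuous B} /\
    (forall p, exp_domain p -> 0 < C p /\ 0 < B p) /\
    forall (S : nuh_data R) (theta K K0 rho0 delta Ctau A gamma eta : R)
      (I : seq nat),
      nonuniformly_hyperbolic S theta K K0 rho0 ->
      return_time_data S I delta ->
      0 < A -> 0 < gamma <= 1 -> 0 < Ctau ->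
      (forall n : nat, (1 <= n)%N ->
        (mubar S [set y | (n <= taubar S y)%N]
           <= (Ctau * expR (- A * n%:R `^ gamma))%:E)%E) ->
      0 < eta <= 1 ->
      let p := (theta^-1, K, (\max_(i <- I) i)%N, delta, Ctau, A, gamma, eta,
                rho0, K0) in
      forall (v w : M S -> R) (n : nat),
        holder_space eta v -> holder_space eta w -> (1 <= n)%N ->
        `|correlation S v w n|
          <= C p * expR (- B p * n%:R `^ gamma)
             * fine (holder_norm eta v) * fine (holder_norm eta w)).
Proof. by split; [exact: polynomial_decay|exact: stretched_decay]. Qed.
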